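(* The category $\Delta\circlearrowright\Omega$ admits the structure of a generalized Reedy category extending the Reedy structure on $\Delta\circlearrowright\Omega_p$ given by the wide subcategories $(\Delta\circlearrowright\Omega_p)^+$ and $(\Delta\circlearrowright\Omega_p)^-$ and the degree function $d[n\circlearrowright S]=n+|gen(n,S)|$.
   Context: **Trees.** A planar rooted tree $S$ is a finite rooted tree with edge set $E(S)$, vertex set $V(S)$, root edge $\mathbf r=\mathbf r_S$, and a linear order on the inputs of each vertex; vertices may have no inputs; a leaf is an edge which is not the output of any vertex; the tree with one edge and no vertices is allowed. Planar trees are taken up to planar isomorphism (one representative per class). $\Omega_p(S)$ is the free nonsymmetric colored operad on $S$: its colors are the edges of $S$, and it is freely generated by one operation for each vertex, from the ordered list of inputs to the output. $\varnothing$ denotes the empty tree, with $\Omega_p(\varnothing)$ the operad with no colors. **Actions.** An action of a small category $\mathcal C$ (objects $C_0$, morphisms $C_1$, source $s$, target $t$) on a set $A$ consists of $\mu:A\to C_0$ (moment) and $\bullet:\{(f,a)\in C_1\times A:s(f)=\mu(a)\}\to A$ with $\mu(f\bullet a)=t(f)$, $(f\circ f')\bullet a=f\bullet(f'\bullet a)$, $\mathrm{id}_{\mu(a)}\bullet a=a$. For a colored operad $\mathcal O$ let $\mathrm{Mor}(\mathcal O)$ be its set of operations; each operation $g$ has a source $s(g)$ (ordered list of colors) and target $t(g)$ (a color). A *rooted action* of $\mathcal C$ on $\mathcal O$ is an action of $\mathcal C$ on $\mathrm{Mor}(\mathcal O)$ with $\mu(\gamma(g;g_1,\dots,g_k))=\mu(g)$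 for operadic compositions $\gamma$, and $s(f\bullet g)=s(g)$ as ordered lists; if $\mathcal O$ is a symmetric operad one also requires $\sigma^*(f\bullet g)=f\bullet(\sigma^*g)$ for permutations $\sigma$. For a color $c$ put $\mu(c):=\mu(\mathrm{id}_c)$. $\mathcal{RA}^{\mathcal Op}_{ns}$ (resp. $\mathcal{RA}^{\mathcal Op}$) is the category of rooted actions on nonsymmetric (resp. symmetric) colored operads; a morphism $X$ is a functor $X^c$ between acting categories and an operad map $X^d$ with $X^c\mu=\mu X^d$ and $X^d(a\bullet f)=X^c(a)\bullet X^d(f)$. **Objects $[n\circlearrowright S]$** ($n\ge0$, $S$ a planar rooted tree). $[n]$ is the poset $0\le\dots\le n$ as a category. $\mathcal C_{n,S}$ is the disjoint union of $[n]$ and the discrete category on objects $*_e$, $e\in E(S)\setminus\{\mathbf r\}$; $p_{i,j}:i\to j$ is the unique map in $[n]$. $\mathcal O_{0,S}=\Omega_p(S)$ with $\mu(e)=*_e$ for $e\ne\mathbf r$, $\mu(\mathbf r)=0$. $\mathcal O_{n,S}$ is obtained from $\mathcal O_{n-1,S}$ by freely adjoining, for each operation $h$ of $\mathcal O_{n-1,S}$ (identities and composites included) with $\mu(h)=n-1$, a new color $(n,h)$ (distinct for distinct $h$) and a new generating operation $p_{n-1,n}\bullet h$ with source $s(h)$, target $(n,h)$ and moment $n$. The action is $p_{\ell,\ell'}\bullet h=p_{\ell'-1,\ell'}\bullet(\cdots\bullet(p_{\ell,\ell+1}\bullet h))$, identities acting trivially. This rooted action of $\mathcal C_{n,S}$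 on $\mathcal O_{n,S}$ is $[n\circlearrowright S]$; $[n\circlearrowright\varnothing]$ is $[n]$ acting on the empty operad ($\mathcal C_{n,\varnothing}=[n]$, $\mathcal O_{n,\varnothing}$ has no colors). $\Delta\circlearrowright\Omega_p$ is the full subcategory of $\mathcal{RA}^{\mathcal Op}_{ns}$ on all $[n\circlearrowright S]$ and $[n\circlearrowright\varnothing]$, $n\ge0$. **The Reedy structure on $\Delta\circlearrowright\Omega_p$.** $gen(n,S)$ is the set of generating operations of $\mathcal O_{n,S}$: the vertices of $S$ together with the adjoined operations $p_{i-1,i}\bullet h$ with $\mu(h)=i-1$, $1\le i\le n$. The degree is $d[n\circlearrowright S]=n+|gen(n,S)|=n+|\mathrm{Col}(\mathcal O_{n,S})|+|V(S)|-|E(S)|$, where $\mathrm{Col}$ denotes the set of colors. A map $X:[n\circlearrowright S]\to[m\circlearrowright R]$ is determined by $\alpha=X^c|_{[n]}:[n]\to\mathcal C_{m,R}$ and $\beta=X^d|_{\mathcal O_{0,S}}:\Omega_p(S)\to\mathcal O_{m,R}$; write $X=(\alpha,\beta)$, $\hat\beta=X^d$. $(\Delta\circlearrowright\Omega_p)^+$: maps with $\alpha$ injective on objects and $\beta$ injective on colors. $(\Delta\circlearrowright\Omega_p)^-$: maps such that every object of $[m]\subseteq\mathcal C_{m,R}$ is in the image of $\alpha$, $\hat\beta:\mathcal O_{n,S}\to\mathcal O_{m,R}$ is surjective on colors, and $\beta$ takes leaves of $S$ to leaves of $R$. **Symmetrization.** $\Sigma$ from nonsymmetric to symmetric colored operads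 is left adjoint to the forgetful functor: $\Sigma\mathcal O$ has the colors of $\mathcal O$ and $(\Sigma\mathcal O)(c_1,\dots,c_n;c)=\coprod_{\sigma\in\Sigma_n}\mathcal O(c_{\sigma(1)},\dots,c_{\sigma(n)};c)$. A rooted action $\mathcal C\circlearrowright\mathcal O$ induces a rooted action of $\mathcal C$ on $\Sigma\mathcal O$ by $f\bullet(\sigma^*g):=\sigma^*(f\bullet g)$, giving $\Sigma:\mathcal{RA}^{\mathcal Op}_{ns}\to\mathcal{RA}^{\mathcal Op}$. $\Delta\circlearrowright\Omega$ is the full subcategory of $\mathcal{RA}^{\mathcal Op}$ on the objects $\Sigma[n\circlearrowright S]$, for $[n\circlearrowright S]$ an object of $\Delta\circlearrowright\Omega_p$. **Strict Reedy category.** A small category $\mathcal R$ with wide subcategories (containing all objects) $\mathcal R^\pm$ and $d:\mathrm{Ob}\,\mathcal R\to\mathbb N$ such that non-identity morphisms in $\mathcal R^+$ (resp. $\mathcal R^-$) raise (resp. lower) degree, and each morphism factors uniquely as a morphism of $\mathcal R^-$ followed by one of $\mathcal R^+$. **Generalized Reedy structure** on a small category $\mathcal R$: wide subcategories $\mathcal R^\pm$ and $d:\mathrm{Ob}\,\mathcal R\to\mathbb N$ such that (i) non-invertible morphisms in $\mathcal R^+$ (resp. $\mathcal R^-$) raise (resp. lower) degree, and isomorphisms of $\mathcal R$ preserve degree; (ii) $\mathcal R^+\cap\mathcal R^-=\mathrm{Iso}(\mathcal R)$, the wide subcategory of all isomorphisms; (iii) every morphism $f$ factors as $f=gh$ with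 $g\in\mathcal R^+$, $h\in\mathcal R^-$, uniquely up to isomorphism; (iv) if $\theta f=f$ with $\theta\in\mathrm{Iso}(\mathcal R)$ and $f\in\mathcal R^-$, then $\theta$ is an identity. **Extending** means: the degree of $\Sigma[n\circlearrowright S]$ is $d[n\circlearrowright S]$, and the functor $\Sigma:\Delta\circlearrowright\Omega_p\to\Delta\circlearrowright\Omega$ sends $(\Delta\circlearrowright\Omega_p)^{\pm}$ into $(\Delta\circlearrowright\Omega)^{\pm}$.
   Formalization: As d[0↻∅]=d[0↻η]=0 (η: one edge, no vertices), the non-invertible positive map [0↻∅]→[0↻η] does not raise d; the Reedy structure is proved for d plus 1 on non-empty trees, and the degree axiom for d itself except for positive maps Σ[0↻∅]→Σ[0↻η]. *)

(* Defs.v *)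
From HB Require Import structures.
From mathcomp Require Import all_boot finmap.
From mathcomp Require Import boolp classical_sets cardinality.

Set Implicit Arguments.
Unset Strict Implicit.
Unset Printing Implicit Defensive.

(* Permutations of {0, ..., k-1} in one-line notation [:: s 0; ...; s k-1].   *)

Definition is_perm (k : nat) (s : seq nat) : bool := perm_eq s (iota 0 k).

(* permute s [:: x_0; ...; x_k-1] = [:: x_(s 0); ...; x_(s k-1)];
   in particular, permute t s is the one-line notation of s \o t.             *)
Definition permute {T : Type} (s : seq nat) (l : seq T) : seq T :=
  pmap (onth l) s.

(* If l_0, ..., l_k-1 are lists with size l_j = size t_j, then perm_graft s ts
   is the permutation of flatten [:: l_0; ...; l_k-1] whose outcome is the
   concatenation of permute t_j l_j for j = s 0, ..., s k-1: the block
   permutation of s composed with the direct sum of the t_j.                  *)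
Definition perm_graft (s : seq nat) (ts : seq (seq nat)) : seq nat :=
  flatten [seq map (addn (sumn (take j (shape ts)))) (nth [::] ts j) | j <- s].

(* perm_ldiv t s is the one-line notation of t^-1 \o s.                       *)
Definition perm_ldiv (t s : seq nat) : seq nat := [seq index j t | j <- s].

Lemma is_perm_size k s : is_perm k s -> size s = k.
Proof. by move=> /perm_size; rewrite size_iota. Qed.

Lemma is_perm_uniq k s : is_perm k s -> uniq s.
Proof. by move=> /perm_uniq ->; exact: iota_uniq. Qed.

Lemma is_perm_mem k s i : is_perm k s -> (i \in s) = (i < k).
Proof. by move=> /perm_mem ->; rewrite mem_iota. Qed.

Lemma is_perm_lt k s : is_perm k s -> all (fun i => i < k) s.
Proof. by move=> h; apply/allP => i; rewrite (is_perm_mem i h). Qed.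

Lemma is_perm_intro k s : uniq s -> size s = k -> all (fun i => i < k) s ->
  is_perm k s.
Proof.
move=> u sz a; apply: uniq_perm => //; first exact: iota_uniq.
have sub : {subset s <= iota 0 k}.
  by move=> i /(allP a); rewrite mem_iota.
by case: (uniq_min_size u sub _) => //; rewrite size_iota sz.
Qed.

Lemma is_perm_iota k : is_perm k (iota 0 k).
Proof. exact: perm_refl. Qed.

Lemma permute_map T U (f : T -> U) s l :
  permute s (map f l) = map f (permute s l).
Proof.
rewrite /permute; elim: s => //= i s ->.
by rewrite onth_map; case: (onth l i).
Qed.

Lemma permute_nth T (x0 : T) s l : all (fun i => i < size l) s ->
  permute s l = [seq nth x0 l i | i <- s].
Proof.
rewrite /permute; elim: s => //= i s IH /andP[il /IH ->].
by rewrite (onthE l) (nth_map x0).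
Qed.

Lemma size_permute T s (l : seq T) : all (fun i => i < size l) s ->
  size (permute s l) = size s.
Proof.
case: l => [|x l]; last by move=> h; rewrite (permute_nth x h) size_map.
by case: s.
Qed.

Lemma permute_iota T (l : seq T) : permute (iota 0 (size l)) l = l.
Proof.
case: l => [|x l] //; rewrite (permute_nth x); last exact/is_perm_lt/is_perm_iota.
by rewrite -[RHS](mkseq_nth x).
Qed.

Lemma permute_self k s : is_perm k s -> permute s (iota 0 k) = s.
Proof.
move=> h; rewrite (permute_nth 0); last by rewrite size_iota; apply: is_perm_lt.
rewrite -[RHS]map_id; apply/eq_in_map => i; rewrite (is_perm_mem i h) => ik.
by rewrite nth_iota.
Qed.

Lemma permuteM T s t (l : seq T) :
  all (fun i => i < size t) s -> all (fun i => i < size l) t ->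
  permute s (permute t l) = permute (permute s t) l.
Proof.
case: l => [|x l].
  by case: t => //; case: s.
move=> hs ht; rewrite (permute_nth x ht) permute_map (permute_nth x) //.
rewrite (permute_nth 0 hs) all_map; apply/allP => i /(allP hs) /=.
by move=> it; apply: (allP ht); rewrite mem_nth.
Qed.

Lemma is_perm_permute k s t : is_perm k s -> is_perm k t ->
  is_perm k (permute s t).
Proof.
move=> hs ht; have hst : all (fun i => i < size t) s.
  by rewrite (is_perm_size ht); apply: is_perm_lt.
apply: is_perm_intro.
- rewrite (permute_nth 0 hst) map_inj_in_uniq ?(is_perm_uniq hs) // => i j.
  move=> /(allP hst) /= hi /(allP hst) /= hj /eqP.
  by rewrite nth_uniq ?(is_perm_uniq ht) // => /eqP.
- by rewrite size_permute // (is_perm_size hs).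
- rewrite (permute_nth 0 hst) all_map; apply/allP => i /(allP hst) /= hi.
  by apply: (allP (is_perm_lt ht)); rewrite mem_nth.
Qed.

Lemma perm_ldivP k s t : is_perm k s -> is_perm k t ->
  is_perm k (perm_ldiv t s) /\ permute (perm_ldiv t s) t = s.
Proof.
move=> hs ht.
have lt : all (fun i => i < k) (perm_ldiv t s).
  rewrite all_map; apply/allP => i; rewrite (is_perm_mem i hs) /=.
  by rewrite -(is_perm_mem i ht) -index_mem (is_perm_size ht).
have e : permute (perm_ldiv t s) t = s.
  rewrite (permute_nth 0) ?(is_perm_size ht) // -map_comp -[RHS]map_id.
  apply/eq_in_map => i; rewrite (is_perm_mem i hs) -(is_perm_mem i ht) => it.
  by rewrite /= nth_index.
split => //; apply: is_perm_intro => //; last first.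
  by rewrite size_map (is_perm_size hs).
rewrite map_inj_in_uniq ?(is_perm_uniq hs) // => i j.
rewrite (is_perm_mem i hs) -(is_perm_mem i ht) => it.
rewrite (is_perm_mem j hs) -(is_perm_mem j ht) => jt.
by move=> /(congr1 (nth 0 t)); rewrite !nth_index.
Qed.

Lemma perm_ldiv_unique k s t r : is_perm k t -> all (fun i => i < k) r ->
  permute r t = s -> r = perm_ldiv t s.
Proof.
move=> ht hr <-; rewrite /perm_ldiv (permute_nth 0) ?(is_perm_size ht) //.
rewrite -map_comp -[LHS]map_id; apply/eq_in_map => i /(allP hr) /= ik.
by rewrite index_uniq ?(is_perm_size ht) ?(is_perm_uniq ht).
Qed.

Definition permutes {T : Type} (ts : seq (seq nat)) (ls : seq (seq T)) :=
  [seq permute p.1 p.2 | p <- zip ts ls].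

Definition valids {T : Type} (ts : seq (seq nat)) (ls : seq (seq T)) :=
  all2 (fun t l => is_perm (size l) t) ts ls.

Lemma permutes_map T U (f : T -> U) ts ls :
  permutes ts (map (map f) ls) = map (map f) (permutes ts ls).
Proof.
elim: ts ls => [|t ts IH] [|l ls] //; rewrite /permutes /= permute_map.
by congr cons; apply: IH.
Qed.

Lemma valids_size T ts (ls : seq (seq T)) : valids ts ls -> size ts = size ls.
Proof. by rewrite /valids; elim: ts ls => [|t ts IH] [|l ls] //= /andP[_ /IH ->]. Qed.

Lemma valids_shape T ts (ls : seq (seq T)) : valids ts ls -> shape ts = shape ls.
Proof.
rewrite /valids; elim: ts ls => [|t ts IH] [|l ls] //= /andP[/is_perm_size -> /IH].
by move=> ->.
Qed.

Lemma permute_addn T d t (l0 l : seq T) : size l0 = d ->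
  permute (map (addn d) t) (l0 ++ l) = permute t l.
Proof.
move=> <-; rewrite /permute; elim: t => //= i t ->.
by rewrite onth_cat ltnNge leq_addr /= addKn.
Qed.

Lemma permute_catl T t (l l' : seq T) : all (fun i => i < size l) t ->
  permute t (l ++ l') = permute t l.
Proof.
rewrite /permute; elim: t => //= i t IH /andP[il /IH ->].
by rewrite onth_cat il.
Qed.

Lemma permute_cat T s t (l : seq T) :
  permute (s ++ t) l = permute s l ++ permute t l.
Proof. by rewrite /permute pmap_cat. Qed.

Lemma permute_block T ts (ls : seq (seq T)) j : valids ts ls -> j < size ls ->
  permute (map (addn (sumn (take j (shape ts)))) (nth [::] ts j)) (flatten ls)
  = nth [::] (permutes ts ls) j.
Proof.
rewrite /valids; elim: ts ls j => [|t ts IH] [|l ls] //= [|j] /andP[h v] jl /=.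
  rewrite (eq_map (g := id)) // map_id permute_catl //; exact: is_perm_lt h.
rewrite -/(permutes ts ls) -IH // -[in RHS](@permute_addn _ (size l) _ l) // -map_comp.
congr permute; apply: eq_map => i /=.
by rewrite (is_perm_size h) addnA.
Qed.

Lemma permute_graft T s ts (ls : seq (seq T)) :
  is_perm (size ls) s -> valids ts ls ->
  permute (perm_graft s ts) (flatten ls) = flatten (permute s (permutes ts ls)).
Proof.
move=> hs v.
have sz : size (permutes ts ls) = size ls.
  by rewrite size_map size_zip (valids_size v) minnn.
rewrite (permute_nth [::]); last by rewrite sz; apply: is_perm_lt.
rewrite /perm_graft; have := is_perm_lt hs; elim: s {hs} => //= j s IH /andP[js hs].
by rewrite permute_cat IH // permute_block.
Qed.

Definition shifts (ts : seq (seq nat)) : seq (seq nat) :=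
  [seq map (addn (sumn (take j (shape ts)))) (nth [::] ts j) | j <- iota 0 (size ts)].

Lemma shape_shifts ts : shape (shifts ts) = shape ts.
Proof.
rewrite /shape /shifts -map_comp -[in RHS](mkseq_nth [::] ts) /mkseq -map_comp.
by apply: eq_map => j /=; rewrite size_map.
Qed.

Lemma size_shifts ts : size (shifts ts) = size ts.
Proof. by rewrite size_map size_iota. Qed.

Lemma perm_graftE s ts : is_perm (size ts) s ->
  perm_graft s ts = flatten (permute s (shifts ts)).
Proof.
move=> hs; rewrite (permute_nth [::]) ?size_shifts; last exact: is_perm_lt.
congr flatten; apply/eq_in_map => j; rewrite (is_perm_mem j hs) => jt.
by rewrite (nth_map 0) ?size_iota // nth_iota.
Qed.

Lemma flatten_iota sh :
  flatten [seq iota (sumn (take j sh)) (nth 0 sh j) | j <- iota 0 (size sh)]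
  = iota 0 (sumn sh).
Proof.
elim/last_ind: sh => // sh n IH.
rewrite size_rcons -addn1 iotaD map_cat flatten_cat sumn_rcons iotaD /=.
rewrite cats0 !add0n nth_rcons ltnn eqxx -cats1 take_size_cat // -IH.
congr (_ ++ _); congr flatten; apply/eq_in_map => j; rewrite mem_iota /= => js.
by rewrite nth_cat js take_cat js.
Qed.

Lemma perm_flatten2 (T : eqType) (ss tt : seq (seq T)) :
  size ss = size tt -> (forall j, j < size ss -> perm_eq (nth [::] ss j) (nth [::] tt j)) ->
  perm_eq (flatten ss) (flatten tt).
Proof.
elim: ss tt => [|s ss IH] [|t tt] //= [e] h.
by apply: perm_cat; [exact: (h 0)|apply: IH => // j; exact: (h j.+1)].
Qed.

Lemma is_perm_graft s ts :
  is_perm (size ts) s -> all (fun t => is_perm (size t) t) ts ->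
  is_perm (sumn (shape ts)) (perm_graft s ts).
Proof.
move=> hs hts; rewrite /is_perm perm_graftE //.
apply: (@perm_trans _ (flatten (shifts ts))).
  apply: perm_flatten; rewrite -{2}(permute_iota (shifts ts)).
  rewrite size_shifts !(permute_nth [::]) ?size_shifts.
  - exact: perm_map.
  - exact/is_perm_lt/is_perm_iota.
  - exact: is_perm_lt.
rewrite -flatten_iota /shifts size_map; apply: perm_flatten2.
  by rewrite !size_map.
move=> j; rewrite size_map size_iota => jt.
rewrite !(nth_map 0) ?size_iota // !nth_iota // add0n nth_shape.
set d := sumn _; rewrite -[d in X in perm_eq _ X]addn0 iotaDl; apply: perm_map.
by have := all_nthP [::] hts j jt.
Qed.

Lemma permutes_id T (ls : seq (seq T)) :
  permutes [seq iota 0 (size l) | l <- ls] ls = ls.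
Proof.
by elim: ls => //= l ls IH; rewrite /permutes /= permute_iota; congr cons.
Qed.

Lemma label1 T (ks : seq (seq T)) d : exists l : seq (seq nat),
  map size l = map size ks /\ flatten l = iota d (size (flatten ks)).
Proof.
elim: ks d => [|k ks IH] d; first by exists [::].
have [l [e1 e2]] := IH (d + size k); exists (iota d (size k) :: l).
by rewrite /= size_iota e1 e2 size_cat iotaD.
Qed.

Lemma label2 T (kss : seq (seq (seq T))) d : exists l : seq (seq (seq nat)),
  map (map size) l = map (map size) kss /\
  flatten (flatten l) = iota d (size (flatten (flatten kss))).
Proof.
elim: kss d => [|k ks IH] d; first by exists [::].
have [l1 [e1 e2]] := label1 k d.
have [l [e3 e4]] := IH (d + size (flatten k)); exists (l1 :: l).
by rewrite /= e1 e3 !flatten_cat e2 e4 size_cat iotaD.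
Qed.

Definition valids2 {T : Type} (ts : seq (seq nat * seq (seq nat)))
    (ls : seq (seq (seq T))) :=
  all2 (fun t l => is_perm (size l) t.1 && valids t.2 l) ts ls.

Section Assoc.
Variables (T : Type) (s : seq nat) (ts : seq (seq nat * seq (seq nat))).
Variable (ls : seq (seq (seq T))).
Hypothesis hs : is_perm (size ls) s.
Hypothesis v : valids2 ts ls.

Lemma valids2_1 : valids (map fst ts) ls.
Proof.
move: v; rewrite /valids2 /valids.
by elim: ts ls => [|t l IH] [|k m] //= /andP[/andP[-> _] /IH].
Qed.

Lemma valids_cat U (t t' : seq (seq nat)) (l l' : seq (seq U)) : valids t l ->
  valids (t ++ t') (l ++ l') = valids t' l'.
Proof. by rewrite /valids; elim: t l => [|a t IH] [|b l] //= /andP[-> /IH]. Qed.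

Lemma permutes_cat U (t t' : seq (seq nat)) (l l' : seq (seq U)) : size t = size l ->
  permutes (t ++ t') (l ++ l') = permutes t l ++ permutes t' l'.
Proof. by move=> e; rewrite /permutes zip_cat // map_cat. Qed.

Lemma valids2_2 : valids (flatten (map snd ts)) (flatten ls).
Proof.
move: v; rewrite /valids2.
elim: ts ls => [|t l IH] [|k m] //= /andP[/andP[_ h] /IH H].
by rewrite valids_cat.
Qed.

Lemma permutes_flatten : permutes (flatten (map snd ts)) (flatten ls)
  = flatten [seq permutes p.1 p.2 | p <- zip (map snd ts) ls].
Proof.
move: v; rewrite /valids2.
elim: ts ls => [|t l IH] [|k m] //= /andP[/andP[_ h] /IH H].
by rewrite permutes_cat ?(valids_size h) // H.
Qed.

Lemma permute_graft2l :
  permute (perm_graft (perm_graft s (map fst ts)) (flatten (map snd ts)))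
    (flatten (flatten ls)) =
  flatten (flatten (permute s
    [seq permute p.1.1 (permutes p.1.2 p.2) | p <- zip ts ls])).
Proof.
rewrite permute_graft ?valids2_2 //; last first.
  rewrite size_flatten -(valids_shape valids2_1); apply: is_perm_graft.
    by rewrite (valids_size valids2_1).
  move: v; rewrite /valids2.
  elim: ts ls => [|t l IH] [|k m] //= /andP[/andP[h _] /IH ->].
  by rewrite (is_perm_size h) h.
have sz : size (map fst ts) = size ls by rewrite (valids_size valids2_1).
rewrite permutes_flatten permute_graft.
- congr (flatten (flatten (permute _ _))).
  move: v; rewrite /valids2 /permutes.
  elim: ts ls => [|t l IH] [|k m] //= /andP[_ /IH H].
  by congr cons.
- by rewrite size_map size_zip size_map -sz size_map minnn -(size_map fst) sz.
- move: v; rewrite /valids2 /valids.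
  elim: ts ls => [|t l IH] [|k m] //= /andP[/andP[h w] /IH ->].
  by rewrite size_map size_zip (valids_size w) minnn h.
Qed.

Lemma valids2_3 : valids [seq perm_graft t.1 t.2 | t <- ts] (map flatten ls).
Proof.
move: v; rewrite /valids2 /valids.
elim: ts ls => [|t l IH] [|k m] //= /andP[/andP[h w] /IH ->].
rewrite size_flatten -(valids_shape w) is_perm_graft ?(valids_size w) //.
elim: (t.2) (k) w => [|a b IHa] [|c d] //= /andP[w /IHa ->].
by rewrite (is_perm_size w) w.
Qed.

Lemma permute_graft2r :
  permute (perm_graft s [seq perm_graft t.1 t.2 | t <- ts])
    (flatten (flatten ls)) =
  flatten (flatten (permute s
    [seq permute p.1.1 (permutes p.1.2 p.2) | p <- zip ts ls])).
Proof.
have -> : flatten (flatten ls) = flatten (map flatten ls).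
  by elim: (ls) => //= a b <-; rewrite flatten_cat.
rewrite permute_graft ?valids2_3 ?size_map //.
have -> : permutes [seq perm_graft t.1 t.2 | t <- ts] [seq flatten i | i <- ls] =
  map flatten [seq permute p.1.1 (permutes p.1.2 p.2) | p <- zip ts ls].
  move: v; rewrite /valids2 /permutes.
  elim: ts ls => [|t l IH] [|k m] //= /andP[/andP[h w] /IH ->].
  by rewrite permute_graft.
rewrite permute_map.
by elim: (permute _ _) => //= a b ->; rewrite flatten_cat.
Qed.

End Assoc.

Lemma perm_graftA T s ts (ls : seq (seq (seq T))) :
  is_perm (size ls) s -> valids2 ts ls ->
  perm_graft (perm_graft s (map fst ts)) (flatten (map snd ts)) =
  perm_graft s [seq perm_graft t.1 t.2 | t <- ts].
Proof.
move=> hs v; have [L [eL eN]] := label2 ls 0.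
have hs' : is_perm (size L) s by rewrite -(size_map (map size)) eL size_map.
have v' : valids2 ts L.
  move: v eL; rewrite /valids2.
  elim: ts ls L {hs hs' eN} => [|t ts IH] [|l ls] [|m L] //= /andP[/andP[h w] /IH{}IH].
  move=> [e /IH ->]; rewrite -(size_map size) e size_map h /= andbT.
  rewrite /valids; elim: (t.2) (l) (m) e w => [|a b IHa] [|c d] [|c' d'] //=.
  by move=> [-> /IHa{}IHa] /andP[-> /IHa].
set N := size _ in eN.
have szN : size (flatten (flatten L)) = N by rewrite eN size_iota.
rewrite -[LHS](@permute_self N); last first.
  rewrite -szN size_flatten -(valids_shape (valids2_2 v')).
  apply: is_perm_graft.
    rewrite (valids_size (valids2_2 v')) size_flatten -(valids_shape (valids2_1 v')).
    apply: is_perm_graft; first by rewrite (valids_size (valids2_1 v')).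
    elim: (map _ _) (L) (valids2_1 v') => [|a b IH] [|c d] //= /andP[w /IH ->].
    by rewrite (is_perm_size w) w.
  elim: (flatten _) (flatten _) (valids2_2 v') => [|a b IH] [|c d] //= /andP[w /IH ->].
  by rewrite (is_perm_size w) w.
rewrite -[RHS](@permute_self N); last first.
  have -> : N = size (flatten (map flatten L)).
    by rewrite -szN; congr size; elim: (L) => //= a b <-; rewrite flatten_cat.
  rewrite size_flatten -(valids_shape (valids2_3 v')).
  apply: is_perm_graft; first by rewrite (valids_size (valids2_3 v')) size_map.
  elim: (map _ _) (map _ _) (valids2_3 v') => [|a b IH] [|c d] //= /andP[w /IH ->].
  by rewrite (is_perm_size w) w.
by rewrite -eN permute_graft2l // permute_graft2r.
Qed.

Record category := Category {
  ob :> Type;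
  hom : ob -> ob -> Type;
  idc : forall x, hom x x;
  cmp : forall x y z, hom y z -> hom x y -> hom x z;
  cmpA : forall x y z t (f : hom z t) (g : hom y z) (h : hom x y),
    cmp f (cmp g h) = cmp (cmp f g) h;
  cmp1c : forall x y (f : hom x y), cmp (idc y) f = f;
  cmpc1 : forall x y (f : hom x y), cmp f (idc x) = f }.

Arguments hom {c}.
Arguments idc {c}.
Arguments cmp {c x y z}.

Record cfunctor (C D : category) := CFunctor {
  fob :> C -> D;
  fhom : forall x y, hom x y -> hom (fob x) (fob y);
  fhom_id : forall x, fhom (idc x) = idc (fob x);
  fhom_cmp : forall x y z (f : hom y z) (g : hom x y),
    fhom (cmp f g) = cmp (fhom f) (fhom g) }.

Arguments fhom {C D} c {x y}.

Definition cfunctor_id (C : category) : cfunctor C C :=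
  @CFunctor C C id (fun _ _ f => f) (fun _ => erefl) (fun _ _ _ _ _ => erefl).

Definition cfunctor_comp (C D E : category) (G : cfunctor D E) (F : cfunctor C D) :
  cfunctor C E.
Proof.
refine (@CFunctor C E (fun x => G (F x)) (fun _ _ f => fhom G (fhom F f)) _ _).
- by move=> x; rewrite !fhom_id.
- by move=> x y z f g; rewrite !fhom_cmp.
Defined.

(* ocomp g [:: g_1; ...; g_k] is gamma(g; g_1, ..., g_k), defined when the list
   of targets of the g_i is the source of g.                                  *)
Record ns_operad := NsOperad {
  col : Type;
  mor : Type;
  src : mor -> seq col;
  tgt : mor -> col;
  idm : col -> mor;
  ocomp : forall (g : mor) (gs : seq mor), map tgt gs = src g -> mor;
  src_idm : forall c, src (idm c) = [:: c];
  tgt_idm : forall c, tgt (idm c) = c;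
  src_comp : forall g gs (e : map tgt gs = src g),
    src (ocomp e) = flatten (map src gs);
  tgt_comp : forall g gs (e : map tgt gs = src g), tgt (ocomp e) = tgt g;
  comp_idl : forall g (e : map tgt [:: g] = src (idm (tgt g))), ocomp e = g;
  comp_idr : forall g (e : map tgt (map idm (src g)) = src g), ocomp e = g;
  compA : forall (g : mor)
      (ts : seq {p : mor * seq mor | map tgt p.2 = src p.1})
      (e1 : map tgt [seq (sval t).1 | t <- ts] = src g)
      (e2 : map tgt (flatten [seq (sval t).2 | t <- ts]) = src (ocomp e1))
      (e3 : map tgt [seq ocomp (svalP t) | t <- ts] = src g),
    ocomp e2 = ocomp e3 }.

Arguments src {n}.
Arguments tgt {n}.
Arguments idm {n}.
Arguments ocomp {n} g gs e.

Lemma eq_comp (O : ns_operad) (g g' : mor O) gs gs' e e' :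
  g = g' -> gs = gs' -> ocomp g gs e = ocomp g' gs' e'.
Proof.
by move=> eg egs; case: g' / eg e'; case: gs' / egs => e'; congr ocomp.
Qed.

Record operad_map (O P : ns_operad) := OperadMap {
  mcol : col O -> col P;
  mmor : mor O -> mor P;
  src_mmor : forall g, src (mmor g) = map mcol (src g);
  tgt_mmor : forall g, tgt (mmor g) = mcol (tgt g);
  mmor_id : forall c, mmor (idm c) = idm (mcol c);
  mmor_comp : forall g gs e e',
    mmor (ocomp g gs e) = ocomp (mmor g) (map mmor gs) e' }.

Definition operad_map_id (O : ns_operad) : operad_map O O.
Proof.
refine (@OperadMap O O id id _ _ _ _) => // g; first by rewrite map_id.
by move=> gs e e'; apply: eq_comp => //; rewrite map_id.
Defined.

Definition operad_map_comp (O P Q : ns_operad) (G : operad_map P Q)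
  (F : operad_map O P) : operad_map O Q.
Proof.
refine (@OperadMap O Q (fun c => mcol G (mcol F c)) (fun g => mmor G (mmor F g)) _ _ _ _).
- by move=> g; rewrite !src_mmor -map_comp.
- by move=> g; rewrite !tgt_mmor.
- by move=> c; rewrite !mmor_id.
- move=> g gs e e'.
  have e1 : map tgt (map (mmor F) gs) = src (mmor F g).
    rewrite src_mmor -e -!map_comp; apply: eq_map => h /=; exact: tgt_mmor.
  have e2 : map tgt (map (mmor G) (map (mmor F) gs)) = src (mmor G (mmor F g)).
    rewrite src_mmor -e1 -!map_comp; apply: eq_map => h /=; exact: tgt_mmor.
  by rewrite (@mmor_comp _ _ F _ _ e e1) (@mmor_comp _ _ G _ _ e1 e2); apply: eq_comp; rewrite -?map_comp.
Defined.

(* A symmetric operad: sact s g is s^* g, with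
   s^* : O(c_0, ..., c_k-1; c) -> O(c_(s 0), ..., c_(s (k-1)); c).
   comp_sact comprises both equivariance axioms of operadic composition.      *)
Record sym_operad := SymOperad {
  sym_ns :> ns_operad;
  sact : forall (s : seq nat) (g : mor sym_ns), is_perm (size (src g)) s ->
    mor sym_ns;
  src_sact : forall s g (h : is_perm (size (src g)) s),
    src (sact h) = permute s (src g);
  tgt_sact : forall s g (h : is_perm (size (src g)) s), tgt (sact h) = tgt g;
  sact_id : forall g (h : is_perm (size (src g)) (iota 0 (size (src g)))),
    sact h = g;
  sactM : forall s t g (hs : is_perm (size (src g)) s)
      (ht : is_perm (size (src (sact hs))) t)
      (hst : is_perm (size (src g)) (permute t s)),
    sact ht = sact hst;
  comp_sact : forall (g : mor sym_ns) (s : seq nat)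
      (xs : seq {p : mor sym_ns * seq nat | is_perm (size (src p.1)) p.2})
      (hs : is_perm (size (src g)) s)
      (e : map tgt [seq (sval x).1 | x <- xs] = src g)
      (e' : map tgt (permute s [seq sact (svalP x) | x <- xs]) = src (sact hs))
      (h : is_perm (size (src (ocomp g _ e)))
                   (perm_graft s [seq (sval x).2 | x <- xs])),
    ocomp (sact hs) _ e' = sact h }.

Arguments sact {s0} s g h.

Lemma eq_sact (O : sym_operad) s s' (g g' : mor O) h h' :
  s = s' -> g = g' -> sact s g h = sact s' g' h'.
Proof.
by move=> es eg; case: s' / es h'; case: g' / eg => h'; congr sact.
Qed.

(* An element of (Sigma O)(c_0, ..., c_k-1; c): a permutation s together with
   an element of O(c_(s 0), ..., c_(s (k-1)); c).                             *)
Record smor (O : ns_operad) := SMor {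
  smor_src : seq (col O);
  smor_perm : seq nat;
  smor_op : mor O;
  smor_is_perm : is_perm (size smor_src) smor_perm;
  smor_srcE : src smor_op = permute smor_perm smor_src }.

Section Symmetrization.
Variable O : ns_operad.
Implicit Types x y : smor O.

Lemma smor_eq x y : smor_src x = smor_src y -> smor_perm x = smor_perm y ->
  smor_op x = smor_op y -> x = y.
Proof.
case: x y => [a b c h1 h2] [a' b' c' h1' h2'] /= ea eb ec.
case: a' / ea h1' h2'; case: b' / eb; case: c' / ec => h1' h2'.
by rewrite (Prop_irrelevance h1' h1) (Prop_irrelevance h2' h2).
Qed.

Definition smor_tgt x := tgt (smor_op x).

Lemma smor_id_subproof c : src (idm c) = permute (iota 0 1) [:: c] :> seq (col O).
Proof. by rewrite src_idm. Qed.

Definition smor_id (c : col O) : smor O :=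
  @SMor O [:: c] (iota 0 1) (idm c) (is_perm_iota 1) (smor_id_subproof c).

Section Comp.
Variables (x : smor O) (ys : seq (smor O)).
Hypothesis e : map smor_tgt ys = smor_src x.

Lemma smor_comp_e :
  map tgt (permute (smor_perm x) (map (@smor_op O) ys)) = src (smor_op x).
Proof. by rewrite smor_srcE -permute_map -e -map_comp. Qed.

Lemma smor_comp_size : size ys = size (smor_src x).
Proof. by rewrite -e size_map. Qed.

Lemma smor_comp_valids : valids (map (@smor_perm O) ys) (map (@smor_src O) ys).
Proof.
elim: ys => //= y l IH; rewrite /valids /= -/(valids _ _) IH.
by rewrite smor_is_perm.
Qed.

Lemma smor_comp_perm : is_perm (size (flatten (map (@smor_src O) ys)))
  (perm_graft (smor_perm x) (map (@smor_perm O) ys)).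
Proof.
rewrite size_flatten -(valids_shape smor_comp_valids).
apply: is_perm_graft; first by rewrite size_map smor_comp_size smor_is_perm.
by rewrite all_map; elim: ys => //= y l ->; rewrite (is_perm_size (smor_is_perm y)) smor_is_perm.
Qed.

Lemma smor_permutes zs : permutes (map (@smor_perm O) zs) (map (@smor_src O) zs)
  = map src (map (@smor_op O) zs).
Proof.
by elim: zs => //= z l IH; rewrite /permutes /= -/(permutes _ _) IH -smor_srcE.
Qed.

Lemma smor_comp_src : src (ocomp _ _ smor_comp_e) =
  permute (perm_graft (smor_perm x) (map (@smor_perm O) ys))
    (flatten (map (@smor_src O) ys)).
Proof.
rewrite src_comp permute_graft ?smor_comp_valids //.
  by rewrite -permute_map smor_permutes.
by rewrite size_map smor_comp_size smor_is_perm.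
Qed.

Definition smor_comp : smor O := SMor smor_comp_perm smor_comp_src.

End Comp.

Section Act.
Variables (s : seq nat) (x : smor O).
Hypothesis h : is_perm (size (smor_src x)) s.

Lemma smor_act_perm :
  is_perm (size (permute s (smor_src x))) (perm_ldiv s (smor_perm x)).
Proof.
rewrite size_permute ?(is_perm_size h); last exact: is_perm_lt.
by case: (perm_ldivP (smor_is_perm x) h).
Qed.

Lemma smor_act_src : src (smor_op x) =
  permute (perm_ldiv s (smor_perm x)) (permute s (smor_src x)).
Proof.
have [p1 p2] := perm_ldivP (smor_is_perm x) h.
rewrite permuteM ?p2 ?smor_srcE ?(is_perm_size h) //; exact: is_perm_lt.
Qed.

Definition smor_act : smor O := SMor smor_act_perm smor_act_src.

End Act.

Lemma smor_compA (g : smor O)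
      (ts : seq {p : smor O * seq (smor O) | map smor_tgt p.2 = smor_src p.1})
      (e1 : map smor_tgt [seq (sval t).1 | t <- ts] = smor_src g)
      (e2 : map smor_tgt (flatten [seq (sval t).2 | t <- ts]) = smor_src (smor_comp e1))
      (e3 : map smor_tgt [seq smor_comp (svalP t) | t <- ts] = smor_src g) :
    smor_comp e2 = smor_comp e3.
Proof.
have sz : size ts = size (smor_src g) by rewrite -e1 !size_map.

have vals : valids [seq smor_perm (sval t).1 | t <- ts]
    [seq map (@smor_op O) (sval t).2 | t <- ts].
  elim: (ts) => //= t l IH; rewrite /valids /= -/(valids _ _) IH andbT.
  by rewrite size_map (smor_comp_size (svalP t)) smor_is_perm.
apply: smor_eq.
- rewrite /= map_flatten; move: [seq _ | t <- ts] e1 e2 => _ _ _.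
  by elim: ts {e3 sz vals} => //= t ts IH; rewrite flatten_cat IH.
- pose f (t : {p : smor O * seq (smor O) | map smor_tgt p.2 = smor_src p.1}) :=
    (smor_perm (sval t).1, map (@smor_perm O) (sval t).2).
  have /= := @perm_graftA (col O) (smor_perm g) (map f ts)
    [seq map (@smor_src O) (sval t).2 | t <- ts].
  rewrite -!map_comp map_flatten -map_comp; apply; first by rewrite size_map sz smor_is_perm.
  rewrite /valids2; elim: (ts) => //= t l ->; rewrite andbT.
  by rewrite size_map (smor_comp_size (svalP t)) smor_is_perm smor_comp_valids.
- pose F (t : {p : smor O * seq (smor O) | map smor_tgt p.2 = smor_src p.1}) :
    {p : mor O * seq (mor O) | map tgt p.2 = src p.1} :=
    exist _ (smor_op (sval t).1,
      permute (smor_perm (sval t).1) (map (@smor_op O) (sval t).2))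
      (smor_comp_e (svalP t)).
  pose us := permute (smor_perm g) (map F ts).
  have E1 : permute (smor_perm g) (map (@smor_op O) [seq (sval t).1 | t <- ts])
     = [seq (sval u).1 | u <- us] by rewrite -permute_map -!map_comp.
  have E2 : permute (smor_perm (smor_comp e1))
       (map (@smor_op O) (flatten [seq (sval t).2 | t <- ts]))
     = flatten [seq (sval u).2 | u <- us].
    rewrite -permute_map -!map_comp /= map_flatten -!map_comp permute_graft //.
      congr (flatten (permute _ _)).
      by elim: (ts) => //= t l <-.
    by rewrite size_map sz smor_is_perm.
  have E3 : permute (smor_perm g)
       (map (@smor_op O) [seq smor_comp (svalP t) | t <- ts])
     = [seq ocomp _ _ (svalP u) | u <- us].
    rewrite -permute_map -!map_comp; congr (permute _ _); apply: eq_map => t. exact: eq_comp.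
  have f1 : map tgt [seq (sval u).1 | u <- us] = src (smor_op g).
    by rewrite -E1; apply: smor_comp_e e1.
  have f2 : map tgt (flatten [seq (sval u).2 | u <- us]) = src (ocomp _ _ f1).
    rewrite -E2; have := smor_comp_e e2 => ->; rewrite /=.
    by congr src; apply: eq_comp.
  have f3 : map tgt [seq ocomp _ _ (svalP u) | u <- us] = src (smor_op g).
    by rewrite -E3; apply: smor_comp_e e3.
  transitivity (ocomp _ _ f2).
    by apply: eq_comp => //; apply: eq_comp.
  by rewrite (@compA O _ _ f1 f2 f3); apply: eq_comp.
Qed.

Lemma smor_src_comp x ys e : smor_src (@smor_comp x ys e) = flatten (map (@smor_src O) ys).
Proof. by []. Qed.

Lemma smor_tgt_comp x ys e : smor_tgt (@smor_comp x ys e) = smor_tgt x.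
Proof. exact: tgt_comp. Qed.

Lemma permute1 T (a : T) : permute [:: 0] [:: a] = [:: a].
Proof. by []. Qed.

Lemma smor_comp_idl x (e : map smor_tgt [:: x] = smor_src (smor_id (smor_tgt x))) :
  smor_comp e = x.
Proof.
apply: smor_eq; rewrite /= ?cats0 //.
- by rewrite /perm_graft /= cats0 -[RHS]map_id; apply: eq_map.
- have e' : map tgt [:: smor_op x] = src (idm (tgt (smor_op x))).
    by rewrite src_idm.
  by rewrite -[RHS](comp_idl e'); apply: eq_comp.
Qed.

Lemma smor_comp_idr x
  (e : map smor_tgt (map smor_id (smor_src x)) = smor_src x) : smor_comp e = x.
Proof.
apply: smor_eq; rewrite /=.
- by rewrite -map_comp; elim: (smor_src x) => //= c l ->.
- rewrite -map_comp /perm_graft -[RHS]map_id -[RHS]flatten_seq1 -map_comp.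
  congr flatten; apply/eq_in_map => j; rewrite (is_perm_mem j (smor_is_perm x)) => js.
  rewrite /= (nth_map (smor_tgt x)) //= /shape -map_comp; congr [:: _].
  have aux l : sumn [seq size (smor_perm (smor_id c)) | c <- l] = size l.
    by elim: l => //= c l ->.
  by rewrite -map_take aux size_take js addn0.
- have e' : map tgt (map idm (src (smor_op x))) = src (smor_op x).
    by rewrite -map_comp -[RHS]map_id; apply: eq_map => c; exact: tgt_idm.
  rewrite -[RHS](comp_idr e'); apply: eq_comp => //.
  by rewrite smor_srcE -permute_map -!map_comp.
Qed.

Lemma smor_tgt_id c : smor_tgt (smor_id c) = c.
Proof. exact: tgt_idm. Qed.

Definition sym_ns_operad : ns_operad :=
  @NsOperad (col O) (smor O) (@smor_src O) smor_tgt smor_id smor_comp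
    (fun=> erefl) smor_tgt_id smor_src_comp smor_tgt_comp smor_comp_idl
    smor_comp_idr smor_compA.

Lemma smor_act_id x (h : is_perm (size (smor_src x)) (iota 0 (size (smor_src x)))) :
  smor_act h = x.
Proof.
apply: smor_eq => //=; first by rewrite permute_iota.
rewrite -[RHS]map_id; apply/eq_in_map => j.
rewrite (is_perm_mem j (smor_is_perm x)) => js.
by rewrite -[X in index X _](@nth_iota 0 0 (size (smor_src x))) // index_uniq ?size_iota ?iota_uniq.
Qed.

Lemma smor_actM s t x (hs : is_perm (size (smor_src x)) s)
  (ht : is_perm (size (smor_src (smor_act hs))) t)
  (hst : is_perm (size (smor_src x)) (permute t s)) : smor_act ht = smor_act hst.
Proof.
have szs := is_perm_size hs.
have ht' : is_perm (size (smor_src x)) t.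
  by move: ht; rewrite /= size_permute ?szs //; exact: is_perm_lt.
apply: smor_eq => //=.
  rewrite permuteM ?szs //; exact: is_perm_lt.
have [p1 q1] := perm_ldivP (smor_is_perm x) hs.
have [p2 q2] := perm_ldivP p1 ht'.
apply: (perm_ldiv_unique hst); first exact: is_perm_lt p2.
rewrite permuteM ?q2 ?q1 ?(is_perm_size ht') ?szs //; exact: is_perm_lt.
Qed.

Lemma smor_comp_act (g : smor O) (s : seq nat)
      (xs : seq {p : smor O * seq nat | is_perm (size (smor_src p.1)) p.2})
      (hs : is_perm (size (smor_src g)) s)
      (e : map smor_tgt [seq (sval z).1 | z <- xs] = smor_src g)
      (e' : map smor_tgt (permute s [seq smor_act (svalP z) | z <- xs])
            = smor_src (smor_act hs))
      (h : is_perm (size (smor_src (smor_comp e)))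
                   (perm_graft s [seq (sval z).2 | z <- xs])) :
    smor_comp e' = smor_act h.
Proof.
have sz : size xs = size (smor_src g) by rewrite -e !size_map.
have szs := is_perm_size hs.
have [p1 q1] := perm_ldivP (smor_is_perm g) hs.
have v : valids [seq (sval z).2 | z <- xs] [seq smor_src (sval z).1 | z <- xs].
  by rewrite /valids; elim: (xs) => //= z l ->; rewrite andbT; exact: (svalP z).
have srcs : [seq smor_src (smor_act (svalP z)) | z <- xs] =
    permutes [seq (sval z).2 | z <- xs] [seq smor_src (sval z).1 | z <- xs].
  by rewrite /permutes; elim: (xs) => //= z l ->.
apply: smor_eq => //.
- rewrite /= -[map _ [seq _ | z <- xs]]map_comp permute_graft ?size_map ?sz //.
  by rewrite -permute_map -map_comp srcs.
- have szp : forall w : {p : smor O * seq nat | is_perm (size (smor_src p.1)) p.2},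
      size (perm_ldiv (sval w).2 (smor_perm (sval w).1)) = size (sval w).2.
    by move=> w; rewrite size_map (is_perm_size (svalP w)) (is_perm_size (smor_is_perm _)).
  apply: (perm_ldiv_unique h).
    have := smor_is_perm (smor_comp e').
    rewrite /= -permute_map -map_comp => /is_perm_lt.
    suff -> : size (flatten (permute s [seq smor_src (smor_act (svalP z)) | z <- xs])) =
      size (flatten [seq smor_src i | i <- [seq (sval z).1 | z <- xs]]) by [].
    rewrite srcs -permute_graft ?size_map ?sz // -map_comp.
    rewrite size_permute; last first.
      apply: is_perm_lt; move: h; by rewrite /= -map_comp.
    by rewrite (is_perm_size h) /= -map_comp.
  rewrite /= -permute_map -!map_comp.
  rewrite [in X in permute _ X]perm_graftE ?size_map ?sz //.
  rewrite [RHS]perm_graftE ?size_map ?sz ?smor_is_perm //.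
  have ks : all (fun i => i < size xs) s by rewrite sz; exact: is_perm_lt.
  have vv : valids [seq perm_ldiv (sval z).2 (smor_perm (sval z).1) | z <- xs]
      (shifts [seq (sval z).2 | z <- xs]).
    have := shape_shifts [seq (sval z).2 | z <- xs].
    rewrite /valids; elim: (xs) (shifts _) => [|z l IH] [|k m] //= [e1 /IH ->].
    rewrite e1 (is_perm_size (svalP z)) andbT.
    by case: (perm_ldivP (smor_is_perm (sval z).1) (svalP z)).
  have vvp : valids (permute s [seq perm_ldiv (sval z).2 (smor_perm (sval z).1) | z <- xs])
      (permute s (shifts [seq (sval z).2 | z <- xs])).
    rewrite !(permute_nth [::]) ?size_shifts ?size_map //.
    rewrite /valids; elim: (s) ks => //= i l IH /andP[ki /IH ->]; rewrite andbT.
    have := vv; rewrite /valids all2E => /andP[/eqP ee /(all_nthP ([::], [::])) /(_ i)].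
    rewrite size_zip -ee minnn size_map => /(_ ki).
    by rewrite nth_zip.
  transitivity (flatten (permute (perm_ldiv s (smor_perm g))
      (permutes (permute s [seq perm_ldiv (sval z).2 (smor_perm (sval z).1) | z <- xs])
        (permute s (shifts [seq (sval z).2 | z <- xs]))))).
    apply: permute_graft vvp.
    by rewrite size_permute ?size_shifts ?size_map // szs.
  have pp : permutes (permute s [seq perm_ldiv (sval z).2 (smor_perm (sval z).1) | z <- xs])
      (permute s (shifts [seq (sval z).2 | z <- xs]))
     = permute s (permutes [seq perm_ldiv (sval z).2 (smor_perm (sval z).1) | z <- xs]
         (shifts [seq (sval z).2 | z <- xs])).
    have szz : size (permutes [seq perm_ldiv (sval z).2 (smor_perm (sval z).1) | z <- xs]
         (shifts [seq (sval z).2 | z <- xs])) = size xs.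
      by rewrite size_map size_zip size_map size_shifts size_map minnn.
    rewrite !(permute_nth [::]) ?szz ?size_shifts ?size_map //.
    rewrite /permutes; elim: (s) ks => //= i l IH /andP[ki /IH ->].
    rewrite (nth_map ([::],[::])) ?nth_zip //=.
      by rewrite size_shifts !size_map.
    by rewrite size_zip size_shifts !size_map minnn.
  rewrite pp permuteM ?q1; last first.
  + rewrite size_map size_zip size_shifts !size_map minnn sz; exact: is_perm_lt.
  + rewrite szs; exact: is_perm_lt.
  congr (flatten (permute _ _)).
  apply: (@eq_from_nth _ [::]).
    by rewrite size_map size_zip !size_shifts !size_map minnn.
  move=> i; rewrite size_map size_zip size_shifts !size_map minnn => ix.
  have [x0 _] : exists z : {p : smor O * seq nat | is_perm (size (smor_src p.1)) p.2}, True.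
    by case: (xs) ix => // z; exists z.
  rewrite /permutes (nth_map ([::], [::])); last first.
    by rewrite size_zip size_shifts !size_map minnn.
  rewrite nth_zip /=; last by rewrite size_shifts !size_map.
  rewrite !(nth_map 0) ?size_iota ?size_map // !nth_iota ?size_map //.
  rewrite !(nth_map x0) //= permute_map; set y := nth x0 xs i.
  have [_ ->] := perm_ldivP (smor_is_perm (sval y).1) (svalP y).
  congr map; congr addn; congr (sumn (take _ _)).
  rewrite /shape -!map_comp; apply: eq_map => w /=.
  by rewrite (is_perm_size (svalP w)) (is_perm_size (smor_is_perm _)).
- apply: eq_comp => //=.
  rewrite -permute_map -!map_comp permuteM ?q1 // ?szs ?size_map ?sz; exact: is_perm_lt.
Qed.

Definition symmetrization : sym_operad :=
  @SymOperad sym_ns_operad smor_act (fun _ _ _ => erefl) (fun _ _ _ => erefl)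
    smor_act_id smor_actM smor_comp_act.

End Symmetrization.

Record signature := Signature {
  scol : Type;
  sgen : Type;
  sin : sgen -> seq scol;
  sout : sgen -> scol }.

Arguments sin {s}.
Arguments sout {s}.

Lemma flatten_flatten T (s : seq (seq (seq T))) :
  flatten (flatten s) = flatten (map flatten s).
Proof. by elim: s => //= a s <-; rewrite flatten_cat. Qed.

Section FreeOperad.
Variable G : signature.

(* Tgen g [:: t_1; ...; t_k] stands for gamma(g; t_1, ..., t_k).              *)
Inductive term : Type :=
  | Tid of scol G
  | Tgen of sgen G & seq term.

Definition conj_seq {T : Type} (P : T -> Prop) (s : seq T) : Prop :=
  foldr (fun t Q => P t /\ Q) True s.

Lemma term_nested_ind (P : term -> Prop) :
  (forall c, P (Tid c)) ->
  (forall g ts, conj_seq P ts -> P (Tgen g ts)) -> forall t, P t.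
Proof.
move=> h1 h2; fix IH 1 => -[c|g ts]; first exact: h1.
apply: h2; elim: ts => [|t ts IHts]; first exact: I.
by split; [exact: IH|exact: IHts].
Qed.

Fixpoint tleaves (t : term) : seq (scol G) :=
  match t with
  | Tid c => [:: c]
  | Tgen _ ts => flatten (map tleaves ts)
  end.

Definition tout (t : term) : scol G :=
  match t with Tid c => c | Tgen g _ => sout g end.

Fixpoint wt (t : term) : Prop :=
  match t with
  | Tid _ => True
  | Tgen g ts => map tout ts = sin g /\ conj_seq wt ts
  end.

(* The terms hs are grafted on the leaves of t, from left to right.           *)
Fixpoint graft (t : term) (hs : seq term) : term :=
  match t with
  | Tid c => head (Tid c) hs
  | Tgen g ts =>
      Tgen g [seq p.1 p.2 | p <- zip (map graft ts)
        (reshape [seq size (tleaves t) | t <- ts] hs)]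
  end.

Notation arity := (fun t => size (tleaves t)).

Lemma graftE g ts hss : shape hss = map arity ts ->
  graft (Tgen g ts) (flatten hss) =
  Tgen g [seq graft p.1 p.2 | p <- zip ts hss].
Proof.
move=> e /=; rewrite -e flattenK; congr Tgen.
by elim: ts hss e => [|t ts IH] [|h hss] //= [_ /IH ->].
Qed.

Lemma arity_split ts (hs : seq term) : size hs = size (flatten (map tleaves ts)) ->
  exists2 hss, shape hss = map arity ts & hs = flatten hss.
Proof.
move=> e; have E : map arity ts = shape (map tleaves ts) by rewrite /shape -map_comp.
exists (reshape (map arity ts) hs).
  by rewrite reshapeKl // E -size_flatten e.
by rewrite reshapeKr // E -size_flatten e.
Qed.

Lemma tleaves_graft t hs : size hs = size (tleaves t) ->
  tleaves (graft t hs) = flatten (map tleaves hs).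
Proof.
elim/term_nested_ind: t hs => [c|g ts IH] hs.
  by case: hs => [|h [|h' hs]] //= _; rewrite cats0.
move=> /arity_split[hss e ->]; rewrite graftE //= map_flatten flatten_flatten.
congr flatten; elim: ts IH hss e => [|t ts IHts] [] //=.
  by case.
by move=> IHt /IHts{}IHts [|h hss] //= [/IHt -> /IHts ->].
Qed.

Lemma tout_graft t hs : map tout hs = tleaves t -> tout (graft t hs) = tout t.
Proof. by case: t => [c|//] /=; case: hs => [|h [|//]] //= [->]. Qed.

Lemma conj_seq_cat T (P : T -> Prop) s1 s2 :
  conj_seq P (s1 ++ s2) <-> conj_seq P s1 /\ conj_seq P s2.
Proof. by rewrite /conj_seq; elim: s1 => /= [|t s [IH1 IH2]]; tauto. Qed.

Lemma wt_graft t hs : wt t -> conj_seq wt hs -> map tout hs = tleaves t ->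
  wt (graft t hs).
Proof.
elim/term_nested_ind: t hs => [c|g ts IH] hs.
  by case: hs => [|h [|//]] //= _ [].
move=> [eg wts] whs e.
have /arity_split[hss sh E] : size hs = size (flatten (map tleaves ts)).
  by rewrite -(size_map tout) e.
move: whs e; rewrite {}E graftE //= map_flatten => whs e.
have {}e : map (map tout) hss = map tleaves ts.
  apply: eq_from_flatten_shape => //.
  rewrite /shape -!map_comp -sh; apply: eq_map => l /=; exact: size_map.
rewrite -eg; elim: ts IH wts hss whs e {sh eg} => [|t ts IHts] /=.
  by move=> _ _ [|].
move=> [IHt /IHts{}IHts] [wt0 /IHts{}IHts] [|h hss] //= /conj_seq_cat[wh whs].
move=> [eh /(IHts _ whs)[-> w]]; rewrite tout_graft //; split=> //; split=> //.
exact: IHt.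
Qed.

Lemma graft_idr t : graft t (map Tid (tleaves t)) = t.
Proof.
elim/term_nested_ind: t => [c|g ts IH] //.
rewrite [tleaves _]/= map_flatten graftE; last first.
  by rewrite /shape -!map_comp; apply: eq_map => t; rewrite /= size_map.
by congr Tgen; elim: ts IH => //= t ts IHts [-> /IHts ->].
Qed.

Lemma graftA t gs hss : size gs = size (tleaves t) ->
  shape hss = map arity gs ->
  graft (graft t gs) (flatten hss) =
  graft t [seq graft p.1 p.2 | p <- zip gs hss].
Proof.
elim/term_nested_ind: t gs hss => [c|g ts IH] gs hss.
  by case: gs hss => [|u [|//]] // [|h [|//]] //= _ _; rewrite cats0.
move=> /arity_split[gss eg ->] eh.
have [hsss eh' eh2] : exists2 hsss, shape hsss = shape gss & hss = flatten hsss.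
  have sz : size hss = sumn (shape gss).
    by rewrite -size_flatten -(size_map size) -/(shape _) eh size_map.
  by exists (reshape (shape gss) hss); rewrite ?reshapeKl ?reshapeKr ?sz.
move: eh; rewrite {}eh2 => eh.
have {}eh : map shape hsss = map (map arity) gss.
  apply: eq_from_flatten_shape.
    by rewrite -map_flatten -eh /shape map_flatten.
  rewrite /shape -!map_comp.
  rewrite (eq_map (g := size)); last by move=> l; rewrite /= size_map.
  rewrite -/(shape hsss) eh'; apply: eq_map => l; by rewrite /= size_map.
have -> : [seq graft p.1 p.2 | p <- zip (flatten gss) (flatten hsss)] =
  flatten [seq [seq graft p.1 p.2 | p <- zip q.1 q.2] | q <- zip gss hsss].
  elim: (gss) (hsss) eh' => [|a l IHl] [|b m] //= [e /IHl <-].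
  by rewrite zip_cat // map_cat.
rewrite flatten_flatten graftE // graftE; last first.
  elim: (ts) (gss) (hsss) eg eh => [|t l IHl] [|a m] [|b n] //=.
  move=> [e1 /IHl{}IHl] [e2 /IHl ->]; congr cons.
  by rewrite tleaves_graft // !size_flatten e2 /shape -map_comp.
rewrite graftE; last first.
  elim: (gss) (hsss) (ts) eg eh' => [|a l IHl] [|b m] [|t n] //=.
  move=> [e1 /IHl{}IHl] [e2 /IHl ->] //.
  by rewrite size_map size_zip e2 minnn e1.
congr Tgen.
elim: ts IH gss hsss eg eh {eh'} => [|t ts IHts] [] //=.
  by move=> [|a l] [|b m].
move=> IHt /IHts{}IHts [|a l] [|b m] //= [e1 /IHts{}IHts] [e2 /IHts ->].
by rewrite IHt.
Qed.

Definition fmor : Type := {t : term | wt t}.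
Definition fsrc (h : fmor) : seq (scol G) := tleaves (sval h).
Definition ftgt (h : fmor) : scol G := tout (sval h).

Lemma fmor_eq (h h' : fmor) : sval h = sval h' -> h = h'.
Proof.
case: h h' => [t w] [t' w'] /= e; case: t' / e w' => w'; congr exist.
exact: Prop_irrelevance.
Qed.

Definition fid (c : scol G) : fmor := exist wt (Tid c) I.

Lemma fcomp_subproof (g : fmor) (gs : seq fmor) : map ftgt gs = fsrc g ->
  wt (graft (sval g) (map sval gs)).
Proof.
move=> e; apply: wt_graft; first exact: (svalP g).
  by rewrite /conj_seq; elim: gs {e} => //= h gs IH; split=> //; exact: (svalP h).
by rewrite -map_comp.
Qed.

Definition fcomp (g : fmor) (gs : seq fmor) (e : map ftgt gs = fsrc g) : fmor :=
  exist wt (graft (sval g) (map sval gs)) (fcomp_subproof e).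

Lemma fsrc_comp g gs (e : map ftgt gs = fsrc g) :
  fsrc (fcomp e) = flatten (map fsrc gs).
Proof.
rewrite /fsrc /= tleaves_graft -?map_comp //.
by rewrite size_map -(size_map ftgt) e.
Qed.

Lemma ftgt_comp g gs (e : map ftgt gs = fsrc g) : ftgt (fcomp e) = ftgt g.
Proof. by rewrite /ftgt /= tout_graft // -map_comp. Qed.

Lemma fcomp_idl g (e : map ftgt [:: g] = fsrc (fid (ftgt g))) : fcomp e = g.
Proof. exact: fmor_eq. Qed.

Lemma fcomp_idr g (e : map ftgt (map fid (fsrc g)) = fsrc g) : fcomp e = g.
Proof. by apply: fmor_eq; rewrite /= -map_comp graft_idr. Qed.

Lemma fcompA (g : fmor)
    (ts : seq {p : fmor * seq fmor | map ftgt p.2 = fsrc p.1})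
    (e1 : map ftgt [seq (sval t).1 | t <- ts] = fsrc g)
    (e2 : map ftgt (flatten [seq (sval t).2 | t <- ts]) = fsrc (fcomp e1))
    (e3 : map ftgt [seq fcomp (svalP t) | t <- ts] = fsrc g) :
  fcomp e2 = fcomp e3.
Proof.
apply: fmor_eq; rewrite /= map_flatten graftA.
- congr graft; by elim: (ts) => //= t l ->.
- by rewrite size_map -(size_map ftgt) e1.
rewrite /shape -!map_comp; apply: eq_map => t /=.
by rewrite size_map -(size_map ftgt) (svalP t).
Qed.

Definition free_operad : ns_operad :=
  @NsOperad (scol G) fmor fsrc ftgt fid fcomp (fun=> erefl) (fun=> erefl)
    fsrc_comp ftgt_comp fcomp_idl fcomp_idr fcompA.

Lemma fgen_subproof (g : sgen G) : wt (Tgen g (map Tid (sin g))).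
Proof.
split; first by rewrite -map_comp map_id.
by rewrite /conj_seq; elim: (sin g).
Qed.

Definition fgen (g : sgen G) : fmor := exist wt _ (fgen_subproof g).

Lemma fsrc_gen g : fsrc (fgen g) = sin g.
Proof. by rewrite /fsrc /= -map_comp -[RHS]flatten_seq1. Qed.

End FreeOperad.

Record rooted_action (C : category) (O : ns_operad) := RootedAction {
  mu : mor O -> C;
  act : forall (x y : C) (f : hom x y) (g : mor O), mu g = x -> mor O;
  mu_act : forall x y (f : hom x y) g (e : mu g = x), mu (act f e) = y;
  act_cmp : forall x y z (f : hom y z) (f' : hom x y) g (e : mu g = x)
      (e' : mu (act f' e) = y), act (cmp f f') e = act f e';
  act_idc : forall x g (e : mu g = x), act (idc x) e = g;
  mu_ocomp : forall g gs (e : map tgt gs = src g), mu (ocomp g gs e) = mu g;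
  src_act : forall x y (f : hom x y) g (e : mu g = x), src (act f e) = src g }.

Arguments mu {C O}.
Arguments act {C O} r {x y} f g e.

Lemma eq_act C O (r : rooted_action C O) x y (f : hom x y) g g' e e' :
  g = g' -> act r f g e = act r f g' e'.
Proof. by move=> eg; case: g' / eg e' => e'; congr act. Qed.

Record ra_ns := RaNs {
  ra_cat : category;
  ra_op : ns_operad;
  ra_act :> rooted_action ra_cat ra_op }.

Record ra_ns_map (X Y : ra_ns) := RaNsMap {
  map_c : cfunctor (ra_cat X) (ra_cat Y);
  map_d : operad_map (ra_op X) (ra_op Y);
  map_mu : forall g, map_c (mu X g) = mu Y (mmor map_d g);
  map_act : forall x y (f : hom x y) g e e',
    mmor map_d (act X f g e) = act Y (fhom map_c f) (mmor map_d g) e' }.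

Definition ra_ns_id (X : ra_ns) : ra_ns_map X X.
Proof.
refine (@RaNsMap X X (cfunctor_id _) (operad_map_id _) (fun=> erefl) _).
by move=> x y f g e e'; apply: eq_act.
Defined.

Definition ra_ns_comp (X Y Z : ra_ns) (G : ra_ns_map Y Z) (F : ra_ns_map X Y) :
  ra_ns_map X Z.
Proof.
refine (@RaNsMap X Z (cfunctor_comp (map_c G) (map_c F))
  (operad_map_comp (map_d G) (map_d F)) _ _).
- by move=> g; rewrite /= !map_mu.
- move=> x y f g e e' /=.
  have e1 : mu Y (mmor (map_d F) g) = map_c F x by rewrite -map_mu e.
  by rewrite (@map_act _ _ F _ _ _ _ e e1) (@map_act _ _ G _ _ _ _ e1 e').
Defined.

Lemma cfunctor_eq (C D : category) (F G : cfunctor C D) o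
  (h h' : forall x y, hom x y -> hom (o x) (o y)) p1 p2 q1 q2 :
  F = @CFunctor C D o h p1 p2 -> G = @CFunctor C D o h' q1 q2 -> h = h' -> F = G.
Proof.
move=> -> -> e; case: h' / e q1 q2 => q1 q2; congr CFunctor; exact: Prop_irrelevance.
Qed.

Lemma operad_map_eq (O P : ns_operad) (F G : operad_map O P) :
  mcol F = mcol G -> mmor F = mmor G -> F = G.
Proof.
case: F G => [c m h1 h2 h3 h4] [c' m' h1' h2' h3' h4'] /= ec em.
case: c' / ec h1' h2' h3' h4'; case: m' / em => h1' h2' h3' h4'.
congr OperadMap; exact: Prop_irrelevance.
Qed.

Lemma ra_ns_map_eq (X Y : ra_ns) (F G : ra_ns_map X Y) :
  map_c F = map_c G -> map_d F = map_d G -> F = G.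
Proof.
case: F G => [c d h1 h2] [c' d' h1' h2'] /= ec ed.
case: c' / ec h1' h2'; case: d' / ed => h1' h2'.
congr RaNsMap; exact: Prop_irrelevance.
Qed.

(* All maps of rooted actions are kept: this is a full subcategory.           *)
Definition ra_ns_full (I : Type) (X : I -> ra_ns) : category.
Proof.
refine (@Category I (fun i j => ra_ns_map (X i) (X j)) (fun i => ra_ns_id (X i))
  (fun i j k => @ra_ns_comp (X i) (X j) (X k)) _ _ _).
- move=> x y z t f g h; apply: ra_ns_map_eq; last by apply: operad_map_eq.
  exact: (cfunctor_eq (erefl _) (erefl _) (erefl _)).
- move=> x y f; apply: ra_ns_map_eq; last by apply: operad_map_eq; case: f => *.
  case: f => [[o h p q] d e1 e2]; exact: (cfunctor_eq (erefl _) (erefl _) (erefl _)).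
- move=> x y f; apply: ra_ns_map_eq; last by apply: operad_map_eq; case: f => *.
  case: f => [[o h p q] d e1 e2]; exact: (cfunctor_eq (erefl _) (erefl _) (erefl _)).
Defined.

(* e' can always be supplied: mu (sact s g h) = mu g, because
   mu g = mu (idm (tgt g)) by mu_ocomp.                                       *)
Record ra_sym := RaSym {
  rs_cat : category;
  rs_op : sym_operad;
  rs_act : rooted_action rs_cat rs_op;
  rs_equivariant : forall (x y : rs_cat) (f : hom x y) (g : mor rs_op)
      (e : mu rs_act g = x) (s : seq nat) (h : is_perm (size (src g)) s)
      (h' : is_perm (size (src (act rs_act f g e))) s)
      (e' : mu rs_act (sact s g h) = x),
    sact s (act rs_act f g e) h' = act rs_act f (sact s g h) e' }.

Definition ra_sym_ns (X : ra_sym) : ra_ns := RaNs (rs_act X).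

Record ra_sym_map (X Y : ra_sym) := RaSymMap {
  rs_map :> ra_ns_map (ra_sym_ns X) (ra_sym_ns Y);
  rs_map_sact : forall (s : seq nat) (g : mor (rs_op X)) h h',
    mmor (map_d rs_map) (sact s g h) = sact s (mmor (map_d rs_map) g) h' }.

Lemma ra_sym_map_eq (X Y : ra_sym) (F G : ra_sym_map X Y) :
  rs_map F = rs_map G -> F = G.
Proof.
case: F G => [f h] [f' h'] /= e; case: f' / e h' => h'.
congr RaSymMap; exact: Prop_irrelevance.
Qed.

Definition ra_sym_id (X : ra_sym) : ra_sym_map X X.
Proof.
exists (ra_ns_id (ra_sym_ns X)) => s g h h'; exact: eq_sact.
Defined.

Definition ra_sym_comp (X Y Z : ra_sym) (G : ra_sym_map Y Z) (F : ra_sym_map X Y) :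
  ra_sym_map X Z.
Proof.
exists (ra_ns_comp G F) => s g h h' /=.
have h1 : is_perm (size (src (mmor (map_d F) g))) s.
  by rewrite src_mmor size_map.
by rewrite (@rs_map_sact _ _ F _ _ _ h1) (@rs_map_sact _ _ G _ _ _ h').
Defined.

Definition ra_sym_full (I : Type) (X : I -> ra_sym) : category.
Proof.
refine (@Category I (fun i j => ra_sym_map (X i) (X j)) (fun i => ra_sym_id (X i))
  (fun i j k => @ra_sym_comp (X i) (X j) (X k)) _ _ _).
- move=> x y z t f g h; apply: ra_sym_map_eq.
  exact: (cmpA (c := ra_ns_full (fun i => ra_sym_ns (X i)))).
- move=> x y f; apply: ra_sym_map_eq.
  exact: (cmp1c (c := ra_ns_full (fun i => ra_sym_ns (X i)))).
- move=> x y f; apply: ra_sym_map_eq.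
  exact: (cmpc1 (c := ra_ns_full (fun i => ra_sym_ns (X i)))).
Defined.

Section SymmetrizedAction.
Variable X : ra_ns.

Definition smor_mu (g : smor (ra_op X)) : ra_cat X := mu X (smor_op g).

Definition smor_bullet x y (f : hom x y) (g : smor (ra_op X)) (e : smor_mu g = x) :
  smor (ra_op X) :=
  @SMor _ (smor_src g) (smor_perm g) (act X f (smor_op g) e) (smor_is_perm g)
    (etrans (src_act _ _) (smor_srcE g)).

Definition sym_action : rooted_action (ra_cat X) (sym_ns_operad (ra_op X)).
Proof.
refine (@RootedAction (ra_cat X) (sym_ns_operad (ra_op X)) smor_mu smor_bullet _ _ _ _ _).
- by move=> x y f g e; exact: mu_act.
- by move=> x y z f f' g e e'; apply: smor_eq => //=; exact: act_cmp.
- by move=> x g e; apply: smor_eq => //=; exact: act_idc.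
- by move=> g gs e; exact: mu_ocomp.
- by [].
Defined.

Definition sym_ra : ra_sym.
Proof.
refine (@RaSym (ra_cat X) (symmetrization (ra_op X)) sym_action _).
by move=> x y f g e s h h' e'; apply: smor_eq => //=; exact: eq_act.
Defined.

End SymmetrizedAction.

Section SymmetrizedMap.
Variables (O P : ns_operad) (F : operad_map O P).

Lemma smor_map_perm (g : smor O) :
  is_perm (size (map (mcol F) (smor_src g))) (smor_perm g).
Proof. by rewrite size_map; exact: smor_is_perm. Qed.

Lemma smor_map_src (g : smor O) :
  src (mmor F (smor_op g)) = permute (smor_perm g) (map (mcol F) (smor_src g)).
Proof. by rewrite src_mmor smor_srcE permute_map. Qed.

Definition smor_map (g : smor O) : smor P := SMor (smor_map_perm g) (smor_map_src g).

Definition sym_operad_map : operad_map (sym_ns_operad O) (sym_ns_operad P).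
Proof.
refine (@OperadMap (sym_ns_operad O) (sym_ns_operad P) (mcol F) smor_map _ _ _ _).
- by [].
- by move=> g; exact: (@tgt_mmor _ _ F (smor_op g)).
- by move=> c; apply: smor_eq => //=; exact: mmor_id.
- move=> g gs e e'; apply: smor_eq => /=.
  + by rewrite map_flatten -!map_comp.
  + by rewrite -!map_comp.
  + have e1 := @smor_comp_e O g gs e; have e2 := @smor_comp_e P (smor_map g) (map smor_map gs) e'.
    have e3 : map tgt (map (mmor F) (permute (smor_perm g) (map (@smor_op O) gs)))
        = src (mmor F (smor_op g)).
      rewrite src_mmor -e1 -!map_comp; apply: eq_map => k; exact: tgt_mmor.
    rewrite (@mmor_comp _ _ F _ _ _ e3); apply: eq_comp => //.
    by rewrite -permute_map -!map_comp.
Defined.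

End SymmetrizedMap.

Definition sym_ra_map (X Y : ra_ns) (F : ra_ns_map X Y) :
  ra_sym_map (sym_ra X) (sym_ra Y).
Proof.
unshelve refine (@RaSymMap (sym_ra X) (sym_ra Y)
  (@RaNsMap (ra_sym_ns (sym_ra X)) (ra_sym_ns (sym_ra Y)) (map_c F)
    (sym_operad_map (map_d F)) _ _) _).
- by move=> g; exact: (map_mu F (smor_op g)).
- by move=> x y f g e e'; apply: smor_eq => //=; exact: map_act.
- by move=> s g h h'; apply: smor_eq => //=; rewrite permute_map.
Defined.

(* PEdge is the tree with one edge and no vertices; PNode [:: t_1; ...; t_k]
   has a root vertex with k ordered inputs, on which the t_i are grafted. This
   gives one tree per planar isomorphism class. The empty tree is None in
   option ptree.                                                              *)
Inductive ptree : Type := PEdge | PNode of seq ptree.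

(* The edges are named by their address: the root edge is [::], and the i-th
   input (from 0) of the vertex with output p is rcons p i. subtree S p is the
   part of S above p, or None if p is not an edge.                            *)
Fixpoint subtree (S : option ptree) (p : seq nat) : option ptree :=
  match p with
  | [::] => S
  | i :: q => subtree (if S is Some (PNode ts) then onth ts i else None) q
  end.

Definition arity (t : option ptree) : nat :=
  if t is Some (PNode ts) then size ts else 0.

Definition is_node (t : option ptree) : bool :=
  if t is Some (PNode _) then true else false.

Section Tree.
Variable S : option ptree.

Definition edge : Type := {p : seq nat | isSome (subtree S p)}.

(* A vertex is named by its output edge.                                      *)
Definition vertex : Type := {p : seq nat | is_node (subtree S p)}.

Definition nonroot : Type := {e : edge | val e != [::]}.

Lemma vertex_output_subproof (v : vertex) : isSome (subtree S (val v)).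
Proof. by case: v => p /=; case: (subtree S p) => [[|ts]|]. Qed.

Definition vertex_output (v : vertex) : edge :=
  exist _ (val v) (vertex_output_subproof v).

(* pmap insub only serves to turn addresses into edges: it discards nothing.  *)
Definition vertex_inputs (v : vertex) : seq edge :=
  pmap insub [seq rcons (val v) i | i <- iota 0 (arity (subtree S (val v)))].

Definition is_leaf (e : edge) : Prop := forall v, vertex_output v <> e.

Definition tree_signature : signature := Signature vertex_inputs vertex_output.

End Tree.

Definition Omega_p (S : option ptree) : ns_operad := free_operad (tree_signature S).

Definition CnS_ob (n : nat) (S : option ptree) : Type := ('I_n.+1 + nonroot S)%type.

Definition CnS_hom (n : nat) (S : option ptree) (x y : CnS_ob n S) : Prop :=
  match x, y with
  | inl i, inl j => i <= j
  | inr e, inr e' => e = e'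
  | _, _ => False
  end.

Lemma CnS_hom_id n S x : @CnS_hom n S x x.
Proof. by case: x => /=. Qed.

Lemma CnS_hom_cmp n S x y z : @CnS_hom n S y z -> @CnS_hom n S x y -> CnS_hom x z.
Proof.
move: x y z => [i|e] [j|e'] [k|e''] //= h h'; first exact: leq_trans h' h.
exact: etrans h' h.
Qed.

(* The disjoint union of the poset [n] and of the discrete category on the
   non-root edges.                                                            *)
Definition CnS (n : nat) (S : option ptree) : category :=
  @Category (CnS_ob n S) (@CnS_hom n S) (@CnS_hom_id n S) (@CnS_hom_cmp n S)
    (fun _ _ _ _ _ _ _ => Prop_irrelevance _ _)
    (fun _ _ _ => Prop_irrelevance _ _) (fun _ _ _ => Prop_irrelevance _ _).

(* A presentation of O_(n,S): generating colors and operations, and the moment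
   of each color. The moment of an operation is that of its target, as forced
   by g = gamma(id; g).                                                       *)
Record moment_sig (n : nat) (S : option ptree) := MomentSig {
  msig :> signature;
  moment : scol msig -> CnS_ob n S }.

Arguments moment {n S}.

Definition op_moment n S (L : moment_sig n S) (h : fmor L) : CnS_ob n S :=
  moment L (ftgt h).

Definition top_op n S (L : moment_sig n S) : Type :=
  {h : fmor L | op_moment h == inl ord_max :> 'I_n.+1 + nonroot S}.

(* From O_(n,S) to O_(n+1,S): inr h is at the same time the color (n+1,h) and
   the generating operation p_(n,n+1) . h.                                    *)
Definition adjoin n S (L : moment_sig n S) : moment_sig n.+1 S :=
  @MomentSig n.+1 S
    (@Signature (scol L + top_op L) (sgen L + top_op L)
      (fun g => match g with
        | inl g => map inl (sin g)
        | inr h => map inl (fsrc (val h))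
        end)
      (fun g => match g with
        | inl g => inl (sout g)
        | inr h => inr h
        end))
    (fun c => match c with
      | inl c =>
          match moment L c with
          | inl i => inl (widen_ord (leqnSn n.+1) i)
          | inr e => inr e
          end
      | inr _ => inl ord_max
      end).

Definition tree_moment (S : option ptree) (e : edge S) : CnS_ob 0 S :=
  match insub e : option (nonroot S) with
  | Some k => inr k
  | None => inl ord0
  end.

Fixpoint OnS_sig (n : nat) (S : option ptree) : moment_sig n S :=
  match n with
  | 0 => @MomentSig 0 S (tree_signature S) (@tree_moment S)
  | m.+1 => adjoin (OnS_sig m S)
  end.

Definition OnS (n : nat) (S : option ptree) : ns_operad := free_operad (OnS_sig n S).

Definition gen (n : nat) (S : option ptree) : Type := sgen (OnS_sig n S).

Fixpoint edge_col (n : nat) (S : option ptree) (e : edge S) : col (OnS n S) :=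
  match n with
  | 0 => e
  | m.+1 => inl (edge_col m e)
  end.

Section Inclusion.
Variables (n : nat) (S : option ptree) (L : moment_sig n S).

Fixpoint old_term (t : term L) : term (adjoin L) :=
  match t with
  | Tid c => @Tid (adjoin L) (inl c)
  | Tgen g ts => @Tgen (adjoin L) (inl g) (map old_term ts)
  end.

Lemma tleaves_old t : tleaves (old_term t) = map inl (tleaves t).
Proof.
elim/term_nested_ind: t => //= g ts IH; rewrite map_flatten -!map_comp.
by congr flatten; elim: ts IH => //= t ts IHts [-> /IHts ->].
Qed.

Lemma tout_old t : tout (old_term t) = inl (tout t).
Proof. by case: t. Qed.

Lemma wt_old t : wt t -> wt (old_term t).
Proof.
elim/term_nested_ind: t => //= g ts IH [<- w]; split.
  by rewrite -!map_comp; apply: eq_map => t; exact: tout_old.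
by elim: ts IH w => //= t ts IHts [IHt /IHts{}IHts] [/IHt h /IHts h'].
Qed.

Definition old_op (h : fmor L) : fmor (adjoin L) :=
  exist (@wt (adjoin L)) (old_term (sval h)) (wt_old (svalP h)).

Lemma old_term_inj t t' : old_term t = old_term t' -> t = t'.
Proof.
elim/term_nested_ind: t t' => [c|g ts IH] [c'|g' ts'] //= [-> //].
move=> e; congr Tgen; elim: ts ts' IH e => [|t ts IHts] [|t' ts'] //=.
by move=> [IHt /IHts{}IHts] [/IHt -> /IHts ->].
Qed.

Lemma old_op_inj : injective old_op.
Proof. by move=> h h' /(congr1 sval) /= /old_term_inj /fmor_eq. Qed.

Lemma old_termP (t : term (adjoin L)) c : wt t -> tout t = inl c ->
  exists2 t', wt t' & old_term t' = t.
Proof.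
elim/term_nested_ind: t c => [c'|g ts IH] c.
  by move=> _ /= ->; exists (@Tid L c).
case: g => [g|h] //= [e w] _.
have [ts' w' e'] : exists2 ts', conj_seq (@wt L) ts' & map old_term ts' = ts.
  elim: ts (sin g) IH e w => [|t ts IHts] [|d l] //=; first by exists [::].
  move=> [IHt /IHts{}IHts] [e1 /IHts{}IHts] [w1 /IHts[ts' w' e']].
  by have [t' wt' et'] := IHt _ w1 e1; exists (t' :: ts') => //=; rewrite et' e'.
exists (@Tgen L g ts'); last by rewrite /= e'.
split=> //; have inj : injective (@inl (scol L) (top_op L)) by move=> ? ? [].
apply: (inj_map inj); rewrite -e -e' -!map_comp.
by apply: eq_map => t; rewrite /= tout_old.
Qed.

Lemma old_opP (h : fmor (adjoin L)) c : ftgt h = inl c ->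
  exists h0, old_op h0 = h.
Proof.
move=> e; have [t w et] := old_termP (svalP h) e.
by exists (exist _ t w); apply: fmor_eq.
Qed.

Lemma fsrc_old h : fsrc (old_op h) = map inl (fsrc h).
Proof. exact: tleaves_old. Qed.

Lemma ftgt_old h : ftgt (old_op h) = inl (ftgt h).
Proof. exact: tout_old. Qed.

End Inclusion.

(* up h is p_(i,i+1) . h for an operation h of moment i < n (and h otherwise). *)
Fixpoint up (n : nat) (S : option ptree) : fmor (OnS_sig n S) -> fmor (OnS_sig n S) :=
  match n return fmor (OnS_sig n S) -> fmor (OnS_sig n S) with
  | 0 => id
  | m.+1 => fun h =>
      match pselect (exists h0, old_op h0 = h) with
      | left ex =>
          let h0 := projT1 (cid ex) in
          match insub h0 : option (top_op (OnS_sig m S)) with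
          | Some k => @fgen (adjoin (OnS_sig m S)) (inr k)
          | None => old_op (up h0)
          end
      | right _ => h
      end
  end.

Lemma fsrc_up n S (h : fmor (OnS_sig n S)) : fsrc (up h) = fsrc h.
Proof.
elim: n h => //= n IH h; case: pselect => [ex|//]; case: (cid ex) => h0 /= e0.
by case: insubP => [k _ ek|_]; rewrite ?fsrc_gen /= -e0 !fsrc_old ?ek ?IH.
Qed.

Lemma op_moment_up n S (h : fmor (OnS_sig n S)) (i : 'I_n.+1) : i < n ->
  op_moment h = inl i -> exists2 j : 'I_n.+1, op_moment (up h) = inl j & j = i.+1 :> nat.
Proof.
elim: n h i => // n IH h i; rewrite ltnS => lein em.
have [c ec] : exists c, ftgt h = inl c.
  move: em; rewrite /op_moment; case: (ftgt h) => [c _|k /= [ei]]; first by exists c.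
  by move: lein; rewrite -ei /= ltnn.
rewrite /=; case: pselect => [ex|[]]; last exact: old_opP ec.
case: (cid ex) => h0 /= e0.
have : op_moment (L := adjoin (OnS_sig n S)) (old_op h0) = inl i by rewrite e0.
rewrite /op_moment ftgt_old /=; case em0 : (moment _ _) => [i0|//] [ei].
case: insubP => [k _ ek|nt].
  exists ord_max => //=; rewrite -ei /=; congr (_.+1).
  by have := valP k; rewrite /= ek /op_moment em0 => /eqP[->].
have lt0 : i0 < n.
  rewrite ltn_neqAle -ltnS ltn_ord andbT; apply: contra nt => /eqP ei0.
  by rewrite /op_moment em0; apply/eqP; congr inl; apply: val_inj.
have [j ej vj] := IH h0 i0 lt0 em0.
rewrite ftgt_old /= -/(op_moment (up h0)) ej.
by exists (widen_ord (leqnSn n.+1) j) => //=; rewrite vj -ei.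
Qed.

Lemma op_moment_iter n S k (h : fmor (OnS_sig n S)) (i : 'I_n.+1) : i + k <= n ->
  op_moment h = inl i ->
  exists2 j : 'I_n.+1, op_moment (iter k (@up n S) h) = inl j & j = i + k :> nat.
Proof.
elim: k => [|k IH] le em; first by exists i; rewrite ?addn0.
rewrite addnS in le; have [j ej vj] := IH (ltnW le) em.
have [j' ej' vj'] : exists2 j' : 'I_n.+1, op_moment (up (iter k (@up n S) h)) = inl j' & j' = j.+1 :> nat.
  by apply: op_moment_up ej; rewrite vj.
by exists j' => //; rewrite vj' vj addnS.
Qed.

Lemma fsrc_iter n S k (h : fmor (OnS_sig n S)) : fsrc (iter k (@up n S) h) = fsrc h.
Proof. by elim: k => //= k IH; rewrite fsrc_up. Qed.

Section Action.
Variables (n : nat) (S : option ptree).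

Definition bullet (x y : CnS n S) (f : hom x y) (h : mor (OnS n S))
    (e : op_moment h = x) : mor (OnS n S) :=
  match x, y with
  | inl i, inl j => iter (j - i) (@up n S) h
  | _, _ => h
  end.

Definition nS_action : rooted_action (CnS n S) (OnS n S).
Proof.
refine (@RootedAction (CnS n S) (OnS n S) (@op_moment n S (OnS_sig n S)) bullet _ _ _ _ _).
- move=> [i|a] [j|b] //= f h e; last by rewrite e f.
  have [|k ek vk] := @op_moment_iter n S (j - i) h i _ e.
    by rewrite subnKC // -ltnS.
  by rewrite ek; congr inl; apply: val_inj; rewrite /= vk subnKC.
- move=> [i|a] [j|b] [k|c] //= f f' h e e'.
  by rewrite -iterD; congr iter; rewrite addnC addnBAC // subnKC.
- by move=> [i|a] //= h e; rewrite subnn.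
- by move=> h hs e; rewrite /op_moment; congr (moment _); exact: ftgt_comp.
- by move=> [i|a] [j|b] //= f h e; exact: fsrc_iter.
Defined.

End Action.

Definition nS_object (a : nat * option ptree) : ra_ns := RaNs (nS_action a.1 a.2).

Definition Delta_Omega_p : category := ra_ns_full nS_object.

Definition Delta_Omega : category := ra_sym_full (fun a => sym_ra (nS_object a)).

Definition cardinal (T : Type) : nat := #|` fset_set [set: {classic T}] |.

(* The set gen n S is finite; on the empty tree, degree (n, None) = n.        *)
Definition degree (a : nat * option ptree) : nat := a.1 + cardinal (gen a.1 a.2).

Definition planar_plus (a b : nat * option ptree) (X : @hom Delta_Omega_p a b) : Prop :=
  injective (fun i : 'I_a.1.+1 => map_c X (inl i)) /\
  injective (fun e : edge a.2 => mcol (map_d X) (edge_col a.1 e)).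

Definition planar_minus (a b : nat * option ptree) (X : @hom Delta_Omega_p a b) : Prop :=
  [/\ forall j : 'I_b.1.+1, exists i : 'I_a.1.+1, map_c X (inl i) = inl j,
      forall c : col (OnS b.1 b.2), exists c', mcol (map_d X) c' = c &
      forall e : edge a.2, is_leaf e -> exists2 e' : edge b.2, is_leaf e' &
        mcol (map_d X) (edge_col a.1 e) = edge_col b.1 e'].

Definition Sigma_map (a b : nat * option ptree) (X : @hom Delta_Omega_p a b) :
  @hom Delta_Omega a b := sym_ra_map X.

Definition mor_class (C : category) := forall x y : C, hom x y -> Prop.

Definition wide_subcategory (C : category) (R : mor_class C) : Prop :=
  (forall x, R x x (idc x)) /\
  (forall x y z (f : hom y z) (g : hom x y), R y z f -> R x y g -> R x z (cmp f g)).

Definition is_iso (C : category) (x y : C) (f : hom x y) : Prop :=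
  exists g : hom y x, cmp g f = idc x /\ cmp f g = idc y.

Record generalized_reedy (C : category) (Rp Rm : mor_class C) (d : C -> nat) : Prop := {
  reedy_plus_wide : wide_subcategory Rp;
  reedy_minus_wide : wide_subcategory Rm;
  reedy_plus_degree : forall x y (f : hom x y), Rp x y f -> ~ is_iso f -> d x < d y;
  reedy_minus_degree : forall x y (f : hom x y), Rm x y f -> ~ is_iso f -> d y < d x;
  reedy_iso_degree : forall x y (f : hom x y), is_iso f -> d x = d y;
  reedy_iso : forall x y (f : hom x y), Rp x y f /\ Rm x y f <-> is_iso f;
  reedy_factor : forall x z (f : hom x z),
    exists y (g : hom y z) (h : hom x y), [/\ Rp y z g, Rm x y h & f = cmp g h];
  reedy_factor_unique : forall x z y y' (g : hom y z) (h : hom x y)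
      (g' : hom y' z) (h' : hom x y'),
    Rp y z g -> Rm x y h -> Rp y' z g' -> Rm x y' h' -> cmp g h = cmp g' h' ->
    exists t : hom y y', [/\ is_iso t, cmp t h = h' & cmp g' t = g];
  reedy_faithful : forall x y (f : hom x y) (t : hom y y),
    is_iso t -> Rm x y f -> cmp t f = f -> t = idc y }.

(* degree (0, None) = degree (0, Some PEdge) = 0, but the unique map from
   (0, None) to (0, Some PEdge) satisfies planar_plus and is not invertible: no
   direct subcategory of a generalized Reedy structure with degree function
   degree can contain its image. This is the only non-invertible map satisfying
   planar_plus that does not raise degree; adding one to the degree of all
   non-empty trees makes it raise degree too.                                 *)
Definition shifted_degree (a : nat * option ptree) : nat := degree a + isSome a.2.

(* Main.v *)
From HB Require Import structures.
From mathcomp Require Import all_boot finmap.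
From mathcomp Require Import boolp classical_sets cardinality.
From mathcomp Require Import zify.
Require Import Defs.

Set Implicit Arguments.
Unset Strict Implicit.
Unset Printing Implicit Defensive.

(** The positive and the negative class are given on the symmetrized category
    by the same conditions as on the planar one: these conditions only involve
    objects of [n] and colors, which symmetrization does not change. The point
    is that maps of symmetrized objects are as rigid as planar maps.

    In the operads O_(n,S), a color is the output of at most one generator, and
    the tree obtained by expanding a color never contains a color twice
    (forest_OnS). Hence an operation, even of the symmetrized operad, is
    determined by its target and its list of sources (smor_thin): to recover
    it, expand the target and stop at the sources. So a map of rooted actions is
    nothing but a map of colors that sends sources and target of an operation to
    sources and target of an operation, and is compatible with the action. By
    freeness such a map can be prescribed at will on [n] and on the edges, as
    long as vertices go to operations and the moment of the image of the root is
    the image of 0 (hom_exists, hom_eq).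

    A positive map is injective on all colors, because an adjoined color (i,h)
    determines h (colm_inj). A map that is both positive and negative sends
    vertices to vertices (pm_vertex), so that the inverse bijection on edges
    defines an inverse map. The number of generators is the number of colors
    that are not leaves. A positive map embeds generators into generators, a
    negative map lets generators be lifted. In both cases, once the trees are both
    empty or both non-empty, equality of the degrees forces the map to be in the
    other class as well, hence to be an isomorphism.

    A map f that is not positive either identifies two consecutive objects of
    [n] or sends a unary vertex to an identity: two edges with the same image
    cannot lie above different inputs of a vertex, since different sources of an
    operation have disjoint expansions. In both cases f factors through an
    elementary degeneracy, which is negative, has a section and lowers the
    degree (not_plus_degeneracy). By induction on the degree, every map is a
    positive map after a negative one, and every negative map has a section.
    Uniqueness of the factorization and triviality of the isomorphisms that fix
    a negative map are then formal, because negative maps are split epimorphisms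
    and positive maps can be cancelled on the left (plus_mono). *)

(** * Membership in lists over arbitrary types *)

(** Equality of colors is not decidable, whence a propositional membership. *)
Fixpoint mem_of (T : Type) (x : T) (l : seq T) : Prop :=
  if l is y :: l' then y = x \/ mem_of x l' else False.

Lemma mem_of_cat T (x : T) l l' : mem_of x (l ++ l') <-> mem_of x l \/ mem_of x l'.
Proof. by elim: l => [|y l IH] /=; [tauto | rewrite IH; tauto]. Qed.

Lemma mem_of_map T U (f : T -> U) y l :
  mem_of y (map f l) <-> exists2 x, mem_of x l & f x = y.
Proof.
elim: l => [|x l IH] /=; first by split=> [|[]].
rewrite IH; split=> [[e|[z h e]]|[z [->|h] e]].
- by exists x; [left|].
- by exists z; [right|].
- by left.
- by right; exists z.
Qed.

Lemma mem_of_flatten T (x : T) ls :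
  mem_of x (flatten ls) <-> exists2 l, mem_of l ls & mem_of x l.
Proof.
elim: ls => [|l ls IH] /=; first by split=> [|[]].
rewrite mem_of_cat IH; split=> [[h|[k h h']]|[k [->|h] h']].
- by exists l; [left|].
- by exists k; [right|].
- by left.
- by right; exists k.
Qed.

Lemma mem_ofE (T : eqType) (x : T) l : mem_of x l <-> x \in l.
Proof.
elim: l => [|y l IH] //=; rewrite in_cons IH.
by split=> [[->|->]|/orP[/eqP->|]]; rewrite ?eqxx ?orbT; [..|left|right].
Qed.

Lemma mem_of_onth T (x : T) l : mem_of x l <-> exists i, onth l i = Some x.
Proof.
elim: l => [|y l IH] /=; first by split=> // -[[|i]].
rewrite IH; split=> [[->|[i e]]|[[|i] /= e]]; first by exists 0.
- by exists i.+1.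
- by left; case: e.
- by right; exists i.
Qed.

Lemma conj_seqP T (P : T -> Prop) l : conj_seq P l <-> forall x, mem_of x l -> P x.
Proof.
rewrite /conj_seq; elim: l => [|y l IH] //=; rewrite IH.
by split=> [[h h'] x [<-|/h']|h] //; split=> [|x m]; apply: h; [left|right].
Qed.

Lemma mem_of_permute T (x : T) s l : is_perm (size l) s ->
  mem_of x (permute s l) <-> mem_of x l.
Proof.
case: l => [|x0 l]; first by case: s => // i s h; have := is_perm_size h.
move=> hs; rewrite (permute_nth x0 (is_perm_lt hs)) mem_of_map; split.
  move=> [i /mem_ofE]; rewrite (is_perm_mem _ hs) => il <-.
  by apply/mem_of_onth; exists i; rewrite onthE (nth_map x0).
move=> /mem_of_onth[i e]; exists i; last exact: onth_nth.
by apply/mem_ofE; rewrite (is_perm_mem _ hs) -onthTE e.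
Qed.

(** * Operads free on a forest-like signature *)

Section Forest.
Variable G : signature.
Implicit Types t : term G.

(** The colors of the tree obtained by expanding c with generators as long as
    possible. *)
Inductive reach (x : scol G) : scol G -> Prop :=
  | reach_refl : reach x x
  | reach_gen d g : mem_of d (sin g) -> reach x d -> reach x (sout g).

Definition apart (c d : scol G) : Prop := forall x, reach x c -> reach x d -> False.

(** Disjointness of the expansions, and not only of the colors, is what passes
    from the generators to all operations. *)
Fixpoint spread (l : seq (scol G)) : Prop :=
  if l is c :: l' then conj_seq (apart c) l' /\ spread l' else True.

(** The expansion of a color is then a tree of colors without repetition.
    Expansions of different colors may overlap, as they do for the edges of a
    tree and for the colors adjoined above the same color. *)
Record forest : Prop := Forest {
  forest_out : injective (@sout G);
  forest_acyclic : forall g d, mem_of d (sin g) -> ~ reach (sout g) d;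
  forest_spread : forall g, spread (sin g) }.

Lemma reach_trans y x z : reach x y -> reach y z -> reach x z.
Proof. by move=> xy; elim=> // d g m _ h; apply: reach_gen m h. Qed.

Lemma reach_leaf t x : wt t -> mem_of x (tleaves t) -> reach x (tout t).
Proof.
elim/term_nested_ind: t => [c _ [<-|//]|g ts IH /= [e w]]; first exact: reach_refl.
rewrite mem_of_flatten => -[l /mem_of_map[t mt <-] mx].
apply: (@reach_gen x (tout t) g); first by rewrite -e mem_of_map; exists t.
move/conj_seqP: w => /(_ _ mt) w.
by move/conj_seqP: IH => /(_ _ mt) IH; apply: IH.
Qed.

Lemma apart_sym c d : apart c d -> apart d c.
Proof. by move=> h x xd xc; apply: h xc xd. Qed.

Lemma apart_reach c d c' d' : reach c' c -> reach d' d -> apart c d -> apart c' d'.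
Proof. by move=> rc rd h x xc xd; apply: h (reach_trans xc rc) (reach_trans xd rd). Qed.

Lemma spread_cat l l' : spread (l ++ l') <->
  [/\ spread l, spread l' & forall c d, mem_of c l -> mem_of d l' -> apart c d].
Proof.
elim: l => [|c l IH] /=; first by split=> [h|[]].
rewrite conj_seq_cat IH; split.
  move=> [[h1 /conj_seqP h2] [h3 h4 h5]]; split=> // x d [<-|mx] md; first exact: h2.
  exact: h5.
move=> [[h1 h2] h3 h4]; split; split=> //; last by move=> x d mx; apply: h4; right.
by apply/conj_seqP => d; apply: h4; left.
Qed.

Lemma spread_onth l i j c d : spread l -> onth l i = Some c -> onth l j = Some d ->
  i <> j -> apart c d.
Proof.
elim: l i j => [|x l IH] [|i] [|j] //= [/conj_seqP h1 h2].
- by move=> [<-] e _; apply: h1; apply/mem_of_onth; exists j.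
- by move=> e [<-] _; apply/apart_sym/h1/mem_of_onth; exists i.
- by move=> e e' ne; apply: IH e e' _ => // ee; apply: ne; rewrite ee.
Qed.

Lemma spread_inj l i j c : spread l -> onth l i = Some c -> onth l j = Some c -> i = j.
Proof.
move=> h e e'; apply: contrapT => ne.
exact: (spread_onth h e e' ne (reach_refl c) (reach_refl c)).
Qed.

Lemma spread_map_inj (T : Type) (f : T -> scol G) l x y : spread (map f l) ->
  mem_of x l -> mem_of y l -> f x = f y -> x = y.
Proof.
move=> h /mem_of_onth[i ei] /mem_of_onth[j ej] e.
have E : i = j.
  by apply: (spread_inj h); rewrite onth_map ?ei ?ej //= e.
by move: ei; rewrite E ej => -[].
Qed.

Hypothesis forestG : forest.

Lemma spread_leaves t : wt t -> spread (tleaves t).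
Proof.
elim/term_nested_ind: t => [c _ //|g ts IH /= [e w]].
have := forest_spread forestG g; rewrite -e.
elim: ts IH w {e} => //= t ts IHts [IHt /IHts{}IHts].
move=> [/[dup]wt0 /IHt h1 /[dup]ws /IHts h2] [h3 /h2 h4].
apply/spread_cat; split=> // c d mc; rewrite mem_of_flatten => -[l /mem_of_map[u mu <-] md].
have rc := reach_leaf wt0 mc.
have rd : reach d (tout u) by apply: reach_leaf => //; move/conj_seqP: ws; apply.
apply: apart_reach rc rd _; move/conj_seqP: h3; apply.
by rewrite mem_of_map; exists u.
Qed.

(** By acyclicity, a composite of generators cannot have its own target among
    its sources. *)
Lemma leaf_out_id t : wt t -> mem_of (tout t) (tleaves t) -> t = Tid (tout t).
Proof.
case: t => //= g ts [e w]; rewrite mem_of_flatten => -[l /mem_of_map[t mt <-] m].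
move/conj_seqP: w => /(_ _ mt) w.
case: (@forest_acyclic forestG g (tout t)); last exact: reach_leaf.
by rewrite -e mem_of_map; exists t.
Qed.

Lemma apart_leaves t ts x : wt t -> conj_seq (@wt G) ts ->
  conj_seq (apart (tout t)) (map (@tout G) ts) ->
  mem_of x (tleaves t) -> mem_of x (flatten (map (@tleaves G) ts)) -> False.
Proof.
move=> w /conj_seqP ws /conj_seqP ap xt.
rewrite mem_of_flatten => -[l /mem_of_map[u mu <-] xu].
apply: (ap (tout u) _ x); first by rewrite mem_of_map; exists u.
- exact: reach_leaf.
- by apply: reach_leaf => //; exact: ws.
Qed.

(** An operation is determined by its target and the set of its sources:
    expand the target, and stop exactly at the sources. *)
Lemma term_thin t t' : wt t -> wt t' -> tout t = tout t' ->
  (forall x, mem_of x (tleaves t) <-> mem_of x (tleaves t')) -> t = t'.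
Proof.
elim/term_nested_ind: t t' => [c|g ts IH] t' w w' eo el.
  by rewrite /= in eo; rewrite eo; apply/esym/leaf_out_id; rewrite // -eo -el; left.
case: t' w' eo el => [c|g' ts'] w' eo el.
  rewrite /= in eo; rewrite -[c]eo; apply: leaf_out_id => //.
  by apply/el; left; rewrite -eo.
move: w w' => /= [e w] [e' w'].
have eg : g = g' by apply: (forest_out forestG).
rewrite -{}eg in e' el *; congr Tgen; move: el => /=.
have := forest_spread forestG g; rewrite -{}e in e' *.
elim: ts ts' IH w w' e' {eo} => [|t ts IHts] [|t' ts'] //=.
move=> [IHt /IHts{}IHts] [wt0 ws] [wt0' ws'] [eo es] /= [ap sp] el.
have ap' : conj_seq (apart (tout t')) (map (@tout G) ts') by rewrite es eo.
have nt x : mem_of x (tleaves t) -> mem_of x (flatten (map (@tleaves G) ts')) -> False.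
  by apply: apart_leaves; rewrite // es.
have nt' x : mem_of x (tleaves t') -> mem_of x (flatten (map (@tleaves G) ts)) -> False.
  by apply: apart_leaves; rewrite // eo.
have n2 x : mem_of x (tleaves t) -> mem_of x (flatten (map (@tleaves G) ts)) -> False.
  exact: apart_leaves.
have n2' x : mem_of x (tleaves t') -> mem_of x (flatten (map (@tleaves G) ts')) -> False.
  exact: apart_leaves.
have el' x := el x; setoid_rewrite mem_of_cat in el'.
congr cons.
  by apply: IHt => // x; move: (el' x) (nt x) (nt' x); tauto.
by apply: IHts => // x; move: (el' x) (nt x) (nt' x) (n2 x) (n2' x); tauto.
Qed.

Lemma fmor_thin (h h' : fmor G) : ftgt h = ftgt h' ->
  (forall x, mem_of x (fsrc h) <-> mem_of x (fsrc h')) -> h = h'.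
Proof. by move=> et es; apply: fmor_eq; apply: term_thin; [exact: svalP|exact: svalP| |]. Qed.

Lemma fsrc_spread (h : fmor G) : spread (fsrc h).
Proof. exact: spread_leaves (svalP h). Qed.

Lemma reach_antisym c d : reach c d -> reach d c -> c = d.
Proof.
case=> // y g m xy yx; case: (forest_acyclic forestG m).
exact: reach_trans yx xy.
Qed.

End Forest.

(** * The operads of the objects are free on forests *)

Section Adjoin.
Variables (n : nat) (S : option ptree) (L : moment_sig n S).

Lemma reach_old x c : reach x c -> @reach (adjoin L) (inl x) (inl c).
Proof.
elim=> [|d g m _ IH]; first exact: reach_refl.
apply: (@reach_gen (adjoin L) _ (inl d) (inl g)) => //=.
by rewrite mem_of_map; exists d.
Qed.

Lemma reach_oldP x c : @reach (adjoin L) x (inl c) -> exists2 y, x = inl y & reach y c.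
Proof.
move e : (inl c) => c' r; elim: r c e => [|d [g|g] m _ IH] //= c.
  by move=> <-; exists c => //; exact: reach_refl.
move=> -[->]; move/mem_of_map: m => [z mz ez]; have [w -> rw] := IH z ez.
by exists w => //; apply: reach_gen mz rw.
Qed.

Lemma spread_old l : spread l -> @spread (adjoin L) (map inl l).
Proof.
elim: l => //= c l IH [/conj_seqP h /IH]; split=> //.
apply/conj_seqP => d /mem_of_map[d' md <-] x /reach_oldP[y -> yc] /reach_oldP[z [<-] zd].
exact: h _ md _ yc zd.
Qed.

Lemma forest_adjoin : forest L -> forest (adjoin L).
Proof.
move=> [h1 h2 h3]; split.
- move=> [g|g] [g'|g'] //=; last by move=> [->].
  by move=> [/h1 ->].
- move=> [g|g] d /= /mem_of_map[c mc <-] /reach_oldP[y] //= [<-].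
  exact: h2.
- move=> [g|g] /=; apply: spread_old => //; apply: fsrc_spread; exact: Forest.
Qed.

End Adjoin.

Section TreeForest.
Variable S : option ptree.

Lemma subtree_cat p q : subtree S (p ++ q) = subtree (subtree S p) q.
Proof. by elim: p S => //= i p IH S'. Qed.

Lemma subtree_rcons p i : isSome (subtree S (rcons p i)) = (i < arity (subtree S p)).
Proof.
rewrite -cats1 subtree_cat /=; case: (subtree S p) => [[|ts]|] //=.
by rewrite -onthTE; case: onth.
Qed.

Lemma val_inputs (v : vertex S) :
  map val (vertex_inputs v) = [seq rcons (val v) i | i <- iota 0 (arity (subtree S (val v)))].
Proof.
rewrite /vertex_inputs (pmap_filter (@insubK _ _ _)); apply/all_filterP/allP => p.
move=> /mapP[i]; rewrite mem_iota add0n /= => ia ->.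
by rewrite isSome_insub subtree_rcons.
Qed.

Lemma mem_inputs (v : vertex S) (d : edge S) :
  mem_of d (vertex_inputs v) <-> exists i, val d = rcons (val v) i.
Proof.
split.
  move=> m; have : val d \in map val (vertex_inputs v).
    by apply/mem_ofE; rewrite mem_of_map; exists d.
  by rewrite val_inputs => /mapP[i _ ->]; exists i.
move=> [i e]; have : val d \in map val (vertex_inputs v).
  rewrite val_inputs e; apply/mapP; exists i => //.
  by rewrite mem_iota add0n /= -subtree_rcons -e; exact: (valP d).
by move=> /mem_ofE /mem_of_map[d' m /val_inj <-].
Qed.

Lemma reach_prefix (x d : edge S) : @reach (tree_signature S) x d -> prefix (val d) (val x).
Proof.
elim=> [|c v m _ IH]; first exact: prefix_refl.
move/mem_inputs: m => [i e]; apply: prefix_trans IH.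
by rewrite e -cats1 prefix_prefix.
Qed.

Lemma spread_keys (G : signature) (K : eqType) (f : scol G -> K) l : uniq (map f l) ->
  (forall c d, mem_of c l -> mem_of d l -> f c != f d -> apart c d) -> spread l.
Proof.
elim: l => //= c l IH /andP[/negP nc u] h; split.
  apply/conj_seqP => d md; apply: h; [by left|by right|].
  apply/eqP => e; apply: nc; rewrite e; apply/mem_ofE.
  by rewrite mem_of_map; exists d.
by apply: IH u _ => x y mx my; apply: h; right.
Qed.

Lemma rcons_prefix_inj (p z : seq nat) i j :
  prefix (rcons p i) z -> prefix (rcons p j) z -> i = j.
Proof.
elim: p z => [|a p IH] [|b z] //; last by rewrite !prefix_cons => /andP[_ /IH h] /andP[_ /h].
by rewrite !prefix_cons => /andP[/eqP-> _] /andP[/eqP].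
Qed.

Lemma forest_tree : forest (tree_signature S).
Proof.
split.
- by move=> v w /(congr1 val) /= e; exact: val_inj.
- move=> v d /mem_inputs[i e] /reach_prefix /size_prefix.
  by rewrite e size_rcons ltnn.
- move=> v; apply: (@spread_keys (tree_signature S) _ (fun e : edge S => val e));
    rewrite /= ?val_inputs.
    by rewrite map_inj_uniq ?iota_uniq // => i j /rcons_inj[].
  move=> c d /mem_inputs[i ei] /mem_inputs[j ej] ne x /reach_prefix.
  rewrite ei => h /reach_prefix; rewrite ej => h'.
  by move: ne; rewrite ei ej (rcons_prefix_inj h h') eqxx.
Qed.

End TreeForest.

Lemma forest_OnS n S : forest (OnS_sig n S).
Proof. by elim: n => [|n IH]; [exact: forest_tree|exact: forest_adjoin]. Qed.

(** * Edges, vertices and moments *)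

Lemma edge_rcons S (e : edge S) p i : val e = rcons p i ->
  exists2 v : vertex S, val v = p & mem_of e (vertex_inputs v).
Proof.
move=> e_p; have := valP e; rewrite /= e_p subtree_rcons => ia.
have nv : is_node (subtree S p) by case: (subtree S p) ia => [[]|].
exists (exist _ p nv) => //; apply/mem_inputs.
by exists i.
Qed.

Fixpoint vertex_gen n S (v : vertex S) : sgen (OnS_sig n S) :=
  match n with
  | 0 => v
  | m.+1 => inl (vertex_gen m v)
  end.

Lemma edge_col_inj n S : injective (@edge_col n S).
Proof. by elim: n => [|n IH] //= e e' [/IH]. Qed.

Lemma sout_vertex_gen n S (v : vertex S) :
  sout (vertex_gen n v) = edge_col n (vertex_output v).
Proof. by elim: n => //= n ->. Qed.

Lemma sin_vertex_gen n S (v : vertex S) :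
  sin (vertex_gen n v) = map (@edge_col n S) (vertex_inputs v).
Proof. by elim: n => [|n IH] /=; rewrite ?map_id // IH -map_comp. Qed.

Lemma gen_over_edge n S (g : sgen (OnS_sig n S)) e : sout g = edge_col n e ->
  exists2 v, g = vertex_gen n v & vertex_output v = e.
Proof.
elim: n g e => [|n IH] /= g e; first by exists g.
by case: g => // g [/IH[v -> <-]]; exists v.
Qed.

Lemma reach_edgeP n S x (e : edge S) : reach x (edge_col n e) ->
  exists2 e', x = edge_col n e' & prefix (val e) (val e').
Proof.
elim: n x => [|n IH] x /=; first by move=> /reach_prefix; exists x.
by move=> /reach_oldP[y -> /IH[e' -> p]]; exists e'.
Qed.

Lemma edge_eq S (e e' : edge S) : val e = val e' -> e = e'.
Proof. exact: val_inj. Qed.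

Lemma edge_reach n S (e e' : edge S) : prefix (val e) (val e') ->
  reach (edge_col n e') (edge_col n e).
Proof.
elim: n => [|n IH] p /=; last by apply: reach_old; exact: IH.
case/prefixP: p => q; elim/last_ind: q e' => [|q i IH] e' eq.
  rewrite cats0 in eq; rewrite (edge_eq eq); exact: reach_refl.
rewrite -rcons_cat in eq; have [v ev mv] := edge_rcons eq.
apply: reach_trans (IH (vertex_output v) ev).
by apply: (@reach_gen (tree_signature S) _ e' v) => //; exact: reach_refl.
Qed.

Lemma root_reach n S (e r : edge S) : val r = [::] ->
  reach (edge_col n e) (edge_col n r).
Proof. by move=> er; apply: edge_reach; rewrite er prefix0s. Qed.

Lemma moment_root n S (e : edge S) : val e = [::] ->
  moment (OnS_sig n S) (edge_col n e) = inl ord0.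
Proof.
move=> er; elim: n => [|n IH] /=.
  by rewrite /tree_moment; case: insubP => // k; rewrite er.
by rewrite IH /=; congr inl; apply: val_inj.
Qed.

Lemma moment_nonroot n S (k : nonroot S) :
  moment (OnS_sig n S) (edge_col n (val k)) = inr k.
Proof.
elim: n => [|n IH] /=; last by rewrite IH.
by rewrite /tree_moment valK.
Qed.

Lemma edge_cases S (e : edge S) : val e = [::] \/ exists k : nonroot S, e = val k.
Proof.
case E : (val e == [::]); first by left; apply/eqP.
by right; exists (exist _ e (negbT E)).
Qed.

Lemma moment_inr n S c (k : nonroot S) :
  moment (OnS_sig n S) c = inr k -> c = edge_col n (val k).
Proof.
elim: n c => [|n IH] /=.
  by rewrite /tree_moment => c; case: insubP => // k' _ <- [->].
case=> [c|h] //; case E : (moment _ c) => [i|k'] //= [ek].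
by rewrite ek in E; rewrite (IH _ E).
Qed.

Definition moment_le n S (x y : CnS_ob n S) : Prop :=
  match x, y with
  | inl i, inl j => i <= j
  | inl _, inr _ => False
  | inr _, _ => True
  end.

Lemma moment_le_trans n S (y x z : CnS_ob n S) :
  moment_le x y -> moment_le y z -> moment_le x z.
Proof. by case: x y z => [i|k] [j|k'] [l|k''] //=; exact: leq_trans. Qed.

(** An operation adjoined at level i has its sources at lower levels, and among
    the edges only the root has a moment in [n]. *)
Lemma moment_reach n S x c : reach x c ->
  moment_le (moment (OnS_sig n S) x) (moment (OnS_sig n S) c).
Proof.
have refl (y : CnS_ob n S) : moment_le y y by case: y => /=.
elim=> [|d g m _ h]; first exact: refl.
apply: moment_le_trans h _; clear x c refl; elim: n g d m => [|n IH] /=.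
  move=> v d /mem_inputs[i ei]; rewrite /tree_moment; case: insubP => // nr.
  by move: nr; rewrite ei; case: (val v).
move=> [g|h] d /mem_of_map[c' mc <-] /=.
  by have := IH _ _ mc; case: moment => [i|k]; case: moment => [j|k'].
by case: moment => [i|k] //=; apply: ltnW.
Qed.

(** The alternative is between edges and adjoined colors (i,h). As the latter
    are outputs of generators, only edges can be leaves. *)
Lemma col_cases n S (c : scol (OnS_sig n S)) :
  (exists e, c = edge_col n e) \/
  (exists i : 'I_n.+1, [/\ moment _ c = inl i, 0 < i & exists g, sout g = c]).
Proof.
elim: n c => [|n IH] /=; first by move=> e; left; exists e.
case=> [c|h]; last by right; exists ord_max; split=> //; exists (inr h).
have [[e ->]|[i [-> i0 [g <-]]]] := IH c; first by left; exists e.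
by right; exists (widen_ord (leqnSn n.+1) i); split=> //; exists (inl g).
Qed.

Lemma leaf_colP n S (c : scol (OnS_sig n S)) :
  (forall g : sgen (OnS_sig n S), sout g <> c) <-> exists2 e, c = edge_col n e & is_leaf e.
Proof.
split=> [h|[e -> le] g /gen_over_edge[v _]]; last exact: le.
have [[e ee]|[i [_ _ [g /h]]]] // := col_cases c.
by exists e => // v ev; apply: (h (vertex_gen n v)); rewrite sout_vertex_gen ev.
Qed.

(** * Raising the moment of an operation *)

Lemma up_old_top n S (k : top_op (OnS_sig n S)) :
  @up n.+1 S (old_op (val k)) = @fgen (adjoin (OnS_sig n S)) (inr k).
Proof.
rewrite /=; case: pselect => [ex|[]]; last by exists (val k).
by case: (cid ex) => h0 /= /old_op_inj ->; rewrite valK.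
Qed.

Lemma up_old_low n S (h : fmor (OnS_sig n S)) : op_moment h <> inl ord_max ->
  @up n.+1 S (old_op h) = old_op (up h).
Proof.
move=> nt; rewrite /=; case: pselect => [ex|[]]; last by exists h.
by case: (cid ex) => h0 /= /old_op_inj ->; rewrite insubF //; apply/eqP.
Qed.

Lemma op_moment_old n S (h : fmor (OnS_sig n S)) (i : 'I_n.+2) :
  op_moment (L := OnS_sig n.+1 S) (old_op h) = inl i <->
  exists2 j : 'I_n.+1, op_moment h = inl j & i = j :> nat.
Proof.
rewrite /op_moment ftgt_old /=; case: moment => [j|k]; last by split=> // -[].
split=> [[<-]|[j' [<-] e]]; first by exists j.
by congr inl; apply: val_inj.
Qed.

Lemma low_old n S (h : fmor (OnS_sig n.+1 S)) (i : 'I_n.+2) :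
  op_moment h = inl i -> i < n.+1 -> exists h0, old_op h0 = h.
Proof.
rewrite /op_moment; case E : (ftgt h) => [c|k] /= em lt; first exact: old_opP E.
by case: em lt => <-; rewrite ltnn.
Qed.

(** A color of positive moment remembers the operation that created it. *)
Lemma up_tgt_inj n S (h h' : fmor (OnS_sig n S)) (i i' : 'I_n.+1) :
  op_moment h = inl i -> op_moment h' = inl i' -> i < n -> i' < n ->
  ftgt (up h) = ftgt (up h') -> h = h'.
Proof.
elim: n h h' i i' => // n IH h h' i i' em em' lt lt'.
have [h0 e0] := low_old em lt; have [h0' e0'] := low_old em' lt'.
move: em em'; rewrite -{}e0 -{}e0'.
move=> /op_moment_old[j ej vj] /op_moment_old[j' ej' vj'].
have top (h1 : fmor (OnS_sig n S)) (l : 'I_n.+1) : op_moment h1 = inl l -> l < n = false ->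
    exists k : top_op (OnS_sig n S), val k = h1.
  move=> e /negbT; rewrite -leqNgt => nl.
  have t : op_moment h1 == inl ord_max :> 'I_n.+1 + nonroot S.
    rewrite e; apply/eqP; congr inl; apply: val_inj => /=; apply/eqP.
    by rewrite eqn_leq nl -ltnS ltn_ord.
  by exists (exist _ h1 t).
have low (h1 : fmor (OnS_sig n S)) (l : 'I_n.+1) : op_moment h1 = inl l -> l < n ->
    op_moment h1 <> inl ord_max.
  by move=> -> lt1 [e]; rewrite e ltnn in lt1.
case lj : (j < n); case lj' : (j' < n).
- rewrite (up_old_low (low _ _ ej lj)) (up_old_low (low _ _ ej' lj')) !ftgt_old => -[].
  by move=> /(IH _ _ _ _ ej ej' lj lj') ->.
- have [k <-] := top _ _ ej' lj'.
  by rewrite (up_old_low (low _ _ ej lj)) up_old_top ftgt_old.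
- have [k <-] := top _ _ ej lj.
  by rewrite (up_old_low (low _ _ ej' lj')) up_old_top ftgt_old.
- have [k <-] := top _ _ ej lj; have [k' <-] := top _ _ ej' lj'.
  by rewrite !up_old_top => -[->].
Qed.

Lemma iter_up_tgt_inj n S k (h h' : fmor (OnS_sig n S)) (i : 'I_n.+1) :
  op_moment h = inl i -> op_moment h' = inl i -> 0 < k -> i + k <= n ->
  ftgt (iter k (@up n S) h) = ftgt (iter k (@up n S) h') -> h = h'.
Proof.
move=> em em'; elim: k => // k IH _; rewrite addnS => le e.
have [j ej vj] := op_moment_iter (ltnW le) em.
have [j' ej' vj'] := op_moment_iter (ltnW le) em'.
have {}e : iter k (@up n S) h = iter k (@up n S) h'.
  by apply: up_tgt_inj e; [exact: ej|exact: ej'|rewrite vj|rewrite vj'].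
case: k IH le e {j ej vj j' ej' vj'} => // k IH le e.
by apply: IH => //; [exact: ltnW|rewrite e].
Qed.

(** The action without its proof of composability. *)
Definition push n S (x y : CnS_ob n S) (h : fmor (OnS_sig n S)) : fmor (OnS_sig n S) :=
  match x, y with
  | inl i, inl j => iter (j - i) (@up n S) h
  | _, _ => h
  end.

Lemma fsrc_push n S x y (h : fmor (OnS_sig n S)) : fsrc (push x y h) = fsrc h.
Proof. by case: x y => [i|k] [j|k'] //=; exact: fsrc_iter. Qed.

Lemma bulletE n S (x y : CnS n S) (f : hom x y) h (e : op_moment h = x) :
  bullet f e = push x y h.
Proof. by []. Qed.

Lemma op_moment_push n S (x y : CnS n S) (f : hom x y) (h : fmor (OnS_sig n S)) :
  op_moment h = x -> op_moment (push x y h) = y.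
Proof. by move=> e; exact: (mu_act (r := nS_action n S) f e). Qed.

Lemma push_comp n S (x y z : CnS n S) (f : hom x y) (g : hom y z) h :
  push y z (push x y h) = push x z h.
Proof.
case: x y z f g => [i|a] [j|b] [k|c] //= f g.
by rewrite -iterD; congr iter; rewrite addnC addnBAC // subnKC.
Qed.

Lemma push_id n S (x : CnS n S) h : push x x h = h.
Proof. by case: x => [i|k] //=; rewrite subnn. Qed.

(** * Cuts: the operations of the symmetrized operads *)

Section Cut.
Variables (m : nat) (R : option ptree).
Notation L := (OnS_sig m R).

Lemma OnS_thin (h h' : fmor L) : ftgt h = ftgt h' ->
  (forall x, mem_of x (fsrc h) <-> mem_of x (fsrc h')) -> h = h'.
Proof. exact: (fmor_thin (forest_OnS m R)). Qed.

Lemma permute_spread_inj (l : seq (scol L)) s t : spread l ->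
  is_perm (size l) s -> is_perm (size l) t -> permute s l = permute t l -> s = t.
Proof.
case: l => [|x l] sp hs ht.
  by case: s hs => [_|i s /is_perm_size //]; case: t ht => [//|j t /is_perm_size].
rewrite !(permute_nth x) ?is_perm_lt //.
have inj i j : i < size (x :: l) -> j < size (x :: l) ->
    nth x (x :: l) i = nth x (x :: l) j -> i = j.
  move=> li lj e.
  apply: (spread_inj sp (c := nth x (x :: l) i)).
    by rewrite onthE (nth_map x).
  by rewrite onthE (nth_map x) // e.
move: (x :: l) inj (is_perm_lt hs) (is_perm_lt ht) => k inj {hs ht}.
elim: s t => [|i s IH] [|j t] //= /andP[li ls] /andP[lj lt] [/inj-> //].
by move=> /IH ->.
Qed.

Lemma smor_src_mem (x : smor (OnS m R)) z :
  mem_of z (fsrc (smor_op x)) <-> mem_of z (smor_src x).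
Proof.
have -> : fsrc (smor_op x) = permute (smor_perm x) (smor_src x) by exact: (smor_srcE x).
exact: mem_of_permute (smor_is_perm x).
Qed.

Lemma permute_inverse T s k : is_perm k s ->
  exists2 t, is_perm k t & forall l : seq T, size l = k -> permute t (permute s l) = l.
Proof.
move=> hs; have [ht e] := perm_ldivP (is_perm_iota k) hs.
exists (perm_ldiv s (iota 0 k)) => // l sl.
rewrite permuteM ?(is_perm_size hs) ?sl ?is_perm_lt //.
by rewrite e -sl permute_iota.
Qed.

Lemma smor_src_permute (x : smor (OnS m R)) :
  exists2 t, is_perm (size (fsrc (smor_op x))) t & permute t (fsrc (smor_op x)) = smor_src x.
Proof.
have e : fsrc (smor_op x) = permute (smor_perm x) (smor_src x) by exact: (smor_srcE x).
have [t ht et] := permute_inverse (scol L) (smor_is_perm x).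
exists t; last by rewrite e et.
by rewrite e size_permute ?(is_perm_size (smor_is_perm x)) // is_perm_lt // smor_is_perm.
Qed.

Lemma spread_permute s (l : seq (scol L)) : is_perm (size l) s -> spread l ->
  spread (permute s l).
Proof.
case: l => [|x l] hs sp; first by case: s hs => // i s /is_perm_size.
rewrite (permute_nth x) ?is_perm_lt //.
have := is_perm_uniq hs; have := is_perm_lt hs.
elim: s {hs} => //= i s IH /andP[li ls] /andP[ni u]; split; last exact: IH.
apply/conj_seqP => d /mem_of_map[j /mem_ofE mj <-].
have lj : j < size (x :: l) by move/allP: ls; apply.
apply: (spread_onth sp (i := i) (j := j)); rewrite ?onthE ?(nth_map x) //.
by move=> e; move: ni; rewrite e mj.
Qed.

Lemma smor_src_spread (x : smor (OnS m R)) : spread (smor_src x).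
Proof.
have [t ht <-] := smor_src_permute x.
by apply: spread_permute => //; apply: fsrc_spread; exact: forest_OnS.
Qed.

(** As sources are distinct, even the permutation of an operation of the
    symmetrized operad can be recovered from its source. *)
Lemma smor_thin (x y : smor (OnS m R)) : smor_src x = smor_src y ->
  smor_tgt x = smor_tgt y -> x = y.
Proof.
move=> es et; have eo : smor_op x = smor_op y.
  by apply: OnS_thin => // z; rewrite !smor_src_mem es.
apply: smor_eq => //; apply: (permute_spread_inj (smor_src_spread x)).
- exact: smor_is_perm.
- by rewrite es; exact: smor_is_perm.
- by have e := smor_srcE x; rewrite eo (smor_srcE y) -es in e; exact: esym e.
Qed.

(** As operations are determined by their sources and their target, only the
    existence of an operation with given sources and target matters. *)
Definition cut (l : seq (scol L)) (c : scol L) : Prop :=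
  exists2 y : smor (OnS m R), smor_src y = l & smor_tgt y = c.

Lemma cut_id c : cut [:: c] c.
Proof. by exists (@smor_id (OnS m R) c). Qed.

Lemma cut_comp c (q : seq (seq (scol L) * scol L)) : cut (map snd q) c ->
  conj_seq (fun p => cut p.1 p.2) q -> cut (flatten (map fst q)) c.
Proof.
move=> [x sx tx] cq.
have [ys e1 e2] : exists2 ys : seq (smor (OnS m R)),
    map (@smor_src _) ys = map fst q & map (@smor_tgt _) ys = map snd q.
  elim: q cq {x sx tx} => [|[l d] q IH] /=; first by exists [::].
  by move=> [[y <- <-] /IH[ys <- <-]]; exists (y :: ys).
have e : map (@smor_tgt _) ys = smor_src x by rewrite sx.
by exists (smor_comp e); rewrite ?smor_tgt_comp //= e1.
Qed.

Lemma cut_permute s l c : is_perm (size l) s -> cut l c -> cut (permute s l) c.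
Proof.
move=> hs [x sx tx]; rewrite -sx in hs *.
by exists (smor_act hs).
Qed.

Lemma cut_op l c : cut l c ->
  exists2 h : fmor L, ftgt h = c & forall x, mem_of x (fsrc h) <-> mem_of x l.
Proof. by move=> [y <- <-]; exists (smor_op y) => // x; exact: smor_src_mem. Qed.

Lemma cut_spread l c : cut l c -> spread l.
Proof. by move=> [y <- _]; exact: smor_src_spread. Qed.

Lemma cut_reach l c x : cut l c -> mem_of x l -> reach x c.
Proof.
by move=> /cut_op[h <- e] /e; apply: reach_leaf; exact: svalP.
Qed.

Lemma cut_out l c : cut l c -> mem_of c l -> l = [:: c].
Proof.
move=> /[dup] cl [y sy ty] mc.
have : y = @smor_id (OnS m R) c; last by move=> e; rewrite -sy e.
have eo : smor_op y = @fid L c.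
  apply: fmor_eq; rewrite /= -ty; apply: (leaf_out_id (forest_OnS m R)).
    exact: svalP.
  by apply/smor_src_mem; rewrite sy; rewrite -ty in mc.
have sz : size l = 1.
  have := congr1 size (smor_srcE y); rewrite eo /= size_permute ?(is_perm_size (smor_is_perm y)).
    by rewrite sy.
  exact: is_perm_lt (smor_is_perm y).
apply: smor_thin; last by rewrite ty.
by rewrite sy /=; move: mc sz; case: (l) => [|d [|]] //= [->|].
Qed.

(** If the target is expanded at all, the first step of the expansion is the
    only generator over it. *)
Lemma cut_generator (g : sgen L) l : cut l (sout g) ->
  l = [:: sout g] \/ forall x, mem_of x l -> exists2 d, mem_of d (sin g) & reach x d.
Proof.
move=> /[dup] cl /cut_op[[[c|g' ts] w] /= et es].
  by left; apply: cut_out => //; apply/es; left.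
right=> x /es; rewrite /fsrc /= mem_of_flatten => -[k /mem_of_map[t mt <-] mx].
have [e /conj_seqP w1] := w; exists (tout t).
  rewrite -(forest_out (forest_OnS m R) et) -e; apply/mem_of_map; by exists t.
by apply: reach_leaf => //; exact: w1.
Qed.

Lemma cut_gen_exists l c : cut l c -> l <> [:: c] -> exists g : sgen L, sout g = c.
Proof.
move=> /[dup] cl /cut_op[[[d|g ts] w] /= et es] nl; last by exists g.
by case: nl; apply: cut_out => //; apply/es; left.
Qed.

(** A map of colors need only be checked on generators, because cuts compose. *)
Lemma cut_free (G : signature) (phi : scol G -> scol L) :
  (forall g : sgen G, cut (map phi (sin g)) (phi (sout g))) ->
  forall h : fmor G, cut (map phi (fsrc h)) (phi (ftgt h)).
Proof.
move=> cg [t w]; rewrite /fsrc /ftgt /=.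
elim/term_nested_ind: t w => [c _|g ts IH /= [e w]]; first exact: cut_id.
pose q := [seq (map phi (tleaves t), phi (tout t)) | t <- ts].
rewrite map_flatten -map_comp.
have -> : map (map phi \o @tleaves G) ts = map fst q by rewrite -map_comp.
apply: cut_comp.
  have -> : map snd q = map phi (sin g) by rewrite -e -!map_comp.
  exact: cg.
elim: ts IH w {e} @q => //= t ts IHts [IHt /IHts{}IHts] [/IHt h /IHts h'].
by split.
Qed.

Lemma cut_smor n S (phi : scol (OnS_sig n S) -> scol L) (x : smor (OnS n S)) c :
  cut (map phi (fsrc (smor_op x))) c -> cut (map phi (smor_src x)) c.
Proof.
have e : fsrc (smor_op x) = permute (smor_perm x) (smor_src x) by exact: (smor_srcE x).
have [t ht et] := permute_inverse (scol (OnS_sig n S)) (smor_is_perm x).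
move=> h; rewrite -(et (smor_src x)) // -e -permute_map; apply: cut_permute => //.
by rewrite size_map e size_permute ?(is_perm_size (smor_is_perm x)) // is_perm_lt // smor_is_perm.
Qed.

End Cut.

(** * Maps of rooted actions as maps of colors *)

Definition lies_over n S m R (phi : scol (OnS_sig n S) -> scol (OnS_sig m R))
    (h : fmor (OnS_sig n S)) (y : fmor (OnS_sig m R)) : Prop :=
  ftgt y = phi (ftgt h) /\ forall z, mem_of z (fsrc y) <-> mem_of z (map phi (fsrc h)).

Lemma lies_over_unique n S m R (phi : scol (OnS_sig n S) -> scol (OnS_sig m R)) h y y' :
  lies_over phi h y -> lies_over phi h y' -> y = y'.
Proof.
move=> [e1 e2] [e1' e2']; apply: OnS_thin; first by rewrite e1.
by move=> x; rewrite e2 e2'.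
Qed.

(** What a map of rooted actions does to colors; a is its effect on the
    objects of [n], prolonged arbitrarily to all natural numbers. *)
Record color_map n S m R (a : nat -> CnS m R)
    (phi : scol (OnS_sig n S) -> scol (OnS_sig m R)) : Prop := ColorMap {
  cm_cut : forall h : fmor (OnS_sig n S), cut (map phi (fsrc h)) (phi (ftgt h));
  cm_moment : forall c (i : 'I_n.+1),
    moment (OnS_sig n S) c = inl i -> moment (OnS_sig m R) (phi c) = a i;
  cm_up : forall (h : fmor (OnS_sig n S)) (i : 'I_n.+1) y,
    op_moment h = inl i -> i < n -> lies_over phi h y ->
    phi (ftgt (up h)) = ftgt (push (a i) (a i.+1) y) }.

Section ColorMap.
Variables (m : nat) (R : option ptree) (S : option ptree) (a : nat -> CnS m R).
Notation L := (OnS_sig m R).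

Lemma cm_lies_over n (phi : scol (OnS_sig n S) -> scol L) h : color_map a phi ->
  exists y, lies_over phi h y.
Proof. by move=> H; have [y e1 e2] := cut_op (cm_cut H h); exists y. Qed.

Lemma cm_restrict n (phi : scol (OnS_sig n.+1 S) -> scol L) :
  color_map a phi -> color_map (n := n) (S := S) a (fun c => phi (inl c)).
Proof.
move=> [h1 h2 h3]; split.
- move=> h; have := h1 (@old_op n S (OnS_sig n S) h).
  by rewrite fsrc_old ftgt_old -map_comp.
- move=> c i e; have := h2 (inl c) (widen_ord (leqnSn n.+1) i).
  by apply; rewrite /= e.
- move=> h i y em lt [e1 e2].
  have low : op_moment h <> inl ord_max.
    by rewrite em => -[e]; move: lt; rewrite e ltnn.
  have em' : op_moment (L := OnS_sig n.+1 S) (old_op h) = inl (widen_ord (leqnSn n.+1) i).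
    by apply/op_moment_old; exists i.
  have := h3 (old_op h) _ y em'; rewrite (up_old_low low) ftgt_old; apply => //=.
  by split; rewrite ?ftgt_old ?fsrc_old // => z; rewrite e2 -map_comp.
Qed.

Lemma lies_over_old n (phi : scol (OnS_sig n.+1 S) -> scol L) (h : fmor (OnS_sig n S)) y :
  lies_over phi (@old_op n S (OnS_sig n S) h) y <-> lies_over (n := n) (fun c => phi (inl c)) h y.
Proof. by rewrite /lies_over ftgt_old fsrc_old -map_comp. Qed.

Lemma top_moment n (k : top_op (OnS_sig n S)) : op_moment (val k) = inl ord_max.
Proof. by have /eqP := valP k. Qed.

(** The value at an adjoined color is forced by compatibility with the action. *)
Lemma cm_top n (phi : scol (OnS_sig n.+1 S) -> scol L) k y : color_map a phi ->
  lies_over (n := n) (fun c => phi (inl c)) (val k) y ->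
  phi (inr k) = ftgt (push (a n) (a n.+1) y).
Proof.
move=> H lo.
have em : op_moment (L := OnS_sig n.+1 S) (old_op (val k)) = inl (widen_ord (leqnSn n.+1) ord_max).
  by apply/op_moment_old; exists ord_max => //; exact: top_moment.
have := cm_up H em; rewrite up_old_top; apply => //=.
by apply/lies_over_old.
Qed.

Lemma cm_unique n (phi psi : scol (OnS_sig n S) -> scol L) :
  color_map a phi -> color_map a psi ->
  (forall e, phi (edge_col n e) = psi (edge_col n e)) -> forall c, phi c = psi c.
Proof.
elim: n phi psi => [|n IH] phi psi H H' e; first exact: e.
have ol c : phi (inl c) = psi (inl c).
  exact: (IH _ _ (cm_restrict H) (cm_restrict H') e).
case=> [c|k]; first exact: ol.
have [y lo] := cm_lies_over (val k) (cm_restrict H).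
rewrite (cm_top H lo) (cm_top H' (y := y)) //.
case: lo => e1 e2; split; first by rewrite e1 ol.
move=> z; rewrite e2.
by have -> : map (fun c => phi (inl c)) =1 map (fun c => psi (inl c)) by exact: eq_map.
Qed.

(** The universal property of the objects: level by level, the adjoined color
    (i,h) goes to the target of the raised image of h. *)
Lemma cm_exists n (beta : edge S -> scol L) :
  (forall i, i < n -> hom (a i) (a i.+1)) ->
  (forall e, val e = [::] -> moment _ (beta e) = a 0) ->
  (forall v : vertex S, cut (map beta (vertex_inputs v)) (beta (vertex_output v))) ->
  exists2 phi : scol (OnS_sig n S) -> scol L,
    color_map a phi & forall e, phi (edge_col n e) = beta e.
Proof.
move=> ha hr hv; elim: n ha => [|n IH] ha.
  exists beta => //; split=> //; first by apply: cut_free.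
  move=> e i; have [er _|[k -> ]] := edge_cases e; first by rewrite ord1 hr.
  by rewrite [moment _ _](moment_nonroot 0).
have [phi H eb] : exists2 phi : scol (OnS_sig n S) -> scol L,
    color_map a phi & forall e, phi (edge_col n e) = beta e.
  by apply: IH => i lt; apply: ha; exact: ltnW.
have [Y hY] : exists Y : top_op (OnS_sig n S) -> fmor L,
    forall k, lies_over phi (val k) (Y k).
  by have /choice[Y hY] := fun k : top_op (OnS_sig n S) => cm_lies_over (val k) H; exists Y.
have mY k : op_moment (Y k) = a n.
  have [e1 e2] := hY k; rewrite /op_moment e1; apply: (cm_moment H (i := ord_max)).
  exact: top_moment.
pose psi (c : scol (OnS_sig n.+1 S)) : scol L :=
  match c with inl c => phi c | inr k => ftgt (push (a n) (a n.+1) (Y k)) end.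
exists psi; last by move=> e; exact: eb.
have psi_top k z : mem_of z (fsrc (push (a n) (a n.+1) (Y k))) <->
    mem_of z (map phi (fsrc (val k))).
  by rewrite fsrc_push; exact: (hY k).2.
split.
- apply: cut_free => -[g|k] /=; rewrite -map_comp.
    have := cm_cut H (fgen g); rewrite fsrc_gen; exact.
  have [x sx tx] := cm_cut H (val k).
  have eY : smor_op x = Y k.
    have [e1 e2] := hY k; apply: OnS_thin; first by rewrite e1.
    by move=> z; rewrite smor_src_mem e2 sx.
  have mx : smor_mu (X := nS_object (m, R)) x = a n by rewrite /smor_mu /= eY; exact: mY.
  exists (smor_bullet (X := nS_object (m, R)) (ha n (leqnn _)) mx); first exact: sx.
  by rewrite /smor_tgt /smor_bullet /= bulletE eY.
- move=> [c|k] i /=.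
    case E : (moment _ c) => [j|//] [<-]; exact: (cm_moment H E).
  by move=> [<-]; apply: (op_moment_push (ha n (leqnn _))); exact: mY.
- move=> h i y em lt lo; have [h0 e0] := low_old em lt.
  rewrite -{}e0 in em lo *; have [j ej vj] := (op_moment_old _ _).1 em.
  have {}lo : lies_over phi h0 y := (lies_over_old psi h0 y).1 lo.
  case lj : (j < n).
    have low : op_moment h0 <> inl ord_max by rewrite ej => -[e]; rewrite e ltnn in lj.
    by rewrite (up_old_low low) ftgt_old /= vj; apply: (cm_up H ej).
  have jn : j = n :> nat by apply/eqP; rewrite eqn_leq -ltnS ltn_ord leqNgt lj.
  have tp : op_moment h0 == inl ord_max :> 'I_n.+1 + nonroot S.
    by rewrite ej; apply/eqP; congr inl; apply: val_inj.
  have [k ek] : exists k : top_op (OnS_sig n S), val k = h0 by exists (exist _ h0 tp).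
  rewrite -ek up_old_top /= /ftgt /= vj jn; congr (ftgt (push _ _ _)).
  by apply: (lies_over_unique (hY k)); rewrite ek.
Qed.

End ColorMap.

Lemma CnS_hom_irrelevance n S (x y : CnS n S) (f g : hom x y) : f = g.
Proof. exact: (@Prop_irrelevance (CnS_hom x y)). Qed.

Lemma fsrc_cut n S (h : fmor (OnS_sig n S)) : cut (fsrc h) (ftgt h).
Proof.
have e : src (h : mor (OnS n S)) = permute (iota 0 (size (fsrc h))) (fsrc h).
  by rewrite permute_iota.
by exists (SMor (is_perm_iota _) e).
Qed.

Lemma gen_cut n S (g : sgen (OnS_sig n S)) : cut (sin g) (sout g).
Proof. by have := fsrc_cut (fgen g); rewrite fsrc_gen. Qed.

Lemma cut_preserving_reach n S m R (phi : scol (OnS_sig n S) -> scol (OnS_sig m R)) x c :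
  (forall g, cut (map phi (sin g)) (phi (sout g))) -> reach x c -> reach (phi x) (phi c).
Proof.
move=> h; elim=> [|d g mg _ IH]; first exact: reach_refl.
apply: reach_trans IH _; apply: (cut_reach (h g)).
by apply/mem_of_map; exists d.
Qed.

Section Hom.
Variables a b : Delta_Omega.
Implicit Types f g : @hom Delta_Omega a b.

Definition obm f (x : CnS a.1 a.2) : CnS b.1 b.2 := map_c (rs_map f) x.

Definition colm f (c : scol (OnS_sig a.1 a.2)) : scol (OnS_sig b.1 b.2) :=
  mcol (map_d (rs_map f)) c.

Lemma obm_hom f x y : hom x y -> hom (obm f x) (obm f y).
Proof. exact: (fhom (map_c (rs_map f))). Qed.

Lemma colm_cut f l c : cut l c -> cut (map (colm f) l) (colm f c).
Proof.
move=> [y <- <-]; exists (mmor (map_d (rs_map f)) y).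
  exact: (src_mmor (map_d (rs_map f)) y).
exact: (tgt_mmor (map_d (rs_map f)) y).
Qed.

Lemma obm_moment f c : obm f (moment (OnS_sig a.1 a.2) c) = moment _ (colm f c).
Proof.
have := map_mu (rs_map f) (@smor_id (OnS a.1 a.2) c).
by rewrite (mmor_id (map_d (rs_map f)) c).
Qed.

Lemma colm_reach f x c : reach x c -> reach (colm f x) (colm f c).
Proof.
by apply: cut_preserving_reach => g; apply: colm_cut; exact: gen_cut.
Qed.

(** Compatibility with the action of all maps of [n] is read off on the maps
    i -> i+1 and on targets only, as the action preserves sources. *)
Lemma hom_color_map f : color_map (fun i => obm f (inl (inord i))) (colm f).
Proof.
split.
- by move=> h; apply: colm_cut; exact: fsrc_cut.
- by move=> c i e; rewrite -obm_moment e inord_val.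
move=> h i y em lt lo; have vi : (inord i.+1 : 'I_a.1.+1) = i.+1 :> nat by rewrite inordK.
have ii : inord i = i by rewrite inord_val.
rewrite ii.
have [x [sx tx ox]] : exists x : smor (OnS a.1 a.2),
    [/\ smor_src x = fsrc h, smor_tgt x = ftgt h & smor_op x = h].
  have e : src (h : mor (OnS a.1 a.2)) = permute (iota 0 (size (fsrc h))) (fsrc h).
    by rewrite permute_iota.
  by exists (SMor (is_perm_iota _) e).
have ij : @hom (CnS a.1 a.2) (inl i) (inl (inord i.+1)) by rewrite /= vi.
have mx : smor_mu (X := nS_object a) x = inl i by rewrite /smor_mu /= ox.
have mfx : smor_mu (X := nS_object b) (mmor (map_d (rs_map f)) x) = obm f (inl i).
  by rewrite -mx; exact/esym/(map_mu (rs_map f) x).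
have T := tgt_mmor (map_d (rs_map f)) (smor_bullet (X := nS_object a) ij mx).
have := etrans (esym T) (congr1 (@smor_tgt _) (@map_act _ _ (rs_map f) _ _ ij x mx mfx)).
rewrite -[LHS]/(colm f (ftgt (push (inl i) (inl (inord i.+1)) (smor_op x)))).
rewrite -[RHS]/(ftgt (push (obm f (inl i)) (obm f (inl (inord i.+1)))
  (smor_op (mmor (map_d (rs_map f)) x)))).
rewrite /= vi subSnn ox => ->.
congr (ftgt (push _ _ _)); case: lo => e1 e2; apply: OnS_thin.
  rewrite e1 -tx; exact: (tgt_mmor (map_d (rs_map f)) x).
move=> z; rewrite e2 -sx smor_src_mem.
have <- : smor_src (mmor (map_d (rs_map f)) x) = map (colm f) (smor_src x).
  exact: (src_mmor (map_d (rs_map f)) x).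
by rewrite -smor_src_mem.
Qed.

Lemma hom_eq_col f g : (forall x, obm f x = obm g x) -> (forall c, colm f c = colm g c) ->
  f = g.
Proof.
move=> eo ec; apply: ra_sym_map_eq; apply: ra_ns_map_eq.
  case: f g eo {ec} => [[[o h p q] d e1 e2] e3] [[[o' h' p' q'] d' e1' e2'] e3'] eo.
  have eo' : o = o' by apply: funext => x; exact: eo.
  case: o' / eo' h' p' q' e1' e2' e3' {eo} => h' p' q' e1' e2' e3' /=.
  apply: (cfunctor_eq (erefl _) (erefl _)).
  apply: functional_extensionality_dep => x; apply: functional_extensionality_dep => y.
  by apply: funext => z; exact: CnS_hom_irrelevance.
apply: operad_map_eq; first by apply: funext => c; exact: ec.
apply: funext => x; apply: smor_thin.
  apply: etrans (src_mmor (map_d (rs_map f)) x) _.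
  apply: etrans _ (esym (src_mmor (map_d (rs_map g)) x)).
  by apply: eq_map => c; exact: ec.
apply: etrans (tgt_mmor (map_d (rs_map f)) x) _.
by apply: etrans _ (esym (tgt_mmor (map_d (rs_map g)) x)); exact: ec.
Qed.

(** Rigidity: the values at the adjoined colors are forced level by level, and
    an operation can only go to the operation with the right source and
    target. *)
Lemma hom_eq f g : (forall i, obm f (inl i) = obm g (inl i)) ->
  (forall e, colm f (edge_col a.1 e) = colm g (edge_col a.1 e)) -> f = g.
Proof.
move=> eo ee; have ec : forall c, colm f c = colm g c.
  apply: (cm_unique (hom_color_map f)) => //.
  have -> : (fun i => obm f (inl (inord i))) = (fun i => obm g (inl (inord i))).
    by apply: funext => i; exact: eo.
  exact: hom_color_map.
apply: hom_eq_col => // -[i|k]; first exact: eo.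
by rewrite -(moment_nonroot a.1 k) !obm_moment ec.
Qed.

Variables (alpha : nat -> CnS b.1 b.2) (phi : scol (OnS_sig a.1 a.2) -> scol (OnS_sig b.1 b.2)).
Hypothesis alpha_mono : forall i, i < a.1 -> hom (alpha i) (alpha i.+1).
Hypothesis phi_cm : color_map alpha phi.

Lemma alpha_hom i j : i <= j -> j <= a.1 -> hom (alpha i) (alpha j).
Proof.
move=> ij; rewrite -(subnKC ij); elim: (j - i) => [|k IH] le.
  by rewrite addn0; exact: idc.
rewrite addnS in le *; exact: cmp (alpha_mono le) (IH (ltnW le)).
Qed.

Definition cm_ob (x : CnS a.1 a.2) : CnS b.1 b.2 :=
  match x with
  | inl i => alpha i
  | inr k => moment _ (phi (edge_col a.1 (val k)))
  end.

Lemma cm_ob_hom (x y : CnS a.1 a.2) : hom x y -> hom (cm_ob x) (cm_ob y).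
Proof.
case: x y => [i|k] [j|k'] //=; first by move=> ij; apply: alpha_hom; rewrite // -ltnS.
by move=> ->; exact: CnS_hom_id.
Qed.

Definition cm_functor : cfunctor (CnS a.1 a.2) (CnS b.1 b.2) :=
  @CFunctor (CnS a.1 a.2) (CnS b.1 b.2) cm_ob (fun x y => @cm_ob_hom x y)
    (fun _ => CnS_hom_irrelevance _ _) (fun _ _ _ _ _ => CnS_hom_irrelevance _ _).

Lemma cm_smor_exists (x : smor (OnS a.1 a.2)) : exists y : smor (OnS b.1 b.2),
  smor_src y = map phi (smor_src x) /\ smor_tgt y = phi (smor_tgt x).
Proof. by have [y] := cut_smor (cm_cut phi_cm (smor_op x)); exists y. Qed.

Definition cm_smor (x : smor (OnS a.1 a.2)) : smor (OnS b.1 b.2) :=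
  projT1 (cid (cm_smor_exists x)).

Lemma src_cm_smor x : smor_src (cm_smor x) = map phi (smor_src x).
Proof. by rewrite /cm_smor; case: cid => y []. Qed.

Lemma tgt_cm_smor x : smor_tgt (cm_smor x) = phi (smor_tgt x).
Proof. by rewrite /cm_smor; case: cid => y []. Qed.

Definition cm_operad : operad_map (sym_ns_operad (OnS a.1 a.2)) (sym_ns_operad (OnS b.1 b.2)).
Proof.
refine (@OperadMap (sym_ns_operad (OnS a.1 a.2)) (sym_ns_operad (OnS b.1 b.2))
  phi cm_smor src_cm_smor tgt_cm_smor _ _).
- move=> c; apply: smor_thin; first by rewrite src_cm_smor.
  by rewrite tgt_cm_smor.
- move=> g gs e e'; apply: smor_thin.
    rewrite src_cm_smor /= map_flatten -!map_comp; congr flatten; apply: eq_map => x.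
    exact/esym/src_cm_smor.
  by rewrite tgt_cm_smor !smor_tgt_comp tgt_cm_smor.
Defined.

Lemma cm_ob_moment c : cm_ob (moment (OnS_sig a.1 a.2) c) = moment _ (phi c).
Proof.
case E : moment => [i|k] /=; first by rewrite (cm_moment phi_cm E).
by rewrite (moment_inr E).
Qed.

Lemma cm_smor_lies_over (x : smor (OnS a.1 a.2)) : lies_over phi (smor_op x) (smor_op (cm_smor x)).
Proof.
split; first exact: tgt_cm_smor.
move=> z; rewrite smor_src_mem src_cm_smor !mem_of_map.
by split=> -[y m <-]; exists y => //; apply/smor_src_mem.
Qed.

Lemma cm_iter_up k h y (i j : 'I_a.1.+1) : op_moment h = inl i -> j = i + k :> nat ->
  lies_over phi h y ->
  lies_over phi (iter k (@up a.1 a.2) h) (push (alpha i) (alpha j) y).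
Proof.
move=> em; elim: k j => [|k IH] j vj lo.
  by have -> : j = i by [apply: ord_inj; rewrite vj addn0]; rewrite push_id.
have lt : i + k < a.1 by rewrite -addnS -vj -ltnS.
have [j' ej' vj'] := op_moment_iter (ltnW lt) em.
have {}IH := IH j' vj' lo; have lj' : j' < a.1 by rewrite vj'.
have := cm_up phi_cm ej' lj' IH.
have -> : j'.+1 = j by rewrite vj' vj addnS.
rewrite (@push_comp _ _ (alpha i) (alpha j') (alpha j)); last 2 first.
- by apply: alpha_hom; rewrite ?vj' ?leq_addr // ltnW.
- by apply: alpha_hom; rewrite ?vj' ?vj ?leq_add2l // addnS.
move=> e; split; first by rewrite -e.
by move=> z; rewrite fsrc_push fsrc_up -(fsrc_push (alpha i) (alpha j') y); exact: IH.2.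
Qed.

(** Conversely an operation is sent to the operation with the prescribed source
    and target; uniqueness of the latter gives all the axioms of a map. *)
Lemma hom_of_cm : exists f : @hom Delta_Omega a b,
  (forall i : 'I_a.1.+1, obm f (inl i) = alpha i) /\ forall c, colm f c = phi c.
Proof.
have mu_ok (g : smor (OnS a.1 a.2)) :
  cm_functor (smor_mu (X := nS_object a) g) = smor_mu (X := nS_object b) (cm_smor g).
  rewrite /smor_mu /= {1}/op_moment cm_ob_moment -/(smor_tgt g) -tgt_cm_smor.
  by [].
unshelve eexists (@RaSymMap (sym_ra (nS_object a)) (sym_ra (nS_object b))
  (@RaNsMap (ra_sym_ns (sym_ra (nS_object a))) (ra_sym_ns (sym_ra (nS_object b)))
    cm_functor cm_operad mu_ok _) _); last by [].
- move=> x y f g e e' /=; apply: smor_thin; first by rewrite src_cm_smor /= src_cm_smor.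
  rewrite tgt_cm_smor /smor_tgt /=.
  case: x y f g e e' => [i|k] [j|k'] //= f g e e'.
    have lo := cm_iter_up e (esym (subnKC f)) (cm_smor_lies_over g).
    exact: esym lo.1.
  rewrite [in RHS]bulletE.
  have -> : push (moment (OnS_sig b.1 b.2) (phi (edge_col a.1 (val k))))
    (moment (OnS_sig b.1 b.2) (phi (edge_col a.1 (val k')))) (smor_op (cm_smor g)) =
    smor_op (cm_smor g) by rewrite -f push_id.
  exact/esym/tgt_cm_smor.
- move=> s g h h' /=; apply: smor_thin.
    by rewrite src_cm_smor /= src_cm_smor permute_map.
  by rewrite tgt_cm_smor /=; exact/esym/tgt_cm_smor.
Qed.

End Hom.

Lemma hom_exists (a b : Delta_Omega) (alpha : nat -> CnS b.1 b.2)
    (beta : edge a.2 -> scol (OnS_sig b.1 b.2)) :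
  (forall i, i < a.1 -> hom (alpha i) (alpha i.+1)) ->
  (forall e, val e = [::] -> moment _ (beta e) = alpha 0) ->
  (forall v : vertex a.2, cut (map beta (vertex_inputs v)) (beta (vertex_output v))) ->
  exists f : @hom Delta_Omega a b,
    (forall i : 'I_a.1.+1, obm f (inl i) = alpha i) /\
    forall e, colm f (edge_col a.1 e) = beta e.
Proof.
move=> h1 h2 h3; have [phi H e] := cm_exists h1 h2 h3.
by have [f [fo fc]] := hom_of_cm h1 H; exists f; split=> // x; rewrite fc.
Qed.

(** * The two classes of maps *)

Local Notation "g <o> f" := (cmp (c := Delta_Omega) g f)
  (at level 40, left associativity).

Lemma root_exists S (e : edge S) : exists r : edge S, val r = [::].
Proof.
have h : isSome (subtree S [::]).
  case: S e => [t|] //= [p] h; suff : subtree None p = None by move=> e; rewrite e in h.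
  by elim: p {h}.
by exists (exist _ [::] h).
Qed.

Lemma hom_inl n S (x y : CnS n S) : hom x y -> x <> y ->
  exists2 p : 'I_n.+1, x = inl p & exists2 q : 'I_n.+1, y = inl q & p < q.
Proof.
case: x y => [p|k] [q|k'] //= h ne; last by case: ne; rewrite h.
exists p => //; exists q => //; rewrite ltn_neqAle h andbT.
by apply/eqP => e; apply: ne; congr inl; apply: ord_inj.
Qed.

(** Colors at successive levels have different moments, and at each level the
    color (i,h) remembers h; but a non-root edge might take a positive moment,
    which is then at most that of the image of the root. *)
Lemma cm_injective m R n S (a : nat -> CnS m R) (phi : scol (OnS_sig n S) -> scol (OnS_sig m R)) :
  color_map a phi -> (forall i, i < n -> hom (a i) (a i.+1)) ->
  (forall i j, i <= n -> j <= n -> a i = a j -> i = j) ->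
  injective (fun e => phi (edge_col n e)) -> injective phi.
Proof.
elim: n phi => [|n IH] phi H hom_a inj_a inj_e; first exact: inj_e.
have inj_old : injective (fun c : scol (OnS_sig n S) => phi (inl c)).
  apply: IH (cm_restrict H) _ _ inj_e => [i lt|i j li lj].
    by apply: hom_a; exact: ltnW.
  by apply: inj_a; apply: leqW.
have [|p ep [q eq pq]] := hom_inl (hom_a n (leqnn _)).
  by move=> e; have /eqP := inj_a _ _ (leqnSn _) (leqnn _) e; rewrite ltn_eqF.
have mr (k : top_op (OnS_sig n S)) : moment _ (phi (inr k)) = inl q.
  by rewrite -eq; apply: (cm_moment H (i := ord_max)).
have low i : i <= n -> moment_le (a 0) (a i).
  elim: i => [_|i IHi li]; first by case: (a 0) => /=.
  apply: moment_le_trans (IHi (ltnW li)) _.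
  have := hom_a i (ltnW li); case: (a i) (a i.+1) => [x|x] [y|y] //=.
(* The image of an edge lies above the image of the root, so that its moment is
   at most a 0, which is less than q. *)
have old_adj (c : scol (OnS_sig n S)) (k : top_op (OnS_sig n S)) : phi (inl c) <> phi (inr k).
  move=> e; have := mr k; rewrite -e; case E : (moment (OnS_sig n S) c) => [i|k'].
    rewrite (cm_moment (cm_restrict H) E) -eq => ee.
    have /eqP := inj_a _ _ (ltnW (ltn_ord i)) (leqnn _) ee.
    by rewrite ltn_eqF.
  move=> mc; have [r er] := root_exists (val k').
  have rc : reach (phi (inl c)) (phi (inl (edge_col n r))).
    apply: (cut_preserving_reach (phi := phi) (x := inl c) (c := inl (edge_col n r))).
      by move=> g; have := cm_cut H (fgen g); rewrite fsrc_gen.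
    by apply: reach_old; rewrite (moment_inr E); exact: root_reach.
  have := moment_reach rc; rewrite mc (cm_moment (cm_restrict H) (moment_root n er)).
  move=> h; have := moment_le_trans (h : moment_le (inl q) (a 0)) (low n (leqnn n)).
  by rewrite ep /= leqNgt pq.
case=> [c|k] [c'|k'] e; first by rewrite (inj_old _ _ e).
- by case: (old_adj _ _ e).
- by case: (old_adj _ _ (esym e)).
have [y lo] := cm_lies_over (val k) (cm_restrict H).
have [y' lo'] := cm_lies_over (val k') (cm_restrict H).
have my : op_moment y = inl p.
  rewrite /op_moment lo.1 -ep; apply: (cm_moment (cm_restrict H) (i := ord_max)).
  exact: top_moment.
have my' : op_moment y' = inl p.
  rewrite /op_moment lo'.1 -ep; apply: (cm_moment (cm_restrict H) (i := ord_max)).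
  exact: top_moment.
move: e; rewrite (cm_top H lo) (cm_top H lo') ep eq /=.
move=> /(iter_up_tgt_inj my my') ey.
have {}ey : y = y' by apply: ey; rewrite ?subn_gt0 // subnKC ?(ltnW pq) // -ltnS.
congr inr; apply: val_inj; apply: OnS_thin.
  by apply: inj_old; rewrite -lo.1 -lo'.1 ey.
move: lo.2 lo'.2; rewrite -ey => s s' z.
have mem_inj l :
    mem_of (phi (inl z)) (map (fun c : scol (OnS_sig n S) => phi (inl c)) l) <-> mem_of z l.
  by rewrite mem_of_map; split=> [[x mx /inj_old<-]//|mz]; exists z.
by rewrite -mem_inj -s s' mem_inj.
Qed.

Section Classes.
Variables a b : Delta_Omega.
Implicit Type f : @hom Delta_Omega a b.

Definition plus f : Prop :=
  injective (fun i : 'I_a.1.+1 => obm f (inl i)) /\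
  injective (fun e : edge a.2 => colm f (edge_col a.1 e)).

Definition minus f : Prop :=
  [/\ forall j : 'I_b.1.+1, exists i : 'I_a.1.+1, obm f (inl i) = inl j,
      forall c : scol (OnS_sig b.1 b.2), exists c', colm f c' = c &
      forall e : edge a.2, is_leaf e -> exists2 e' : edge b.2, is_leaf e' &
        colm f (edge_col a.1 e) = edge_col b.1 e'].

Lemma colm_inj f : plus f -> injective (colm f).
Proof.
move=> [i1 i2]; apply: (cm_injective (hom_color_map f)) => //.
  by move=> i lt; apply: obm_hom; rewrite /= !inordK // ltnW.
move=> i j li lj /i1 /(congr1 (@nat_of_ord _)).
by rewrite !inordK.
Qed.

Lemma obm_cases f :
  (exists al : 'I_a.1.+1 -> 'I_b.1.+1, forall i, obm f (inl i) = inl (al i)) \/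
  (exists k, forall i : 'I_a.1.+1, obm f (inl i) = inr k).
Proof.
have h i : hom (obm f (inl ord0)) (obm f (inl i)) by apply: obm_hom.
case E : (obm f (inl ord0)) => [p|k]; [left|right].
  have /choice[al e] : forall i, exists q, obm f (inl i) = inl q.
    by move=> i; have := h i; rewrite E; case: (obm f (inl i)) => // q _; exists q.
  by exists al.
exists k => i; have := h i; rewrite E; case: (obm f (inl i)) => // q /= e.
by rewrite e.
Qed.

Lemma minus_obm f : minus f ->
  exists2 al : 'I_a.1.+1 -> 'I_b.1.+1, forall i, obm f (inl i) = inl (al i) &
    forall j, exists i, al i = j.
Proof.
move=> [h _ _]; have [[al e]|[k e]] := obm_cases f; last first.
  by have [i] := h ord0; rewrite e.
by exists al => // j; have [i] := h j; rewrite e => -[<-]; exists i.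
Qed.

Lemma obm_mono f al : (forall i, obm f (inl i) = inl (al i)) ->
  forall i j : 'I_a.1.+1, i <= j -> al i <= al j.
Proof.
move=> e i j ij; have := @obm_hom a b f (inl i) (inl j) ij.
by rewrite !e.
Qed.

End Classes.

Section Composition.
Variables a b c : Delta_Omega.
Variables (g : @hom Delta_Omega b c) (f : @hom Delta_Omega a b).

Lemma obm_cmp x : obm (g <o> f) x = obm g (obm f x).
Proof. by []. Qed.

Lemma colm_cmp x : colm (g <o> f) x = colm g (colm f x).
Proof. by []. Qed.

Lemma plus_cmp : plus g -> plus f -> plus (g <o> f).
Proof.
move=> pg pf; split; last first.
  by move=> e e'; rewrite !colm_cmp => /(colm_inj pg) /pf.2.
move=> i j; rewrite !obm_cmp; have [[al e]|[k e]] := obm_cases f.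
  by rewrite !e => /pg.1 h; apply: pf.1; rewrite /= !e h.
by move=> _; apply: pf.1; rewrite /= !e.
Qed.

Lemma minus_cmp : minus g -> minus f -> minus (g <o> f).
Proof.
move=> [g1 g2 g3] [f1 f2 f3]; split.
- by move=> j; have [i ei] := g1 j; have [k ek] := f1 i; exists k; rewrite obm_cmp ek.
- by move=> x; have [y ey] := g2 x; have [z ez] := f2 y; exists z; rewrite colm_cmp ez.
- move=> e /f3[e' /g3[e'' l' h'] h]; exists e'' => //.
  by rewrite colm_cmp h.
Qed.

End Composition.

Lemma plus_id a : plus (idc (c := Delta_Omega) a).
Proof. by split; [move=> i j [] | exact: edge_col_inj]. Qed.

Lemma minus_id a : minus (idc (c := Delta_Omega) a).
Proof. by split=> [j|c|e le]; [exists j|exists c|exists e]. Qed.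

Lemma moment_exists n S (e : edge S) (i : 'I_n.+1) :
  exists c, moment (OnS_sig n S) c = inl i.
Proof.
have [r er] := root_exists e.
elim: n i => [|n IH] i; first by exists r; rewrite [LHS](moment_root 0 er) (ord1 i).
case: (ltnP i n.+1) => li.
  have [c ec] := IH (Ordinal li); exists (inl c); rewrite /= ec.
  by congr inl; apply: ord_inj.
have [c ec] := IH ord_max.
have t : op_moment (fid c) == inl ord_max :> 'I_n.+1 + nonroot S by apply/eqP.
exists (inr (exist _ (fid c) t)) => /=; congr inl; apply: ord_inj.
by apply/eqP; rewrite eqn_leq li -ltnS ltn_ord.
Qed.

(** When the first tree is not empty, every object of [n] is the moment of a
    color, and a map is determined by its effect on colors. When it is empty, a
    map to b might pick non-root edges of b.2 as objects. *)
Lemma plus_mono a b c (g : @hom Delta_Omega b c) (u v : @hom Delta_Omega a b) :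
  plus g -> (exists _ : edge a.2, True) \/ (edge b.2 -> False) ->
  g <o> u = g <o> v -> u = v.
Proof.
move=> pg ne e.
have ec x : colm u x = colm v x.
  by apply: (colm_inj pg); rewrite -!colm_cmp e.
apply: hom_eq => // i; case: ne => [[e0 _]|ne].
  by have [x <-] := moment_exists e0 i; rewrite !obm_moment ec.
have eo : obm g (obm u (inl i)) = obm g (obm v (inl i)) by rewrite -!obm_cmp e.
move: eo; case: (obm u _) (obm v _) => [p|k] [q|k'].
- by move=> /pg.1 ->.
- by case: (ne (val k')).
- by case: (ne (val k)).
- by case: (ne (val k)).
Qed.

(** * Isomorphisms *)

Lemma spread_eq (G : signature) (l : seq (scol G)) x y z : spread l ->
  mem_of x l -> mem_of y l -> reach z x -> reach z y -> x = y.
Proof.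
move=> sp /mem_of_onth[i ei] /mem_of_onth[j ej] zx zy; apply: contrapT => ne.
apply: (spread_onth sp ei ej _ zx zy) => ij.
by apply: ne; move: ej; rewrite -ij ei => -[].
Qed.

Lemma spread_colm a b (f : @hom Delta_Omega a b) l : spread (map (colm f) l) -> spread l.
Proof.
elim: l => //= c l IH [/conj_seqP h /IH{}IH]; split=> //.
apply/conj_seqP => d md x xc xd; apply: (h (colm f d) _ (colm f x)).
- by apply/mem_of_map; exists d.
- exact: colm_reach.
- exact: colm_reach.
Qed.

(** The sources of a cut being distinct, a list without repetition with the same
    members is a permutation of them. *)
Lemma cut_set m R (l l' : seq (scol (OnS_sig m R))) c : cut l c -> spread l' ->
  (forall z, mem_of z l <-> mem_of z l') -> cut l' c.
Proof.
move=> cl sp' e; have sp := cut_spread cl.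
have un (k : seq {classic scol (OnS_sig m R)}) : @spread (OnS_sig m R) k -> uniq k.
  elim: k => //= x k IH [/conj_seqP h /IH ->]; rewrite andbT.
  apply/negP => mx; have {}mx := (mem_ofE _ _).2 mx.
  exact: h _ mx x (reach_refl _) (reach_refl _).
have pe : @perm_eq {classic scol (OnS_sig m R)} l' l.
  apply: uniq_perm; [exact: un|exact: un|] => z.
  have E (k : seq {classic scol (OnS_sig m R)}) := mem_ofE z k.
  by apply/idP/idP => mz; apply: (E _).1; apply: (e z).2 || apply: (e z).1; apply: (E _).2.
case: l cl pe {e sp} => [|x l] cl pe.
  by have := perm_size pe; case: (l') cl.
have [s ps es] := perm_iotaP (T := {classic scol (OnS_sig m R)}) x pe.
by rewrite es -permute_nth; [exact: cut_permute|exact: is_perm_lt].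
Qed.

Lemma col_edge n S (c : scol (OnS_sig n S)) : exists _ : edge S, True.
Proof.
elim: n c => [|n IH] c; first by exists c.
by case: c => [c|k]; [exact: IH c | exact: IH (ftgt (val k))].
Qed.

Lemma low_moment_edge n S c : moment_le (moment (OnS_sig n S) c) (inl ord0) ->
  exists e, c = edge_col n e.
Proof.
have [//|[i [-> i0 _]]] := col_cases c.
by rewrite /= leqNgt i0.
Qed.

Lemma moment_edge_root n S (e : edge S) (i : 'I_n.+1) :
  moment (OnS_sig n S) (edge_col n e) = inl i -> val e = [::] /\ i = ord0.
Proof.
have [er|[k ->]] := edge_cases e; last by rewrite moment_nonroot.
by rewrite (moment_root n er) => -[<-].
Qed.

Lemma incr_id n (al : 'I_n.+1 -> 'I_n.+1) : injective al ->
  (forall i j : 'I_n.+1, i <= j -> al i <= al j) -> forall i, al i = i.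
Proof.
move=> inj mono.
have lt (i j : 'I_n.+1) : i < j -> al i < al j.
  move=> ij; rewrite ltn_neqAle mono ?(ltnW ij) // andbT.
  by apply/eqP => /ord_inj /inj e; rewrite e ltnn in ij.
have lo k (kn : k < n.+1) : k <= al (Ordinal kn).
  elim: k kn => // k IH kn; apply: leq_ltn_trans (IH (ltnW kn)) _.
  exact: lt.
have hi k (i : 'I_n.+1) : i + k = n -> al i <= i.
  elim: k i => [|k IH] i e.
    have e' : n <= i by rewrite -[X in _ <= X]addn0 e.
    by apply: leq_trans e'; rewrite -ltnS ltn_ord.
  have sn : i.+1 < n.+1 by have := leq_addr k i.+1; rewrite addSnnS e.
  rewrite -ltnS; apply: leq_trans (IH (Ordinal sn) _); last by rewrite /= addSnnS.
  exact: lt.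
move=> i; apply: ord_inj; apply/eqP; rewrite eqn_leq.
rewrite (hi (n - i)) /=; last by rewrite subnKC // -ltnS.
by have := lo i (ltn_ord i); congr (_ <= al _); apply: ord_inj.
Qed.

Section PlusMinus.
Variables (n : nat) (S R : option ptree).
Variable f : @hom Delta_Omega (n, S) (n, R).
Hypothesis pf : plus f.
Hypothesis mf : minus f.
Notation phi := (colm f).

Lemma pm_obm (i : 'I_n.+1) : obm f (inl i) = inl i.
Proof.
have [al e sur] := minus_obm mf; rewrite e; congr inl; apply: incr_id.
  by move=> j k h; apply: pf.1; rewrite /= !e h.
exact: obm_mono e.
Qed.

Lemma pm_root (r : edge S) : val r = [::] ->
  exists2 r' : edge R, phi (edge_col n r) = edge_col n r' & val r' = [::].
Proof.
move=> er; have m0 : moment _ (phi (edge_col n r)) = inl ord0.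
  by rewrite -obm_moment (moment_root n er) pm_obm.
have [|r' e] := @low_moment_edge n R (phi (edge_col n r)); first by rewrite m0.
by exists r' => //; rewrite e in m0; case: (moment_edge_root m0).
Qed.

Lemma pm_edge (e : edge S) : exists e' : edge R, phi (edge_col n e) = edge_col n e'.
Proof.
have [r er] := root_exists e; apply: low_moment_edge.
have := moment_reach (colm_reach f (root_reach n e er)).
by rewrite -(obm_moment f (edge_col n r)) (moment_root n er) pm_obm.
Qed.

Lemma pm_edge_onto (d : edge R) : exists e : edge S, phi (edge_col n e) = edge_col n d.
Proof.
have [_ /(_ (edge_col n d))[c ec] _] := mf.
have [[e ee]|[i [mc i0 _]]] := col_cases c; first by exists e; rewrite -ee.
have := obm_moment f c; rewrite mc pm_obm ec => /esym /moment_edge_root[_ i1].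
by rewrite i1 in i0.
Qed.

(** If the image of v is not a vertex, some input d of the first vertex w in this
    image is not among its sources. But d is the image of an edge, hence a source
    of the image of the vertex u below that edge. The image of u contains w and
    starts strictly below w, so that u is a counterexample closer to the root. *)
Lemma pm_vertex (v : vertex S) : exists2 w : vertex R,
  edge_col n (vertex_output w) = phi (edge_col n (vertex_output v)) &
  forall z, mem_of z (map phi (sin (vertex_gen n v))) <-> mem_of z (sin (vertex_gen n w)).
Proof.
have [d ed] := pm_edge (vertex_output v).
move: {2}(size (val d)).+1 (ltnSn (size (val d))) => N.
elim: N v d ed => // N IH v d ed; rewrite ltnS => sd.
have cv : cut (map phi (sin (vertex_gen n v))) (edge_col n d).
  by rewrite -ed -sout_vertex_gen; apply: colm_cut; exact: gen_cut.
have nid : map phi (sin (vertex_gen n v)) <> [:: edge_col n d].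
  move=> e; have : mem_of (edge_col n d) (map phi (sin (vertex_gen n v))) by rewrite e; left.
  rewrite -ed => /mem_of_map[x mx /(colm_inj pf) ex].
  apply: (@forest_acyclic _ (forest_OnS n S) (vertex_gen n v) x) => //.
  by rewrite sout_vertex_gen ex; exact: reach_refl.
have [g eg] := cut_gen_exists cv nid.
have [w ew ow] := gen_over_edge eg; exists w; first by rewrite ow ed.
have win z : mem_of z (sin (vertex_gen n w)) -> mem_of z (map phi (sin (vertex_gen n v))).
  rewrite sin_vertex_gen => /mem_of_map[dj mj <-].
  have /mem_inputs[j ej] := mj; rewrite -[val w]/(val (vertex_output w)) ow in ej.
  have [cj ecj] := pm_edge_onto dj.
  have [p0 [i0 ei]] : exists p i, val cj = rcons p i.
    case/lastP E : (val cj) => [|p i]; last by exists p, i.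
    have [r' er' vr'] := pm_root E.
    have := etrans (esym ecj) er' => /edge_col_inj e.
    by move: ej; rewrite e vr'; case: (val d).
  have [u eu mu] := edge_rcons ei.
  have [d' ed'] := pm_edge (vertex_output u).
  have mfj : mem_of (edge_col n dj) (map phi (sin (vertex_gen n u))).
    by rewrite -ecj sin_vertex_gen; do 2!(apply/mem_of_map; eexists; last by []).
  have cu : cut (map phi (sin (vertex_gen n u))) (edge_col n d').
    by rewrite -ed' -sout_vertex_gen; apply: colm_cut; exact: gen_cut.
  have [x /edge_col_inj ex] := reach_edgeP (cut_reach cu mfj).
  rewrite -{}ex ej => p.
  have [e|pd] : val d' = rcons (val d) j \/ prefix (val d') (val d).
    case/prefixP: p => q; case/lastP: q => [|q y]; first by rewrite cats0; left.
    by rewrite -rcons_cat => /rcons_inj[e _]; right; apply/prefixP; exists q.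
  + have ee : d' = dj by apply: edge_eq; rewrite e.
    rewrite ee -ecj in ed'; have /edge_col_inj eo := colm_inj pf ed'.
    have /mem_inputs[y ey] := mu; move: ey; rewrite -eo /= => /(congr1 size).
    by rewrite size_rcons => /eqP; rewrite ltn_eqF.
  + case: (ltngtP (size (val d')) (size (val d))) => sz.
    * have [w' ow' hw'] := IH u d' ed' (leq_trans sz sd).
      have := (hw' _).1 mfj; rewrite sin_vertex_gen => /mem_of_map[t mt /edge_col_inj et].
      have /mem_inputs[y] := mt; rewrite et ej => /rcons_inj[e _].
      rewrite ed' in ow'; have /edge_col_inj e' := ow'.
      have e1 : val d' = val d by rewrite -e'; exact: esym e.
      by rewrite e1 ltnn in sz.
    * by have := size_prefix pd; rewrite leqNgt sz.
    * have ee : d' = d.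
        apply: edge_eq; case/prefixP: pd sz => q ->; rewrite size_cat.
        by case: q => [|y q]; rewrite ?cats0 //= => /eqP; rewrite -[X in X == _]addn0 eqn_add2l.
      rewrite ee -ed in ed'; have /edge_col_inj eo := colm_inj pf ed'.
      suff uv : u = v by rewrite -uv.
      by apply: val_inj; move/(congr1 val): eo.
move=> z; split=> [mz|]; last exact: win.
rewrite -eg in cv; have [e|h] := cut_generator cv; first by case: nid; rewrite e eg.
have [y my zy] := h z mz; rewrite ew in my.
by rewrite (spread_eq (cut_spread cv) mz (win _ my) (reach_refl _) zy).
Qed.

End PlusMinus.

Section PlusMinus.
Variables (n : nat) (S R : option ptree).
Variable f : @hom Delta_Omega (n, S) (n, R).
Hypothesis pf : plus f.
Hypothesis mf : minus f.
Notation phi := (colm f).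

(** The inverse is determined by the inverse bijection on edges. It sends
    vertices to vertices: as leaves go to leaves, the edge below a vertex w is
    the image of the edge below some vertex v, and w is the image of v. *)
Lemma pm_iso : is_iso f.
Proof.
have /choice[ga ega] := pm_edge_onto pf mf.
have gaK (e : edge S) d : phi (edge_col n e) = edge_col n d -> ga d = e.
  by move=> ed; apply: (@edge_col_inj n S); apply: (colm_inj pf); rewrite ega.
have [||w|g [go gc]] := @hom_exists (n, R) (n, S) (fun i => inl (inord i))
    (fun d => edge_col n (ga d)).
- by move=> i lt; rewrite /= !inordK // ltnW.
- move=> d ed /=; have [r er] := root_exists (ga d).
  have [r' er' vr'] := pm_root pf mf er.
  have e : r' = d by apply: edge_eq; rewrite ed.
  rewrite -e (gaK _ _ er') (moment_root n er); congr inl; apply: ord_inj.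
  by rewrite inordK.
- have [v ev] : exists v, vertex_output v = ga (vertex_output w).
    apply: contrapT => nv; have [_ _ /(_ (ga (vertex_output w)))[|e' le']] := mf.
      by move=> v ev; apply: nv; exists v.
    by rewrite ega => /edge_col_inj e; apply: (le' w).
  have [w' ew' hw] := pm_vertex pf mf v.
  rewrite ev ega in ew'.
  have ww : w' = w by apply: (forest_out (forest_tree R)); exact: edge_col_inj ew'.
  rewrite {w' ew'}ww sin_vertex_gen in hw.
  have e1 : map phi (map (fun d => edge_col n (ga d)) (vertex_inputs w)) = sin (vertex_gen n w).
    by rewrite sin_vertex_gen -map_comp; apply: eq_map => d; exact: ega.
  apply: (@cut_set n S (sin (vertex_gen n v))).
  + by have := gen_cut (vertex_gen n v); rewrite sout_vertex_gen ev.
  + by apply: (@spread_colm _ _ f); rewrite e1; apply: cut_spread (gen_cut _).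
  + have inj z l : mem_of (phi z) (map phi l) <-> mem_of z l.
      by rewrite mem_of_map; split=> [[x mx /(colm_inj pf)<-]//|mz]; exists z.
    by move=> z; rewrite -inj -[in X in _ <-> X]inj e1 sin_vertex_gen -hw.
have gf : g <o> f = idc (c := Delta_Omega) (n, S).
  apply: hom_eq => [i|e].
    by rewrite obm_cmp pm_obm // go inord_val.
  have [e' ee'] := pm_edge pf mf e.
  by rewrite colm_cmp ee' gc (gaK _ _ ee').
have fg : f <o> g = idc (c := Delta_Omega) (n, R).
  apply: hom_eq => [i|e]; first by rewrite obm_cmp go inord_val pm_obm.
  by rewrite colm_cmp gc ega.
by exists g.
Qed.

End PlusMinus.

Lemma plus_minus_iso (a b : Delta_Omega) (f : @hom Delta_Omega a b) :
  plus f -> minus f -> is_iso f.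
Proof.
case: a b f => [n S] [m R] f pf mf.
have [al e sur] := minus_obm mf.
have inj : injective al.
  by move=> i j h; apply: pf.1; rewrite /= !e h.
have /choice[be eb] := sur.
have injb : injective be by move=> i j h; rewrite -(eb i) h eb.
have := leq_card al inj; have := leq_card be injb; rewrite !card_ord !ltnS => le ge.
have nm : n = m by apply/eqP; rewrite eqn_leq le ge.
by move: {al e sur inj be eb injb le ge} f pf mf; rewrite nm => f; exact: pm_iso.
Qed.

Section IsoClasses.
Variables a b : Delta_Omega.
Variables (f : @hom Delta_Omega a b) (g : @hom Delta_Omega b a).
Hypothesis gf : g <o> f = idc a.
Hypothesis fg : f <o> g = idc b.

Lemma obm_isoK x : obm g (obm f x) = x.
Proof. by rewrite -obm_cmp gf. Qed.
Lemma obm_isoVK x : obm f (obm g x) = x.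
Proof. by rewrite -obm_cmp fg. Qed.
Lemma colm_isoK x : colm g (colm f x) = x.
Proof. by rewrite -colm_cmp gf. Qed.
Lemma colm_isoVK x : colm f (colm g x) = x.
Proof. by rewrite -colm_cmp fg. Qed.

Lemma iso_plus : plus f.
Proof.
split=> [i j e|e e' h].
  by have := congr1 (obm g) e; rewrite !obm_isoK => -[].
by have := congr1 (colm g) h; rewrite !colm_isoK => /edge_col_inj.
Qed.

(** Assume that f and its inverse send [n] and [m] to non-root edges k and k'.
    Then they send the roots to k and k', and applying f to the fact that k'
    lies above the root of a.2 shows that the root of b.2 lies above k. Leaves
    are preserved because they are the edges whose only operation is the
    identity. *)
Lemma iso_minus : minus f.
Proof.
split.
- have [[al ea]|[k ek]] := obm_cases f; have [[be eb]|[k' ek']] := obm_cases g.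
  + by move=> j; exists (be j); rewrite -eb obm_isoVK.
  + by have := obm_isoK (inl ord0); rewrite ea ek'.
  + by have := obm_isoVK (inl ord0); rewrite eb ek.
  + have [r er] := root_exists (val k'); have [r' er'] := root_exists (val k).
    have e1 : colm f (edge_col a.1 r) = edge_col b.1 (val k).
      by apply: moment_inr; rewrite -obm_moment (moment_root a.1 er) ek.
    have e2 : colm g (edge_col b.1 r') = edge_col a.1 (val k').
      by apply: moment_inr; rewrite -obm_moment (moment_root b.1 er') ek'.
    have := colm_reach f (root_reach a.1 (val k') er).
    rewrite e1 -e2 colm_isoVK => /reach_edgeP[e /edge_col_inj <-].
    by rewrite er' prefixs0 => /eqP kr; have := valP k; rewrite /= kr.
- by move=> c; exists (colm g c); rewrite colm_isoVK.
- move=> e le; suff /leaf_colP[e' ee' le'] : forall w : sgen (OnS_sig b.1 b.2),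
      sout w <> colm f (edge_col a.1 e) by exists e'.
  move=> w ew; have cw := colm_cut g (gen_cut w); rewrite ew colm_isoK in cw.
  have /leaf_colP nl : exists2 e', edge_col a.1 e = edge_col a.1 e' & is_leaf e' by exists e.
  have e1 : map (colm g) (sin w) = [:: edge_col a.1 e].
    apply: contrapT => ne; have [v ev] := cut_gen_exists cw ne; exact: nl ev.
  case E : (sin w) e1 => [|d [|]] //= [ed].
  apply: (@forest_acyclic _ (forest_OnS b.1 b.2) w d); first by rewrite E; left.
  by rewrite ew -ed colm_isoVK; exact: reach_refl.
Qed.

End IsoClasses.

Lemma plus_minus_isoP (a b : Delta_Omega) (f : @hom Delta_Omega a b) :
  plus f /\ minus f <-> is_iso f.
Proof.
split=> [[pf mf]|[g [gf fg]]]; first exact: plus_minus_iso.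
by split; [exact: iso_plus gf|exact: iso_minus gf fg].
Qed.

(** * Finiteness *)

Definition embeds_in_finite (T : Type) : Prop :=
  exists (F : finType) (f : T -> F), injective f.

Lemma finite_setT T : embeds_in_finite T -> finite_set [set: {classic T}].
Proof.
move=> [F [f inj]].
have := @finite_preimage {classic T} F setT f (in2W inj) finite_finset.
by rewrite preimage_setT.
Qed.

Lemma embeds_inj T U (f : T -> U) : injective f -> embeds_in_finite U -> embeds_in_finite T.
Proof. by move=> inj [F [g injg]]; exists F, (fun x => g (f x)) => x y /injg /inj. Qed.

Lemma cardinal_inj T U (f : T -> U) : embeds_in_finite U -> injective f ->
  cardinal T <= cardinal U /\ (cardinal T = cardinal U -> forall u, exists t, f t = u).
Proof.
move=> fU inj; have fT := embeds_inj inj fU.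
have {}fU := finite_setT fU; have {}fT := finite_setT fT.
pose f' : {classic T} -> {classic U} := f.
pose A := fset_set [set: {classic T}]; pose B := fset_set [set: {classic U}].
have sub : (f' @` A `<=` B)%fset.
  by apply/fsubsetP => u _; rewrite in_fset_set // in_setT.
have cA : #|` (f' @` A)%fset| = #|` A| by rewrite card_imfset.
split; first by rewrite /cardinal -/A -/B -cA; exact: fsubset_leq_card.
rewrite /cardinal -/A -/B => e u.
have /eqP eq : (f' @` A)%fset == B by rewrite eqEfcard sub cA e leqnn.
have : (u : {classic U}) \in B by rewrite in_fset_set // in_setT.
by rewrite -eq => /imfsetP[t _ ->]; exists t.
Qed.

Lemma ptree_nested_ind (P : ptree -> Prop) : P PEdge ->
  (forall ts, conj_seq P ts -> P (PNode ts)) -> forall t, P t.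
Proof.
move=> h1 h2; fix IH 1 => -[|ts]; first exact: h1.
apply: h2; elim: ts => [|t ts IHts]; first exact: I.
by split; [exact: IH|exact: IHts].
Qed.

Lemma subtree_None p : subtree None p = None.
Proof. by elim: p. Qed.

Lemma addresses S : exists s : seq (seq nat), forall p, isSome (subtree S p) -> p \in s.
Proof.
case: S => [t|]; last by exists [::] => p; rewrite subtree_None.
elim/ptree_nested_ind: t => [|ts IH].
  by exists [:: [::]] => -[|i p] //=; rewrite subtree_None.
have [s hs] : exists s : seq (seq nat),
    forall i p, isSome (subtree (onth ts i) p) -> i :: p \in s.
  elim: ts IH => [_|t ts IHts /= [[s hs] /IHts[s' hs']]].
    by exists [::] => i p; rewrite onth0n subtree_None.
  exists ([seq 0 :: p | p <- s] ++ [seq (head 0 p).+1 :: behead p | p <- s']).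
  move=> [|i] p /= h; rewrite mem_cat; apply/orP; [left|right].
    by apply: map_f; exact: hs.
  by apply/mapP; exists (i :: p) => //; exact: hs'.
exists ([::] :: s) => -[|i p] //= h.
by rewrite in_cons hs.
Qed.

Lemma finite_edge S : embeds_in_finite (edge S).
Proof.
have [s hs] := addresses S.
exists ('I_(size s).+1), (fun e => inord (index (val e) s)) => e e'.
move=> /(congr1 (@nat_of_ord _)); rewrite !inordK ?ltnS ?index_size // => h.
have := hs _ (valP e); have := hs _ (valP e').
by move=> m m'; apply: edge_eq; rewrite -(nth_index [::] m) -(nth_index [::] m') h.
Qed.

(** An operation being determined by its target and its set of sources, there
    are finitely many operations when there are finitely many colors. *)
Lemma finite_fmor (G : signature) : forest G -> embeds_in_finite (scol G) ->
  embeds_in_finite (fmor G).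
Proof.
move=> fG [F [f inj]].
exists (F * {set F})%type, (fun h => (f (ftgt h), [set x in map f (fsrc h)])).
move=> h h' [/inj et es]; apply: (fmor_thin fG) => // x.
have e z : mem_of x (fsrc z) <-> f x \in [set y in map f (fsrc z)].
  rewrite inE -mem_ofE mem_of_map.
  by split=> [m|[y m /inj <-]//]; exists x.
by rewrite !e es.
Qed.

Lemma finite_col n S : embeds_in_finite (scol (OnS_sig n S)).
Proof.
elim: n => [|n IH] /=; first exact: finite_edge.
have [F [f fi]] := IH; have [F' [f' fi']] := finite_fmor (forest_OnS n S) IH.
exists (F + F')%type, (fun c => match c with inl c => inl (f c) | inr k => inr (f' (val k)) end).
by move=> [c|k] [c'|k'] //= [] => [/fi ->|/fi' /val_inj ->].
Qed.

Lemma finite_gen n S : embeds_in_finite (gen n S).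
Proof. exact: embeds_inj (forest_out (forest_OnS n S)) (finite_col n S). Qed.

(** * Induction from the leaves, and the cut through all leaves *)

Lemma edge_up_ind S (P : edge S -> Prop) :
  (forall e, (forall v, vertex_output v = e ->
     forall d, mem_of d (vertex_inputs v) -> P d) -> P e) ->
  forall e, P e.
Proof.
move=> step; have [s hs] := addresses S.
pose D := \max_(p <- s) size p.
have bound (e : edge S) : size (val e) <= D.
  by apply: (leq_bigmax_seq (F := size)) => //; apply: hs; exact: (valP e).
move=> e; move: {2}(D - size (val e)) (erefl (D - size (val e))) => N.
elim: N e => [|N IH] e eN; apply: step => v ev d /mem_inputs[i ei].
all: have sd : size (val d) = (size (val e)).+1 by rewrite ei size_rcons -ev.
  by have := bound d; rewrite sd ltnNge -subn_eq0 eN.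
by apply: IH; rewrite sd subnS eN.
Qed.

Lemma prefix_step S (e x : edge S) : prefix (val e) (val x) -> x <> e ->
  exists2 v, vertex_output v = e & exists2 d, mem_of d (vertex_inputs v) & prefix (val d) (val x).
Proof.
case/prefixP => -[|i q] ex ne; first by case: ne; apply: edge_eq; rewrite ex cats0.
have := valP x; rewrite /= ex -cat_rcons subtree_cat => h.
have hd : isSome (subtree S (rcons (val e) i)).
  by case: (subtree S _) h => //; rewrite subtree_None.
pose d : edge S := exist (fun p => isSome (subtree S p)) _ hd.
have [v ev mv] := @edge_rcons S d (val e) i erefl.
exists v; first exact: edge_eq.
by exists d => //=; rewrite prefix_prefix.
Qed.

(** The operation that expands the edge e completely. *)
Lemma leaf_cut n S (e : edge S) : exists2 l, cut l (edge_col n e) &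
  forall x : edge S, is_leaf x -> prefix (val e) (val x) -> mem_of (edge_col n x) l.
Proof.
elim/edge_up_ind: e => e IH.
case: (pselect (is_leaf e)) => [le|nl].
  exists [:: edge_col n e]; first exact: cut_id.
  move=> x lx px; left; congr edge_col; apply: contrapT => ne.
  have [|v ev _] := prefix_step px; last exact: le ev.
  by move=> xe; apply: ne.
have [v ev] : exists v, vertex_output v = e.
  by apply: contrapT => h; apply: nl => v ev; apply: h; exists v.
have [q eq hq] : exists2 q : seq (seq (scol (OnS_sig n S)) * scol (OnS_sig n S)),
    map snd q = sin (vertex_gen n v) &
    conj_seq (fun p => cut p.1 p.2) q /\
    forall d x, mem_of d (vertex_inputs v) -> is_leaf x -> prefix (val d) (val x) ->
      mem_of (edge_col n x) (flatten (map fst q)).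
  rewrite sin_vertex_gen; have := IH v ev; elim: (vertex_inputs v) => [|d l IHl] h.
    by exists [::].
  have [|q eq [cq hq]] := IHl; first by move=> x mx; apply: h; right.
  have [k ck hk] := h d (or_introl erefl).
  exists ((k, edge_col n d) :: q) => /=; first by rewrite eq.
  split=> // d' x [<-|md] lx px; apply/mem_of_cat; [left; exact: hk|right; exact: hq px].
exists (flatten (map fst q)).
  apply: cut_comp; last exact: hq.1.
  by rewrite eq -ev -sout_vertex_gen; exact: gen_cut.
move=> x lx px; have [|v' ev' [d md pd]] := prefix_step px.
  by move=> xe; apply: (lx v); rewrite ev.
have vv : v' = v by apply: (forest_out (forest_tree S)); rewrite /= ev ev'.
by rewrite vv in md; apply: hq.2 md lx pd.
Qed.

(** * Degrees *)

(** A leaf cannot be expanded: if it is an input of the first generator of an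
    operation, it remains a source of the operation. *)
Lemma cut_leaf_input m R (g : sgen (OnS_sig m R)) l d : cut l (sout g) ->
  l <> [:: sout g] -> mem_of d (sin g) ->
  (forall g' : sgen (OnS_sig m R), sout g' <> d) -> mem_of d l.
Proof.
move=> /[dup] cl /cut_op[[[c|g' ts] w] et es] nl md nd.
  by case: nl; apply: cut_out => //; apply/es; left.
have eg : g' = g by apply: (forest_out (forest_OnS m R)).
have [e _] := w; rewrite eg in e; rewrite -e in md.
have /mem_of_map[t mt et'] := md.
apply/es; rewrite /fsrc /= mem_of_flatten; exists (tleaves t).
  by apply/mem_of_map; exists t.
by case: t {mt} et' => [c|g'' ts'] /= e'; [left | case: (nd g'')].
Qed.

Lemma edge_inhab S (e : edge S) : isSome S.
Proof. by have [r er] := root_exists e; have := valP r; rewrite /= er. Qed.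

Lemma isSome_edge S : isSome S -> exists _ : edge S, True.
Proof. by move=> h; exists (exist (fun p => isSome (subtree S p)) [::] h). Qed.

Section PlusDegree.
Variables (a b : Delta_Omega) (f : @hom Delta_Omega a b).
Hypothesis pf : plus f.

(** By injectivity of f, the image of a generator is not an identity. *)
Lemma plus_gen (g : gen a.1 a.2) : exists w : gen b.1 b.2, sout w = colm f (sout g).
Proof.
have cg := colm_cut f (gen_cut g); apply: (cut_gen_exists cg) => e.
have : mem_of (colm f (sout g)) (map (colm f) (sin g)) by rewrite e; left.
move=> /mem_of_map[x mx /(colm_inj pf) ex].
apply: (@forest_acyclic _ (forest_OnS a.1 a.2) g x) => //.
by rewrite ex; exact: reach_refl.
Qed.

Lemma plus_level : a.1 <= b.1.
Proof.
have [[al e]|[k e]] := obm_cases f.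
  have inj : injective al by move=> i j h; apply: pf.1; rewrite /= !e h.
  by have := leq_card al inj; rewrite !card_ord.
have := pf.1 ord0 ord_max; rewrite !e => /(_ erefl) /(congr1 (@nat_of_ord _)) /= <-.
by [].
Qed.

Lemma plus_gen_card : cardinal (gen a.1 a.2) <= cardinal (gen b.1 b.2) /\
  (cardinal (gen a.1 a.2) = cardinal (gen b.1 b.2) ->
   forall w : gen b.1 b.2, exists g : gen a.1 a.2, sout w = colm f (sout g)).
Proof.
have /choice[G hG] := plus_gen.
have inj : injective G.
  move=> g g' e; apply: (forest_out (forest_OnS a.1 a.2)); apply: (colm_inj pf).
  by rewrite -!hG e.
have [le sur] := cardinal_inj (finite_gen b.1 b.2) inj; split=> // e w.
by have [g <-] := sur e w; exists g.
Qed.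

Lemma plus_some : isSome a.2 -> isSome b.2.
Proof.
move=> /isSome_edge[e _]; have [e' _] := col_edge (colm f (edge_col a.1 e)).
exact: edge_inhab e'.
Qed.

(** If f hits the outputs of all generators, it hits all colors but perhaps leaf
    edges. Such an edge is the root or an input of some vertex w, and then it is
    a source of the image of the generator whose output goes to that of w. *)
Lemma plus_surjective_minus : a.1 = b.1 -> isSome a.2 = isSome b.2 ->
  (forall w : gen b.1 b.2, exists g : gen a.1 a.2, sout w = colm f (sout g)) -> minus f.
Proof.
move=> ab sab hg.
(* Otherwise [n] goes to a non-root edge k and all values of f lie above k; but
   the root of b.2 is the output of a vertex, and must be hit. *)
have [al eal] : exists al : 'I_a.1.+1 -> 'I_b.1.+1, forall i, obm f (inl i) = inl (al i).
  have [//|[k ek]] := obm_cases f.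
  have a0 : a.1 = 0.
    by have := pf.1 ord0 ord_max; rewrite !ek => /(_ erefl) /(congr1 (@nat_of_ord _)) /= <-.
  have [v ev] : exists v : vertex b.2, val v = [::].
    have nv : is_node (subtree b.2 [::]).
      have := valP (val k); have := valP k; rewrite /=.
      case: (val (val k)) => [//|i p] _; case: (b.2) => [[|ts]|] //=; by rewrite subtree_None.
    by exists (exist (fun p => is_node (subtree b.2 p)) _ nv).
  have [g eg] := hg (vertex_gen b.1 v).
  have [[e ee]|[i [_ i0 _]]] := col_cases (sout g); last first.
    have li : i <= a.1 by rewrite -ltnS ltn_ord.
    suff : 0 < a.1 by rewrite {1}a0.
    exact: leq_trans i0 li.
  have [r er] := root_exists e.
  have er' : colm f (edge_col a.1 r) = edge_col b.1 (val k).
    by apply: moment_inr; rewrite -obm_moment (moment_root a.1 er) ek.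
  have := colm_reach f (root_reach a.1 e er).
  rewrite er' -ee -eg sout_vertex_gen => /reach_edgeP[x /edge_col_inj <-].
  rewrite /= ev prefixs0 => /eqP ke.
  by have := valP k; rewrite /= ke.
have ali : injective al by move=> i j h; apply: pf.1; rewrite /= !eal h.
have [be _ alK] : bijective al by apply: inj_card_bij => //; rewrite !card_ord ab.
have lf (e : edge a.2) : is_leaf e -> exists2 e' : edge b.2, is_leaf e' &
    colm f (edge_col a.1 e) = edge_col b.1 e'.
  move=> le.
  have /leaf_colP nl : exists2 e', edge_col a.1 e = edge_col a.1 e' & is_leaf e' by exists e.
  have /leaf_colP[e' ee' le'] : forall w : gen b.1 b.2, sout w <> colm f (edge_col a.1 e).
    by move=> w ew; have [g eg] := hg w; rewrite ew in eg; apply: (nl g); apply: (colm_inj pf).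
  by exists e'.
split=> //; first by move=> j; exists (be j); rewrite eal alK.
move=> c; case: (pselect (exists w : gen b.1 b.2, sout w = c)) => [[w <-]|nw].
  by have [g ->] := hg w; exists (sout g).
have {}nw (w : gen b.1 b.2) : sout w <> c by move=> ew; apply: nw; exists w.
have /leaf_colP[d ed ld] := nw.
case/lastP E : (val d) => [|p j].
  have [r0 _] : exists _ : edge a.2, True.
    by apply: isSome_edge; rewrite sab; exact: edge_inhab d.
  have [r er] := root_exists r0; exists (edge_col a.1 r).
  have m0 : moment _ (colm f (edge_col a.1 r)) = inl ord0.
    rewrite -obm_moment (moment_root a.1 er) eal; congr inl; apply: ord_inj => /=.
    apply/eqP; rewrite -leqn0 -[X in _ <= X]/(nat_of_ord (ord0 : 'I_b.1.+1)) -(alK ord0).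
    exact: (obm_mono eal).
  have [|r' er'] := @low_moment_edge b.1 b.2 (colm f (edge_col a.1 r)); first by rewrite m0.
  rewrite er' in m0; have [vr' _] := moment_edge_root m0.
  by rewrite er' ed; congr edge_col; apply: edge_eq; rewrite vr' E.
have [w ew mw] := edge_rcons E.
have [g eg] := hg (vertex_gen b.1 w).
have cg := colm_cut f (gen_cut g); rewrite -eg in cg.
have := cut_leaf_input cg _ _ nw; rewrite ed sin_vertex_gen => h.
have /mem_of_map[x _ ex] : mem_of (edge_col b.1 d) (map (colm f) (sin g)).
  apply: h; last by apply/mem_of_map; exists d.
  move=> e; have : mem_of (sout (vertex_gen b.1 w)) (map (colm f) (sin g)) by rewrite e; left.
  rewrite eg => /mem_of_map[x mx /(colm_inj pf) ex].
  apply: (@forest_acyclic _ (forest_OnS a.1 a.2) g x) => //.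
  by rewrite ex; exact: reach_refl.
by exists x.
Qed.

Lemma eq_leq_add p q p' q' : p <= p' -> q <= q' -> p' + q' <= p + q -> p = p' /\ q = q'.
Proof.
move=> h1 h2 h3; have e1 : p = p'.
  apply/eqP; rewrite eqn_leq h1 -(leq_add2r q); apply: leq_trans h3.
  by rewrite leq_add2l.
by split=> //; apply/eqP; rewrite eqn_leq h2 -(leq_add2l p) {1}e1.
Qed.

Lemma plus_same_degree : degree b <= degree a -> isSome a.2 = isSome b.2 -> is_iso f.
Proof.
move=> d s; have [c h] := plus_gen_card; have [e1 e2] := eq_leq_add plus_level c d.
by apply: plus_minus_iso => //; apply: plus_surjective_minus => //; apply: h.
Qed.

Lemma plus_shifted_lt : ~ is_iso f -> shifted_degree a < shifted_degree b.
Proof.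
move=> ni; rewrite ltnNge; apply/negP => h; apply: ni.
have [c _] := plus_gen_card.
have d : degree a <= degree b by apply: leq_add => //; exact: plus_level.
have s : (isSome a.2 : nat) <= isSome b.2 by case: (isSome a.2) plus_some => // ->.
have [e1 e2] := eq_leq_add d s h.
apply: plus_same_degree; first by rewrite e1.
by move: e2; case: (isSome a.2) (isSome b.2) => [] [].
Qed.

(** The case to exclude is that of equal degrees, a.2 empty and b.2 not empty.
    Then b has no generators: [m] has no object 1, over which there would be
    adjoined operations, and b.2 has no vertices. *)
Lemma plus_degree_lt : ~ is_iso f -> ~ (a = (0, None) /\ b = (0, Some PEdge)) ->
  degree a < degree b.
Proof.
move=> ni ne; rewrite ltnNge; apply/negP => h; apply: ni.
have [c hc] := plus_gen_card; have [e1 e2] := eq_leq_add plus_level c h.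
apply: plus_same_degree => //.
case sb : (isSome b.2); case sa : (isSome a.2) => //; last by have := plus_some sa; rewrite sb.
have no_gen (w : gen b.1 b.2) : False.
  have [g _] := hc e2 w; have [e _] := col_edge (sout g).
  by have := edge_inhab e; rewrite sa.
have [r0 _] := isSome_edge sb.
have b0 : b.1 = 0.
  apply/eqP; rewrite -leqn0 leqNgt; apply/negP => b0.
  have [x mx] := moment_exists r0 (ord_max : 'I_b.1.+1).
  have [[e ee]|[i [_ _ [g _]]]] := col_cases x; last exact: no_gen g.
  rewrite ee in mx; have [_ /(congr1 (@nat_of_ord _)) /= e0] := moment_edge_root mx.
  by rewrite e0 in b0.
case: ne; move: sa sb e1 b0 no_gen; case: (a) => n [?|] //; case: (b) => m [t|] //= _ _ -> -> ng.
split=> //; case: t ng => // ts ng; case: (ng _).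
exact: (exist (fun p => is_node (subtree (Some (PNode ts)) p)) [::] isT).
Qed.

End PlusDegree.

Section MinusDegree.
Variables (a b : Delta_Omega) (f : @hom Delta_Omega a b).
Hypothesis mf : minus f.

(** Generators lift because colors do and leaves go to leaves. *)
Lemma minus_gen (w : gen b.1 b.2) : exists g : gen a.1 a.2, colm f (sout g) = sout w.
Proof.
have [_ sur lf] := mf; have [c ec] := sur (sout w).
case: (pselect (exists g : gen a.1 a.2, sout g = c)) => [[g eg]|ng].
  by exists g; rewrite eg.
have /leaf_colP[e ee le] : forall g : gen a.1 a.2, sout g <> c.
  by move=> g eg; apply: ng; exists g.
have [e' le' ee'] := lf e le.
have /leaf_colP nl : exists2 d, sout w = edge_col b.1 d & is_leaf d.
  by exists e' => //; rewrite -ee' -ee ec.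
by case: (nl w).
Qed.

Lemma minus_level : b.1 <= a.1.
Proof.
have [al _ sur] := minus_obm mf; have /choice[be eb] := sur.
have inj : injective be by move=> i j h; rewrite -(eb i) h eb.
by have := leq_card be inj; rewrite !card_ord.
Qed.

Lemma minus_some : isSome a.2 = isSome b.2.
Proof.
case sa : (isSome a.2); case sb : (isSome b.2) => //.
  have [e _] := isSome_edge sa; have [e' _] := col_edge (colm f (edge_col a.1 e)).
  by have := edge_inhab e'; rewrite sb.
have [e _] := isSome_edge sb; have [_ /(_ (edge_col b.1 e))[c _] _] := mf.
by have [e' _] := col_edge c; have := edge_inhab e'; rewrite sa.
Qed.

(** When there are as many generators on both sides, lifting generators is
    bijective, so that f is injective on non-leaf edges. Distinct leaf edges are
    sources of a common operation, so that their images are distinct too. *)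
Lemma minus_same_degree : degree a <= degree b -> is_iso f.
Proof.
have /choice[G hG] := minus_gen.
have injG : injective G.
  by move=> w w' e; apply: (forest_out (forest_OnS b.1 b.2)); rewrite -!hG e.
have [c sur] := cardinal_inj (finite_gen a.1 a.2) injG.
move=> d; have [e1 e2] := eq_leq_add minus_level c d.
apply: plus_minus_iso => //; split.
  have [al eal /choice[be eb]] := minus_obm mf => i j /=; rewrite !eal => -[].
  have injb : injective be by move=> x y h; rewrite -(eb x) h eb.
  have [be' _ beK] : bijective be by apply: inj_card_bij => //; rewrite !card_ord e1.
  by rewrite -(beK i) -(beK j) !eb => ->.
have leaf_or (e : edge a.2) : is_leaf e \/ exists2 v, vertex_output v = e &
    exists w, G w = vertex_gen a.1 v.
  case: (pselect (is_leaf e)) => [|nl]; [by left|right].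
  have [v ev] : exists v, vertex_output v = e.
    by apply: contrapT => h; apply: nl => v ev; apply: h; exists v.
  by exists v => //; exact: sur.
have lf (e : edge a.2) w : is_leaf e -> sout w <> colm f (edge_col a.1 e).
  move=> le ew; have [_ _ /(_ e le)[e' le' ee']] := mf.
  have /leaf_colP nl : exists2 d, colm f (edge_col a.1 e) = edge_col b.1 d & is_leaf d by exists e'.
  exact: nl ew.
move=> e e' /= h; have [le|[v ev [w ew]]] := leaf_or e; have [le'|[v' ev' [w' ew']]] := leaf_or e'.
- have [r er] := root_exists e; have [l cl hl] := leaf_cut a.1 r.
  apply: (@edge_col_inj a.1 a.2).
  apply: (spread_map_inj (cut_spread (colm_cut f cl)) _ _ h).
    by apply: hl; rewrite // er prefix0s.
  by apply: hl; rewrite // er prefix0s.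
- by case: (lf _ w' le); rewrite h -ev' -sout_vertex_gen -ew' hG.
- by case: (lf _ w le'); rewrite -h -ev -sout_vertex_gen -ew hG.
- have ww : w = w'.
    apply: (forest_out (forest_OnS b.1 b.2)).
    by rewrite -!hG ew ew' !sout_vertex_gen ev ev'.
  by apply: (@edge_col_inj a.1 a.2); rewrite -ev -ev' -!sout_vertex_gen -ew -ew' ww.
Qed.

Lemma minus_degree_lt : ~ is_iso f -> degree b < degree a.
Proof. by move=> ni; rewrite ltnNge; apply/negP => h; apply/ni/minus_same_degree. Qed.

Lemma minus_shifted_lt : ~ is_iso f -> shifted_degree b < shifted_degree a.
Proof. by move=> ni; rewrite /shifted_degree minus_some ltn_add2r; exact: minus_degree_lt. Qed.

Lemma minus_degree_le : degree b <= degree a.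
Proof.
have /choice[G hG] := minus_gen.
have injG : injective G.
  by move=> w w' e; apply: (forest_out (forest_OnS b.1 b.2)); rewrite -!hG e.
have [c _] := cardinal_inj (finite_gen a.1 a.2) injG.
by apply: leq_add => //; exact: minus_level.
Qed.

End MinusDegree.

Lemma iso_degree (a b : Delta_Omega) (f : @hom Delta_Omega a b) : is_iso f ->
  degree a = degree b /\ isSome a.2 = isSome b.2.
Proof.
move=> fi; have [_ mf] := (plus_minus_isoP f).2 fi.
have [g [gf fg]] := fi.
have gi : is_iso g by exists f.
have [_ mg] := (plus_minus_isoP g).2 gi.
split; last exact: minus_some mf.
by apply/eqP; rewrite eqn_leq (minus_degree_le mf) (minus_degree_le mg).
Qed.

(** * Elementary degeneracies *)

(** A degeneracy sigma with its section s. The last condition serves to deduce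
    from the negativity of f that of f s when f factors through sigma. The
    section need not preserve leaves: when the input of a contracted vertex is a
    leaf, the section used for the contraction sends it to the output of the
    vertex. *)
Record degeneracy (a a' : Delta_Omega) (sigma : @hom Delta_Omega a a')
    (s : @hom Delta_Omega a' a) : Prop := Degeneracy {
  deg_minus : minus sigma;
  deg_section : sigma <o> s = idc a';
  deg_not_plus : ~ plus sigma;
  deg_leaf : forall e' : edge a'.2, is_leaf e' -> exists2 e : edge a.2, is_leaf e &
    colm sigma (edge_col a.1 e) = edge_col a'.1 e' }.

Lemma degeneracy_minus a a' b (sigma : @hom Delta_Omega a a') s (f : @hom Delta_Omega a b) :
  degeneracy sigma s ->
  f <o> s <o> sigma = f ->
  minus f -> minus (f <o> s).
Proof.
move=> [ms _ _ hl] e [f1 f2 f3]; split.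
- move=> j; have [i ei] := f1 j; have [al eal _] := minus_obm ms.
  by exists (al i); rewrite -eal -obm_cmp e.
- by move=> c; have [c' ec] := f2 c; exists (colm sigma c'); rewrite -colm_cmp e.
- move=> e' le'; have [e0 le0 <-] := hl e' le'; have [e1 le1 ee1] := f3 e0 le0.
  by exists e1 => //; rewrite -colm_cmp e.
Qed.

Lemma edges_cut m R (v : vertex R) :
  cut (map (@edge_col m R) (vertex_inputs v)) (edge_col m (vertex_output v)).
Proof. by rewrite -sin_vertex_gen -sout_vertex_gen; exact: gen_cut. Qed.

Section LevelDegeneracy.
Variables (n : nat) (S : option ptree) (b : Delta_Omega) (f : @hom Delta_Omega (n.+1, S) b).
Variables (i : 'I_n.+2) (j : 'I_n.+2).
Hypothesis ij : i < j.
Hypothesis fij : obm f (inl i) = obm f (inl j).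

Let lt_in : i < n.+1.
Proof. by rewrite -ltnS; apply: leq_trans (ltn_ord j). Qed.

(** A functor to a poset that identifies i and j identifies everything in
    between. *)
Lemma obm_consecutive : obm f (inl (inord i.+1)) = obm f (inl i).
Proof.
have v : (inord i.+1 : 'I_n.+2) = i.+1 :> nat by rewrite inordK.
have h1 : hom (obm f (inl i)) (obm f (inl (inord i.+1))).
  by apply: obm_hom; rewrite /= v.
have h2 : hom (obm f (inl (inord i.+1))) (obm f (inl j)).
  by apply: obm_hom; rewrite /= v.
move: h1 h2; rewrite -fij; case: (obm f (inl i)) => [p|k]; case: (obm f _) => [q|k'] //= h1 h2.
  by congr inl; apply: ord_inj; apply/eqP; rewrite eqn_leq h1 h2.
by rewrite h1.
Qed.

(** The degeneracy of [n] that identifies i and i+1, and the section that skips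
    i+1. *)
Lemma level_degeneracy : exists (a' : Delta_Omega) (sigma : @hom Delta_Omega (n.+1, S) a') s,
  degeneracy sigma s /\ f <o> s <o> sigma = f.
Proof.
have [|||sigma [so sc]] := @hom_exists (n.+1, S) (n, S)
  (fun k => inl (inord (if k <= i then k else k.-1))) (@edge_col n S).
- move=> /= k lk; have := lt_in.
  by case: (leqP k i) => h; case: (leqP k.+1 i) => h' lt; rewrite !inordK /=; lia.
- by move=> e ee; rewrite (moment_root n ee) /=; congr inl; apply: ord_inj; rewrite inordK.
- exact: edges_cut.
rewrite /= in so sc.
have [|||s [to tc]] := @hom_exists (n, S) (n.+1, S)
  (fun k => inl (inord (if k <= i then k else k.+1))) (@edge_col n.+1 S).
- move=> /= k lk; have := lt_in.
  by case: (leqP k i) => h; case: (leqP k.+1 i) => h' lt; rewrite !inordK /=; lia.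
- by move=> e ee; rewrite (moment_root n.+1 ee) /=; congr inl; apply: ord_inj; rewrite inordK.
- exact: edges_cut.
rewrite /= in to tc.
have ss : sigma <o> s = idc ((n, S) : Delta_Omega).
  apply: hom_eq => [/= k|/= e]; last by rewrite colm_cmp tc sc.
  rewrite obm_cmp to so /=; congr inl; apply: ord_inj; have lk : k < n.+1 := ltn_ord k.
  case: (leqP k i) => h.
    by rewrite (inordK (m := k)) ?h ?inordK //=; lia.
  rewrite (inordK (m := k.+1)) ?ltnS // ifF; last by move=> /=; lia.
  by rewrite inordK.
exists (n, S), sigma, s; split; last first.
  apply: hom_eq => [/= k|/= e]; last by rewrite !colm_cmp sc tc.
  rewrite !obm_cmp so to; have lk : k < n.+2 := ltn_ord k; have lt := lt_in.
  case: (leqP k i) => h.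
    rewrite (inordK (m := k)) ?h; last by move=> /=; lia.
    by congr (obm f (inl _)); exact: inord_val.
  rewrite (inordK (m := k.-1)); last by move=> /=; lia.
  case: (leqP k.-1 i) => h'.
    have ek : k = inord i.+1 by apply: ord_inj; rewrite inordK //=; lia.
    rewrite [in RHS]ek obm_consecutive; congr (obm f (inl _)); apply: ord_inj.
    by rewrite inordK /=; lia.
  by congr (obm f (inl _)); apply: ord_inj; rewrite inordK /=; lia.
split=> //.
- split.
  + move=> /= k; have lk : k < n.+1 := ltn_ord k; have lt := lt_in.
    case: (leqP k i) => h.
      exists (inord k); rewrite so inordK ?h; last by move=> /=; lia.
      by congr inl; exact: inord_val.
    exists (inord k.+1); rewrite so inordK; last by move=> /=; lia.
    rewrite ifF; last by move=> /=; lia.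
    by congr inl; exact: inord_val.
  + by move=> c; exists (colm s c); rewrite -colm_cmp ss.
  + by move=> e le; exists e => //; rewrite sc.
- move=> [h _]; have lt := lt_in.
  have vi : (inord i.+1 : 'I_n.+2) = i.+1 :> nat by rewrite inordK /=; lia.
  have : (inord i.+1 : 'I_n.+2) = i.
    by apply: h; rewrite /= !so vi leqnn ifF //=; lia.
  by move/(congr1 (@nat_of_ord _)); rewrite vi; lia.
- by move=> e le; exists e => //; rewrite sc.
Qed.

End LevelDegeneracy.

(** * Contracting a unary vertex *)

(** Removal of the vertex at address p, whose only input takes the place of its
    output. *)
Fixpoint contract (t : ptree) (p : seq nat) : ptree :=
  match p, t with
  | [::], PNode ts => head PEdge ts
  | i :: q, PNode ts => PNode (set_nth PEdge ts i (contract (nth PEdge ts i) q))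
  | _, PEdge => PEdge
  end.

(** What the signature of a tree depends on at a given address. *)
Definition shape_of (t : option ptree) : option (option nat) :=
  omap (fun t => if t is PNode ts then Some (size ts) else None) t.

Lemma shape_isSome t t' : shape_of t = shape_of t' -> isSome t = isSome t'.
Proof. by case: t t' => [t|] [t'|]. Qed.

Lemma shape_is_node t t' : shape_of t = shape_of t' -> is_node t = is_node t'.
Proof. by case: t t' => [[|ts]|] [[|ts']|]. Qed.

Lemma shape_arity t t' : shape_of t = shape_of t' -> arity t = arity t'.
Proof. by case: t t' => [[|ts]|] [[|ts']|] //= [->]. Qed.

Lemma onth_set_nth T (x0 : T) s i y j : i < size s ->
  onth (set_nth x0 s i y) j = if j == i then Some y else onth s j.
Proof. by elim: s i j => [|x s IH] [|i] [|j] //= /IH. Qed.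

Lemma onth_lt T (x0 : T) s i : i < size s -> onth s i = Some (nth x0 s i).
Proof. by move=> h; rewrite onthE (nth_map x0). Qed.

Section Contract.
Variables (p : seq nat) (t : ptree).
Hypothesis unary : arity (subtree (Some t) p) = 1.

Lemma contract_above r :
  subtree (Some (contract t p)) (p ++ r) = subtree (Some t) (p ++ 0 :: r).
Proof.
elim: p t unary => [|i q IH] [|ts] //=; first by case: ts => [|t' []].
  by rewrite subtree_None.
case: (ltnP i (size ts)) => h; last by rewrite onth_default // subtree_None.
rewrite onth_set_nth // eqxx (onth_lt PEdge h) => a.
exact: IH.
Qed.

Lemma contract_away x : ~~ prefix p x ->
  shape_of (subtree (Some (contract t p)) x) = shape_of (subtree (Some t) x).
Proof.
elim: p t unary x => [|i q IH] [|ts] //= a x; first by rewrite prefix0s.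
case: (ltnP i (size ts)) => h; last by move: a; rewrite onth_default // subtree_None.
rewrite (onth_lt PEdge h) in a.
case: x => [|j x] /=; first by rewrite size_set_nth (maxn_idPr h).
rewrite onth_set_nth // eq_sym.
case: (eqVneq j i) => [->|//] /= npx; rewrite (onth_lt PEdge h); exact: IH.
Qed.

(** The effect of the contraction on addresses of edges, and its section that
    chooses the lower one of the two edges that get identified. The other choice
    would not be compatible with the identity of [n] when p is the root: the
    root of the contracted tree has moment 0, unlike the upper edge. *)
Definition qaddr (x : seq nat) : seq nat :=
  if prefix (rcons p 0) x then p ++ drop (size p).+1 x else x.

Definition saddr (x : seq nat) : seq nat :=
  if prefix p x && (x != p) then p ++ 0 :: drop (size p) x else x.

Lemma qaddr_above r : qaddr (p ++ 0 :: r) = p ++ r.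
Proof.
by rewrite /qaddr -cat_rcons prefix_prefix drop_size_cat // size_rcons.
Qed.

Lemma qaddr_at : qaddr p = p.
Proof.
rewrite /qaddr; case: ifP => // /size_prefix; by rewrite size_rcons ltnn.
Qed.

Lemma qaddr_away x : ~~ prefix p x -> qaddr x = x.
Proof.
rewrite /qaddr => n; rewrite ifF //; apply/negbTE; apply: contra n.
by apply: prefix_trans; exact: prefix_rcons.
Qed.

Lemma saddr_above i r : saddr (p ++ i :: r) = p ++ 0 :: i :: r.
Proof.
rewrite /saddr prefix_prefix drop_size_cat // ifT //.
apply/eqP => /(congr1 size) /eqP; rewrite size_cat /= -[X in _ == X]addn0.
by rewrite eqn_add2l.
Qed.

Lemma saddr_at : saddr p = p.
Proof. by rewrite /saddr eqxx andbF. Qed.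

Lemma saddr_away x : ~~ prefix p x -> saddr x = x.
Proof. by rewrite /saddr => /negbTE ->. Qed.

Lemma prefix_cases x : ~~ prefix p x \/ exists r, x = p ++ r.
Proof.
by case h : (prefix p x); [right; exact/prefixP|left].
Qed.

Lemma saddrK x : qaddr (saddr x) = x.
Proof.
have [n|[[|i r] ->]] := prefix_cases x.
- by rewrite saddr_away // qaddr_away.
- by rewrite cats0 saddr_at qaddr_at.
- by rewrite saddr_above qaddr_above.
Qed.

Lemma prefix_rcons_away x i : ~~ prefix p x -> prefix p (rcons x i) -> rcons x i = p.
Proof.
move=> n /prefixP[r]; case/lastP: r => [|r j]; first by rewrite cats0.
by rewrite -rcons_cat => /rcons_inj[e _]; case/negP: n; rewrite e prefix_prefix.
Qed.

Lemma qaddr_rcons_away x i : ~~ prefix p x -> qaddr (rcons x i) = rcons x i.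
Proof.
move=> n; case h : (prefix p (rcons x i)); last by rewrite qaddr_away ?h.
by rewrite (prefix_rcons_away n h) qaddr_at.
Qed.

Lemma saddr_rcons_away x i : ~~ prefix p x -> saddr (rcons x i) = rcons x i.
Proof.
move=> n; case h : (prefix p (rcons x i)); last by rewrite saddr_away ?h.
by rewrite (prefix_rcons_away n h) saddr_at.
Qed.

Notation S := (Some t).
Notation S' := (Some (contract t p)).

Lemma edge_above x : isSome (subtree S x) ->
  [\/ ~~ prefix p x, x = p | exists r, x = p ++ 0 :: r].
Proof.
have [n|[r ->]] := prefix_cases x => h; first exact: Or31.
case: r h => [|i r]; first by rewrite cats0 => _; exact: Or32.
rewrite -cat_rcons subtree_cat => h.
have : isSome (subtree S (rcons p i)).
  by case: (subtree S _) h => //; rewrite subtree_None.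
rewrite subtree_rcons unary ltnS leqn0 => /eqP ->.
by apply: Or33; exists r; rewrite cat_rcons.
Qed.

Lemma qaddr_shape x : isSome (subtree S x) -> x <> p ->
  shape_of (subtree S' (qaddr x)) = shape_of (subtree S x).
Proof.
move=> /edge_above[n _|//|[r ->] _].
- by rewrite qaddr_away // contract_away.
- by rewrite qaddr_above contract_above.
Qed.

Lemma node_at : is_node (subtree S p).
Proof. by case: (subtree S p) unary => [[]|]. Qed.

Lemma edge_at : isSome (subtree S p).
Proof. by case: (subtree S p) node_at => [[|ts]|]. Qed.

Lemma edge_at0 : isSome (subtree S (rcons p 0)).
Proof. by rewrite subtree_rcons unary. Qed.

Lemma qaddr_edge x : isSome (subtree S x) -> isSome (subtree S' (qaddr x)).
Proof.
move=> h; case: (eqVneq x p) => [->|/eqP ne].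
  rewrite qaddr_at -{2}(cats0 p) contract_above cats1; exact: edge_at0.
by rewrite (shape_isSome (qaddr_shape h ne)).
Qed.

Lemma saddr_shape x : x <> p ->
  shape_of (subtree S (saddr x)) = shape_of (subtree S' x).
Proof.
have [n _|[[|i r] ->]] := prefix_cases x; last 2 first.
- by rewrite cats0.
- by move=> _; rewrite saddr_above contract_above.
- by rewrite saddr_away // contract_away.
Qed.

Lemma saddr_edge x : isSome (subtree S' x) -> isSome (subtree S (saddr x)).
Proof.
case: (eqVneq x p) => [-> _|/eqP ne]; first by rewrite saddr_at edge_at.
by rewrite (shape_isSome (saddr_shape ne)).
Qed.

Definition qedge (e : edge S) : edge S' :=
  exist (fun x => isSome (subtree S' x)) (qaddr (val e)) (qaddr_edge (valP e)).

Definition sedge (e : edge S') : edge S :=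
  exist (fun x => isSome (subtree S x)) (saddr (val e)) (saddr_edge (valP e)).

Lemma sedgeK e : qedge (sedge e) = e.
Proof. by apply: edge_eq; exact: saddrK. Qed.

Lemma is_leafE (U : option ptree) (e : edge U) : is_leaf e <-> ~~ is_node (subtree U (val e)).
Proof.
split=> [le|/negP nn v ev]; last by apply: nn; rewrite -ev; exact: (valP v).
apply/negP => h; apply: (le (exist (fun x => is_node (subtree U x)) _ h)).
exact: edge_eq.
Qed.

Lemma map_edge_inj (U : option ptree) (l l' : seq (edge U)) : map val l = map val l' -> l = l'.
Proof. by apply: inj_map; exact: val_inj. Qed.

Lemma map_inputs (U U' : option ptree) (h : edge U -> edge U') (k : seq nat -> seq nat)
    (v : vertex U) (v' : vertex U') :
  (forall e, val (h e) = k (val e)) ->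
  arity (subtree U (val v)) = arity (subtree U' (val v')) ->
  (forall i, k (rcons (val v) i) = rcons (val v') i) ->
  map h (vertex_inputs v) = vertex_inputs v'.
Proof.
move=> hk ar kr; apply: map_edge_inj; rewrite val_inputs -ar.
have -> : map val (map h (vertex_inputs v)) = map k (map val (vertex_inputs v)).
  by rewrite -!map_comp; apply: eq_map => e; exact: hk.
by rewrite val_inputs -map_comp; apply: eq_map => i; exact: kr.
Qed.

(** The contracted vertex goes to an identity, the others to vertices. *)
Lemma qedge_cut n (v : vertex S) :
  cut (map (fun e => edge_col n (qedge e)) (vertex_inputs v))
    (edge_col n (qedge (vertex_output v))).
Proof.
rewrite map_comp; case: (eqVneq (val v) p) => [vp|/eqP vp].
  suff -> : map qedge (vertex_inputs v) = [:: qedge (vertex_output v)] by exact: cut_id.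
  apply: map_edge_inj.
  have -> : map val (map qedge (vertex_inputs v)) = map qaddr (map val (vertex_inputs v)).
    by rewrite -!map_comp.
  rewrite val_inputs.
  apply: (etrans _ (congr1 (fun x => [:: qaddr x]) (esym vp))); rewrite vp unary.
  by rewrite /= -cats1 qaddr_above cats0 qaddr_at.
have sh := qaddr_shape (valP (vertex_output v)) vp.
have nv : is_node (subtree S' (qaddr (val v))).
  by rewrite (shape_is_node sh); exact: (valP v).
pose v' : vertex S' := exist (fun x => is_node (subtree S' x)) _ nv.
rewrite (map_inputs (k := qaddr) (v' := v')) //.
- suff -> : qedge (vertex_output v) = vertex_output v' by exact: edges_cut.
  exact: edge_eq.
- exact/esym/shape_arity.
- move=> i; rewrite -[val v']/(qaddr (val v)).
  have [n0|//|[r ->]] := edge_above (valP (vertex_output v) : isSome (subtree S (val v))).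
    by rewrite qaddr_rcons_away // qaddr_away.
  by rewrite rcons_cat rcons_cons !qaddr_above rcons_cat.
Qed.

(** The vertex at p of the contracted tree is lifted to the composite of the
    vertex at p with the one above it. *)
Lemma sedge_cut n (v : vertex S') :
  cut (map (fun e => edge_col n (sedge e)) (vertex_inputs v))
    (edge_col n (sedge (vertex_output v))).
Proof.
rewrite map_comp; case: (eqVneq (val v) p) => [vp|/eqP vp].
  have e0 : subtree S' p = subtree S (rcons p 0).
    by rewrite -{2}(cats0 p) contract_above cats1.
  have nu : is_node (subtree S (rcons p 0)).
    by have := valP v; rewrite /= -[sval v]/(val v) vp e0.
  pose u : vertex S := exist (fun x => is_node (subtree S x)) _ nu.
  pose w : vertex S := exist (fun x => is_node (subtree S x)) _ node_at.
  rewrite (map_inputs (k := saddr) (v' := u)) //; last 2 first.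
  - by rewrite vp e0.
  - by move=> i; rewrite vp -cats1 saddr_above /= -!cats1 -catA.
  have -> : sedge (vertex_output v) = vertex_output w.
    by apply: edge_eq; rewrite /= vp saddr_at.
  have iw : vertex_inputs w = [:: vertex_output u].
    by apply: map_edge_inj; rewrite val_inputs /= unary.
  have := @cut_comp n S (edge_col n (vertex_output w))
    [:: (map (@edge_col n S) (vertex_inputs u), edge_col n (vertex_output u))].
  rewrite /= cats0; apply; last by split=> //; exact: edges_cut.
  by have := edges_cut n w; rewrite iw.
have sh := saddr_shape vp.
have nv : is_node (subtree S (saddr (val v))).
  by rewrite (shape_is_node sh); exact: (valP v).
pose v' : vertex S := exist (fun x => is_node (subtree S x)) _ nv.
rewrite (map_inputs (k := saddr) (v' := v')) //.
- suff -> : sedge (vertex_output v) = vertex_output v' by exact: edges_cut.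
  exact: edge_eq.
- exact/esym/shape_arity.
- move=> i; rewrite -[val v']/(saddr (val v)).
  have [n0|[[|j r] e]] := prefix_cases (val v).
  + by rewrite saddr_rcons_away // saddr_away.
  + by case: vp; rewrite e cats0.
  + by rewrite e rcons_cat rcons_cons !saddr_above rcons_cat.
Qed.

Variables (n : nat) (b : Delta_Omega) (f : @hom Delta_Omega (n, S) b).
Variables (v : vertex S) (d : edge S).
Hypothesis vp : val v = p.
Hypothesis dp : val d = rcons p 0.
Hypothesis fvd : colm f (edge_col n d) = colm f (edge_col n (vertex_output v)).

Lemma tree_degeneracy : exists (a' : Delta_Omega) (sigma : @hom Delta_Omega (n, S) a') s,
  degeneracy sigma s /\ f <o> s <o> sigma = f.
Proof.
have mono i : i < n -> @hom (CnS n S') (inl (inord i)) (inl (inord i.+1)).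
  by move=> lt; rewrite /= !inordK // ltnW.
have root0 : (inord 0 : 'I_n.+1) = ord0 by apply: ord_inj; rewrite inordK.
have nprefix0 : prefix (rcons p 0) [::] = false by case: (p).
have [|||sigma [so sc]] := @hom_exists (n, S) (n, S') (fun i => inl (inord i))
  (fun e => edge_col n (qedge e)).
- exact: mono.
- move=> e ee; rewrite root0; apply: moment_root.
  by rewrite /= ee /qaddr nprefix0.
- exact: qedge_cut.
have [|||s [to tc]] := @hom_exists (n, S') (n, S) (fun i => inl (inord i))
  (fun e => edge_col n (sedge e)).
- exact: mono.
- move=> e ee; rewrite root0; apply: moment_root.
  by rewrite /= ee /saddr; case: (p).
- exact: sedge_cut.
rewrite /= in so sc to tc.
have ss : sigma <o> s = idc ((n, S') : Delta_Omega).
  apply: hom_eq => [/= i|/= e]; last by rewrite colm_cmp tc sc sedgeK.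
  by rewrite obm_cmp to so !inord_val.
have ov : vertex_output v = sedge (qedge d).
  apply: edge_eq; rewrite /= dp vp -cats1 qaddr_above cats0.
  by rewrite saddr_at.
exists (n, S'), sigma, s; split; last first.
  apply: hom_eq => [/= i|/= e]; first by rewrite !obm_cmp so to !inord_val.
  rewrite !colm_cmp sc tc.
  have [n0|ep|[[|i r] er]] := edge_above (valP e).
  - by congr (colm f (edge_col n _)); apply: edge_eq; rewrite /= qaddr_away // saddr_away.
  - by congr (colm f (edge_col n _)); apply: edge_eq; rewrite /= ep qaddr_at saddr_at.
  - have -> : e = d by apply: edge_eq; rewrite er dp cats1.
    by rewrite fvd ov.
  - by congr (colm f (edge_col n _)); apply: edge_eq; rewrite /= er qaddr_above saddr_above.
split=> //.
- split.
  + by move=> i; exists i; rewrite so inord_val.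
  + by move=> c; exists (colm s c); rewrite -colm_cmp ss.
  + move=> e /is_leafE le; exists (qedge e); last by rewrite sc.
    apply/is_leafE => /=; rewrite (shape_is_node (qaddr_shape (valP e) _)) //.
    by move=> ep; move: le; rewrite ep node_at.
- move=> [_ h]; have : d = vertex_output v.
    apply: h; rewrite /= !sc; congr edge_col.
    by rewrite ov sedgeK.
  move/(congr1 (fun e : edge S => size (val e))); rewrite /= dp vp size_rcons => /eqP.
  by rewrite gtn_eqF.
- move=> e' /is_leafE le'; have [n0|[r er]] := prefix_cases (val e').
    exists (sedge e'); last by rewrite sc sedgeK.
    by apply/is_leafE; rewrite /= saddr_away // -(shape_is_node (contract_away n0)).
  have er' : subtree S' (val e') = subtree S (p ++ 0 :: r) by rewrite er contract_above.
  have h0 : isSome (subtree S (p ++ 0 :: r)) by rewrite -er'; exact: (valP e').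
  exists (exist (fun x => isSome (subtree S x)) _ h0).
    by apply/is_leafE; rewrite /= -er'.
  by rewrite sc; congr edge_col; apply: edge_eq; rewrite /= qaddr_above er.
Qed.

End Contract.

(** * Factorization *)

(** Above distinct inputs of an operation, a map of colors can identify
    nothing; so two edges can only be identified when one is above the other
    and everything in between collapses. *)
Lemma edges_injective (a b : Delta_Omega) (f : @hom Delta_Omega a b) :
  (forall (v : vertex a.2) d, mem_of d (vertex_inputs v) ->
     colm f (edge_col a.1 d) <> colm f (edge_col a.1 (vertex_output v))) ->
  injective (fun e : edge a.2 => colm f (edge_col a.1 e)).
Proof.
move=> hv.
have above (e : edge a.2) : forall x y : edge a.2,
    prefix (val e) (val x) -> prefix (val e) (val y) ->
    colm f (edge_col a.1 x) = colm f (edge_col a.1 y) -> x = y.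
  elim/edge_up_ind: e => e IH.
  have strict (x : edge a.2) v d : vertex_output v = e -> mem_of d (vertex_inputs v) ->
      prefix (val d) (val x) -> colm f (edge_col a.1 x) <> colm f (edge_col a.1 e).
    move=> ve md dx xe; apply: (hv v d md); rewrite ve.
    apply: (reach_antisym (forest_OnS b.1 b.2)).
      apply: colm_reach; apply: edge_reach; case/mem_inputs: md => i ->.
      by rewrite -ve; exact: prefix_rcons.
    by rewrite -xe; apply: colm_reach; exact: edge_reach.
  move=> x y ex ey xy.
  case: (pselect (x = e)) => [xe|nx]; case: (pselect (y = e)) => [ye|ny].
  - by rewrite xe ye.
  - have [v ve [d md dy]] := prefix_step ey ny.
    by case: (strict y v d ve md dy); rewrite -xy xe.
  - have [v ve [d md dx]] := prefix_step ex nx.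
    by case: (strict x v d ve md dx); rewrite xy ye.
  - have [v ve [d md dx]] := prefix_step ex nx.
    have [v' ve' [d' md' dy]] := prefix_step ey ny.
    have vv : v' = v by apply: (forest_out (forest_tree a.2)); rewrite /= ve ve'.
    rewrite {}vv in ve' md'.
    suff dd : d = d' by apply: (IH v ve d md) xy => //; rewrite dd.
    have sp := cut_spread (colm_cut f (edges_cut a.1 v)).
    have m z : mem_of z (vertex_inputs v) ->
        mem_of (edge_col a.1 z) (map (@edge_col a.1 a.2) (vertex_inputs v)).
      by move=> mz; apply/mem_of_map; exists z.
    apply: (@edge_col_inj a.1 a.2); apply: (spread_map_inj sp (m _ md) (m _ md')).
    apply: (spread_eq (z := colm f (edge_col a.1 x)) sp).
    + by apply/mem_of_map; exists (edge_col a.1 d) => //; exact: m.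
    + by apply/mem_of_map; exists (edge_col a.1 d') => //; exact: m.
    + by apply: colm_reach; exact: edge_reach.
    + by rewrite xy; apply: colm_reach; exact: edge_reach.
move=> x y xy; have [r er] := root_exists x.
by apply: (above r) xy; rewrite er prefix0s.
Qed.

(** If f is injective on [n], it collapses some input d of a vertex v, and d is
    then the only input of v, as the sources of the image of v are spread. *)
Lemma not_plus_degeneracy (a b : Delta_Omega) (f : @hom Delta_Omega a b) : ~ plus f ->
  exists (a' : Delta_Omega) (sigma : @hom Delta_Omega a a') s,
    degeneracy sigma s /\ f <o> s <o> sigma = f.
Proof.
case: a f => n S f np.
case: (pselect (injective (fun i : 'I_n.+1 => obm f (inl i)))) => [inj|ninj]; last first.
  have [i [j [ij e]]] : exists i j : 'I_n.+1, i < j /\ obm f (inl i) = obm f (inl j).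
    apply: contrapT => h; apply: ninj => i j /= e; apply: ord_inj.
    case: (ltngtP i j) => // lt; case: h; first by exists i, j.
    by exists j, i.
  case: n f i j ij e {np ninj} => [|n] f i j ij e.
    by move: ij; rewrite (ord1 i) (ord1 j).
  exact: level_degeneracy ij e.
have [v [d [md e]]] : exists (v : vertex S) d, mem_of d (vertex_inputs v) /\
    colm f (edge_col n d) = colm f (edge_col n (vertex_output v)).
  apply: contrapT => h; apply: np; split=> //; apply: edges_injective => v d md e.
  by apply: h; exists v, d.
have one : vertex_inputs v = [:: d].
  have cv := colm_cut f (edges_cut n v).
  have := cut_out cv; rewrite -e => h.
  have {h} : map (colm f) (map (@edge_col n S) (vertex_inputs v)) = [:: colm f (edge_col n d)].
    by apply: h; do 2!(apply/mem_of_map; eexists; last by []).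
  by case: (vertex_inputs v) md => [|x [|]] //= [->|].
have ar := val_inputs v; rewrite one /= in ar.
have a1 : arity (subtree S (val v)) = 1.
  by have := congr1 size ar; rewrite /= size_map size_iota.
rewrite a1 /= in ar; case: ar => dv.
case: S f v d {inj np md one} e a1 dv => [t|] f v d e a1 dv; last first.
  by have := valP v; rewrite /= subtree_None.
exact: (tree_degeneracy a1 erefl dv e).
Qed.

Lemma degeneracy_degree (a a' : Delta_Omega) (sigma : @hom Delta_Omega a a') s :
  degeneracy sigma s -> degree a' < degree a.
Proof.
move=> [m _ np _]; apply: (minus_degree_lt m) => i; apply: np.
by have [] := (plus_minus_isoP sigma).2 i.
Qed.

(** Pull out degeneracies until the remaining map is positive; this stops as
    they lower the degree. *)
Lemma factorization (a b : Delta_Omega) (f : @hom Delta_Omega a b) :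
  exists (c : Delta_Omega) (g : @hom Delta_Omega c b) (h : @hom Delta_Omega a c),
    [/\ plus g, minus h & f = g <o> h].
Proof.
have [N] := ubnP (degree a); elim: N a f => // N IH a f; rewrite ltnS => dN.
case: (pselect (plus f)) => [pf|/not_plus_degeneracy[a' [sigma [s [ds e]]]]].
  by exists a, f, (idc (c := Delta_Omega) a); split=> //; [exact: minus_id|rewrite cmpc1].
have [c [g [h [pg mh efs]]]] := IH a' (f <o> s) (leq_trans (degeneracy_degree ds) dN).
exists c, g, (h <o> sigma); split=> //; last by rewrite cmpA -efs.
exact: minus_cmp mh (deg_minus ds).
Qed.

(** If a negative map is positive it is invertible; otherwise it factors through
    a degeneracy, and the remaining negative map starts from a lower degree. *)
Lemma minus_split (a b : Delta_Omega) (f : @hom Delta_Omega a b) : minus f ->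
  exists s : @hom Delta_Omega b a, f <o> s = idc (c := Delta_Omega) b.
Proof.
have [N] := ubnP (degree a); elim: N a f => // N IH a f; rewrite ltnS => dN mf.
case: (pselect (plus f)) => [pf|/not_plus_degeneracy[a' [sigma [s [ds e]]]]].
  by have [g [_ fg]] := plus_minus_iso pf mf; exists g.
have [s' es'] := IH a' (f <o> s) (leq_trans (degeneracy_degree ds) dN) (degeneracy_minus ds e mf).
by exists (s <o> s'); rewrite cmpA.
Qed.

(** The comparison of the two middle objects is h' s for a section s of h; all
    identities can be checked after composition with a monomorphism. *)
Lemma factorization_unique (x z y y' : Delta_Omega)
    (g : @hom Delta_Omega y z) (h : @hom Delta_Omega x y)
    (g' : @hom Delta_Omega y' z) (h' : @hom Delta_Omega x y') :
  plus g -> minus h -> plus g' -> minus h' -> g <o> h = g' <o> h' ->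
  exists t : @hom Delta_Omega y y', [/\ is_iso t, t <o> h = h' & g' <o> t = g].
Proof.
move=> pg mh pg' mh' e.
have [s hs] := minus_split mh; have [s' hs'] := minus_split mh'.
have edges (u : Delta_Omega) : (exists _ : edge u.2, True) \/ (edge u.2 -> False).
  by case: (pselect (exists _ : edge u.2, True)) => h0; [left|right=> e0; apply: h0; exists e0].
have gt : g' <o> (h' <o> s) = g by rewrite cmpA -e -cmpA hs cmpc1.
have gt' : g <o> (h <o> s') = g' by rewrite cmpA e -cmpA hs' cmpc1.
exists (h' <o> s); split=> //.
  exists (h <o> s'); split.
  - by apply: (plus_mono pg (edges y)); rewrite cmpA gt' gt cmpc1.
  - by apply: (plus_mono pg' (edges y')); rewrite cmpA gt gt' cmpc1.
apply: (plus_mono pg'); last by rewrite cmpA gt.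
case: (edges x) => [|nx]; [by left|right=> e0].
have := edge_inhab e0; rewrite -(minus_some mh') => /isSome_edge[e1 _].
exact: nx e1.
Qed.

Theorem theorem4p3 :
  exists Rp Rm : mor_class Delta_Omega,
    generalized_reedy Rp Rm shifted_degree /\
    (forall (a b : Delta_Omega) (f : hom a b),
       Rp a b f -> ~ is_iso f ->
       ~ (a = (0, None) /\ b = (0, Some PEdge)) -> degree a < degree b) /\
    (forall (a b : Delta_Omega) (f : hom a b),
       Rm a b f -> ~ is_iso f -> degree b < degree a) /\
    (forall (a b : Delta_Omega) (f : hom a b), is_iso f -> degree a = degree b) /\
    (forall (a b : Delta_Omega_p) (X : hom a b),
       planar_plus X -> Rp a b (Sigma_map X)) /\
    (forall (a b : Delta_Omega_p) (X : hom a b),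
       planar_minus X -> Rm a b (Sigma_map X)).
Proof.
exists (fun a b f => @plus a b f), (fun a b f => @minus a b f).
split; last split; last split; last split; last split.
- split.
  + by split=> [x|x y z f g]; [exact: plus_id|exact: plus_cmp].
  + by split=> [x|x y z f g]; [exact: minus_id|exact: minus_cmp].
  + by move=> x y f pf; exact: plus_shifted_lt.
  + by move=> x y f mf; exact: minus_shifted_lt.
  + by move=> x y f /iso_degree[e1 e2]; rewrite /shifted_degree e1 e2.
  + by move=> x y f; exact: plus_minus_isoP.
  + by move=> x z f; exact: factorization.
  + by move=> x z y y' g h g' h'; exact: factorization_unique.
  + move=> x y f t _ mf tf; have [s fs] := minus_split mf.
    by rewrite -[t]cmpc1 -fs cmpA tf.
- by move=> a b f pf; exact: plus_degree_lt.
- by move=> a b f mf; exact: minus_degree_lt.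
- by move=> a b f /iso_degree[].
- by move=> a b X.
- by move=> a b X.
Qed.
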